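(* Let $n\geqslant 2$, let $D, D'$ be domains in $\overline{\mathbb{R}^n}$, and let $Q:\mathbb{R}^n\to[0,\infty]$ be a Lebesgue measurable function with $Q(x)=0$ for $x\notin D$. Let $g:D'\to D$ be a homeomorphism of $D'$ onto $D$, i.e. $g(D')=D$, whose inverse $f:=g^{-1}:D\to D'$ is a ring $Q$-homeomorphism at every point $x_0\in\partial D$. If $Q\in L^1(D)$ and $y_0$ is an isolated point of the boundary of $D'$, then $g$ has a continuous extension $\overline{g}:D'\cup\{y_0\}\to\overline{\mathbb{R}^n}$ to the point $y_0$.
   Context: $\overline{\mathbb{R}^n}=\mathbb{R}^n\cup\{\infty\}$ is the one-point compactification of $\mathbb{R}^n$. A domain is a nonempty open connected set. Boundaries, closures and continuous extensions are understood in the sense of the space $\overline{\mathbb{R}^n}$. Here $m$ is Lebesgue measure on $\mathbb{R}^n$, and $Q\in L^1(D)$ means $\int_{D\cap\mathbb{R}^n}Q\,dm<\infty$. For $x_0\in\mathbb{R}^n$, $r>0$ and $0<r_1<r_2<\infty$: $S(x_0,r)=\{x\in\mathbb{R}^n:|x-x_0|=r\}$ and $A(x_0,r_1,r_2)=\{x\in\mathbb{R}^n:r_1<|x-x_0|<r_2\}$. For sets $E,F,G$, $\Gamma(E,F,G)$ denotes the family of all continuous paths $\gamma:[a,b]\to\overline{\mathbb{R}^n}$ with $\gamma(a)\in E$, $\gamma(b)\in F$ and $\gamma(t)\in G$ for $t\in(a,b)$. For a path family $\Gamma$ and a map $f:D\to\overline{\mathbb{R}^n}$, $f(\Gamma)=\{f\circ\gamma:\gamma\in\Gamma,\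 \gamma \text{ lies in } D\}$. $M(\Gamma)$ is the conformal modulus of a path family $\Gamma$: $M(\Gamma)=\inf_{\rho}\int_{\mathbb{R}^n}\rho^n(x)\,dm(x)$, the infimum being over all $\rho\in\mathrm{adm}\,\Gamma$, i.e. all Borel functions $\rho:\mathbb{R}^n\to[0,\infty]$ with $\int_\gamma\rho\,ds\geqslant 1$ for every locally rectifiable $\gamma\in\Gamma$ (paths passing through $\infty$ are disregarded). Ring $Q$-homeomorphism at a point: a homeomorphism $f:D\to\overline{\mathbb{R}^n}$ (onto its image) is a ring $Q$-homeomorphism at a finite point $x_0\in\overline{D}$ if there exists $r_0=r_0(x_0)>0$ such that for every $0<r_1<r_2<r_0$, with $A=A(x_0,r_1,r_2)$, $S_1=S(x_0,r_1)$, $S_2=S(x_0,r_2)$, the inequality $$M\big(f(\Gamma(S_1,S_2,A))\big)\leqslant\int_{A}Q(x)\,\eta^n(|x-x_0|)\,dm(x)$$ holds for every measurable function $\eta:(r_1,r_2)\to[0,\infty]$ with $\int_{r_1}^{r_2}\eta(r)\,dr\geqslant 1$. At $x_0=\infty$ the property is defined by means of the inversion $\varphi(x)=x/|x|^2$ (with $\varphi(0)=\infty$, $\varphi(\infty)=0$): $f$ is a ring $Q$-homeomorphism at $\infty$ if $f\circ\varphi$, defined on $\varphi(D)$, is a ring $(Q\circ\varphi)$-homeomorphism at $0$. *)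

(* Defs.v *)
From HB Require Import structures.
From mathcomp Require Import all_boot all_order all_algebra.
From mathcomp Require Import all_classical all_reals all_analysis.
From mathcomp Require Import measurable_realfun.

Set Implicit Arguments.
Unset Strict Implicit.
Unset Printing Implicit Defensive.

Import Order.TTheory GRing.Theory Num.Theory.
Import numFieldNormedType.Exports.

Local Open Scope classical_set_scope.
Local Open Scope ring_scope.

(** [`|x|] on ['rV[R]_n] is the sup norm, hence a separate Euclidean norm. The
  two norms induce the same topology, so the library's topology on ['rV[R]_n]
  is used as it stands. *)

Definition enorm (R : realType) (n : nat) (x : 'rV[R]_n) : R :=
  Num.sqrt (\sum_(i < n) x 0 i ^+ 2).

Definition esphere (R : realType) (n : nat) (x0 : 'rV[R]_n) (r : R) :
    set 'rV[R]_n :=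
  [set x | enorm (x - x0) = r].

Definition eannulus (R : realType) (n : nat) (x0 : 'rV[R]_n) (r1 r2 : R) :
    set 'rV[R]_n :=
  [set x | r1 < enorm (x - x0) < r2].

(** As the library does on the line, Lebesgue measure is obtained from an outer
  measure (here given by countable covers by half-open boxes) by restriction
  to its Caratheodory measurable sets, which are exactly the Lebesgue
  measurable sets. *)

(** [None] is the empty box; it is only needed for n = 0, where every box
  of the form [Some (a, b)] is the whole one-point space. *)
Definition box (R : realType) (n : nat)
    (B : option ('rV[R]_n * 'rV[R]_n)) : set 'rV[R]_n :=
  if B is Some (a, b) then [set x | forall i, a 0 i < x 0 i <= b 0 i]
  else set0.

Definition box_volume (R : realType) (n : nat)
    (B : option ('rV[R]_n * 'rV[R]_n)) : \bar R :=
  if B is Some (a, b) then (\prod_(i < n) Num.max 0 (b 0 i - a 0 i))%:E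
  else 0%E.

Definition lebesgue_outer (R : realType) (n : nat) (X : set 'rV[R]_n) :
    \bar R :=
  ereal_inf [set (\sum_(k <oo) box_volume (B k))%E |
    B in [set B : nat -> option ('rV[R]_n * 'rV[R]_n) |
            X `<=` \bigcup_k box (B k)]].

Section lebesgue_outer_measure.
Local Open Scope ereal_scope.
Context (R : realType) (n : nat).
Local Notation lebesgue_outer := (@lebesgue_outer R n).

Lemma box_volume_ge0 (B : option ('rV[R]_n * 'rV[R]_n)) : 0 <= box_volume B.
Proof.
case: B => [[a b]|] //=; rewrite lee_fin; apply: prodr_ge0 => i _.
by rewrite le_max lexx.
Qed.

Lemma le_lebesgue_outer :
  {homo lebesgue_outer : A B / A `<=` B >-> A <= B}.
Proof.
move=> A B AB; apply/ereal_inf_le_tmp => x [C BC <-{x}].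
by exists C => //; exact: subset_trans BC.
Qed.

Lemma lebesgue_outer_ge0 A : 0 <= lebesgue_outer A.
Proof.
apply: le_ereal_inf_tmp => x [B _ <-{x}].
by apply: nneseries_ge0 => k _ _; exact: box_volume_ge0.
Qed.

Lemma lebesgue_outer0 : lebesgue_outer set0 = 0.
Proof.
apply/eqP; rewrite eq_le; apply/andP; split; last exact: lebesgue_outer_ge0.
apply: ereal_inf_lbound; exists (fun=> None); first by [].
by rewrite eseries0.
Qed.

Lemma lebesgue_outer_sigma_subadditive : sigma_subadditive lebesgue_outer.
Proof.
move=> A; have [[i ioo]|] := pselect (exists i, lebesgue_outer (A i) = +oo).
  rewrite (eseries_pinfty _ _ ioo) ?leey// => k _.
  by rewrite -ltNye (lt_le_trans _ (lebesgue_outer_ge0 _)).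
rewrite -forallNE => Aoo.
suff add2e (e : {posnum R}) : lebesgue_outer (\bigcup_n A n) <=
    \sum_(i <oo) lebesgue_outer (A i) + e%:num%:E.
  by apply/lee_addgt0Pr => _/posnumP[].
rewrite (le_trans _ (epsilon_trick _ _ _))//; last first.
  by move=> k; exact: lebesgue_outer_ge0.
pose P k (B : nat -> option ('rV[R]_n * 'rV[R]_n)) :=
  A k `<=` \bigcup_j box (B j) /\ \sum_(j <oo) box_volume (B j) <=
    lebesgue_outer (A k) + (e%:num / (2 ^ k.+1)%:R)%:E.
have [G PG] : {G & forall k, P k (G k)}.
  apply: (@choice _ _ P) => k; rewrite /P.
  have en1 : (0 < e%:num / (2 ^ k.+1)%:R :> R)%R by [].
  have fA : lebesgue_outer (A k) \is a fin_num.
    by rewrite ge0_fin_numE ?lebesgue_outer_ge0// ltey; apply/eqP.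
  have [_ [B AB <-] Be] := lb_ereal_inf_adherent en1 fA.
  by exists B; split => //; exact/ltW.
pose v (p : nat * nat) := box_volume (G p.1 p.2).
have v_ge0 p : 0 <= v p by exact: box_volume_ge0.
apply: (@le_trans _ _ (\esum_(p in setT) v p)).
  apply: ereal_inf_lbound => /=.
  have /card_esym/ppcard_eqP[h] := card_nat2.
  exists (fun k => G (h k).1 (h k).2).
    move=> t [i _ /(PG i).1[j _ tij]]; exists (h^-1%FUN (i, j)) => //=.
    by rewrite invK ?inE.
  by rewrite -(esum_pred_image v _ xpredT) ?[fun=> _]set_true// image_eq.
rewrite (_ : esum _ _ = \sum_(i <oo) \sum_(j <oo) box_volume (G i j)); last first.
  pose J : nat -> set (nat * nat) := fun i => [set (i, j) | j in setT].
  rewrite (_ : setT = \bigcup_k J k); last first.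
    by rewrite predeqE => -[a b]; split => // _; exists a => //; exists b.
  rewrite esum_bigcupT /=; last 2 first.
    - apply/trivIsetP => i j _ _ ij.
      rewrite predeqE => -[k m] /=; split => //= -[] [_] _ [<-{k} _].
      by move=> [m' _] [] /esym/eqP; rewrite (negbTE ij).
    - by move=> p; exact: v_ge0.
  rewrite -(image_id [set: nat]) -fun_true esum_pred_image//; last first.
    by move=> k _; exact: esum_ge0.
  apply: eq_eseriesr => /= j _.
  rewrite -(esum_pred_image v (pair j) predT)//=; last first.
    by move=> ? ? _ _; exact: (@can_inj _ _ _ snd).
  by congr esum; rewrite predeqE => -[a b]; split; move=> [i _ <-]; exists i.
apply: lee_nneseries => [i _ _|k _]; last exact: (PG k).2.
by apply: nneseries_ge0 => *; exact: box_volume_ge0.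
Qed.

HB.instance Definition _ := isOuterMeasure.Build R 'rV[R]_n lebesgue_outer
  lebesgue_outer0 lebesgue_outer_ge0 le_lebesgue_outer
  lebesgue_outer_sigma_subadditive.

End lebesgue_outer_measure.

(** R^n with the sigma-algebra of Lebesgue measurable sets. *)
Definition lebesgueRn (R : realType) (n : nat) : measurableType _ :=
  caratheodory_type (@lebesgue_outer R n).

Definition lebesgue_measureRn (R : realType) (n : nat) :
    set (caratheodory_type (@lebesgue_outer R n)) -> \bar R :=
  @lebesgue_outer R n.

HB.instance Definition _ (R : realType) (n : nat) :=
  isMeasure.Build _ _ _ (@lebesgue_measureRn R n)
    (@caratheodory_measure0 _ _ (@lebesgue_outer R n))
    (@caratheodory_measure_ge0 _ _ (@lebesgue_outer R n))
    (@caratheodory_measure_sigma_additive _ _ (@lebesgue_outer R n)).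

(** R with the sigma-algebra of Lebesgue measurable sets, the domain of
  [completed_lebesgue_measure]. *)
Definition lebesgueR (R : realType) : measurableType _ :=
  caratheodory_type ((wlength (@idfun R))^*)%mu.

Definition Rbar (R : realType) (n : nat) : topologicalType :=
  one_point_compactification 'rV[R]_n.

Definition fin_pt (R : realType) (n : nat) (x : 'rV[R]_n) : Rbar R n := Some x.

Definition infty_pt (R : realType) (n : nat) : Rbar R n := None.

Definition domain (R : realType) (n : nat) (D : set (Rbar R n)) : Prop :=
  [/\ D !=set0, open D & connected D].

Definition boundary (T : topologicalType) (A : set T) : set T :=
  closure A `\` A°.

(** [f] restricts to a homeomorphism of [A] onto [B] with inverse [g]; the
  values of [f] outside [A] and of [g] outside [B] are irrelevant. *)
Definition homeomorphism (T U : topologicalType) (A : set T) (B : set U)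
    (f : T -> U) (g : U -> T) : Prop :=
  [/\ f @` A = B, {in A, cancel f g},
      {within A, continuous f} & {within B, continuous g}].

Definition homeomorphism_onto_image (T U : topologicalType) (A : set T)
    (f : T -> U) : Prop :=
  exists g : U -> T, homeomorphism A (f @` A) f g.

Definition inversion (R : realType) (n : nat) (x : Rbar R n) : Rbar R n :=
  if x is Some v then
    if v == 0 then infty_pt R n else fin_pt ((enorm v ^+ 2)^-1 *: v)
  else fin_pt 0.

(** [Q \o inversion]; its value at 0, where it would be "Q at infinity", is
  immaterial and set to 0. *)
Definition comp_inversion (R : realType) (n : nat) (Q : 'rV[R]_n -> \bar R) :
    'rV[R]_n -> \bar R :=
  fun x => if inversion (fin_pt x) is Some y then Q y else 0%E.

(** A path [lo, hi] -> Rbar; only the values of [trace] on [lo, hi] matter. *)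
Record curve (R : realType) (n : nat) := Curve {
  lo : R;
  hi : R;
  trace : R -> Rbar R n
}.

Definition connecting_paths (R : realType) (n : nat) (E F G : set (Rbar R n)) :
    set (curve R n) :=
  [set c | [/\ lo c < hi c, {within `[lo c, hi c], continuous (trace c)},
               E (trace c (lo c)), F (trace c (hi c)) &
               forall t, lo c < t < hi c -> G (trace c t)]].

Definition image_paths (R : realType) (n : nat) (D : set (Rbar R n))
    (f : Rbar R n -> Rbar R n) (Gamma : set (curve R n)) : set (curve R n) :=
  [set Curve (lo c) (hi c) (f \o trace c) |
    c in Gamma `&`
         [set c | forall t, lo c <= t <= hi c -> D (trace c t)]].

Definition avoids_infty (R : realType) (n : nat) (c : curve R n) : Prop :=
  forall t, lo c <= t <= hi c -> trace c t <> infty_pt R n.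

Definition finite_trace (R : realType) (n : nat) (c : curve R n) :
    R -> 'rV[R]_n :=
  fun t => if trace c t is Some x then x else 0.

(** Length of the polygon inscribed in [c] with vertices at the parameters
  [a :: s]. *)
Definition polygon_length (R : realType) (n : nat) (c : R -> 'rV[R]_n)
    (a : R) (s : seq R) : R :=
  \sum_(p <- zip (a :: s) s) enorm (c p.2 - c p.1).

Definition arc_length (R : realType) (n : nat) (c : R -> 'rV[R]_n) (a b : R) :
    \bar R :=
  ereal_sup [set (polygon_length c a s)%:E | s in itv_partition a b].

(** On a compact parameter interval, local rectifiability is rectifiability. *)
Definition rectifiable (R : realType) (n : nat) (c : curve R n) : Prop :=
  (arc_length (finite_trace c) (lo c) (hi c) < +oo)%E.

(** The normal representation of a rectifiable path [c]: the parametrization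
  [c0] by arc length, such that [c t = c0 (arc_length c (lo c) t)]. The point
  does not depend on the parameter chosen by [xget], because [c] is constant
  on parameter intervals along which the arc length does not grow. *)
Definition normal_repr (R : realType) (n : nat) (c : curve R n) :
    R -> 'rV[R]_n :=
  fun s => finite_trace c
    (xget (lo c) [set t | lo c <= t <= hi c /\
                          arc_length (finite_trace c) (lo c) t = s%:E]).

Definition line_integral (R : realType) (n : nat) (rho : 'rV[R]_n -> \bar R)
    (c : curve R n) : \bar R :=
  (\int[@lebesgue_measure R]_(
     s in `[0%R, fine (arc_length (finite_trace c) (lo c) (hi c))])
   rho (normal_repr c s))%E.

Definition borel_fun (R : realType) (n : nat) (rho : 'rV[R]_n -> \bar R) :
    Prop :=
  measurable_fun [set: g_sigma_algebraType (@open 'rV[R]_n)] rho.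

Definition admissible (R : realType) (n : nat) (Gamma : set (curve R n)) :
    set ('rV[R]_n -> \bar R) :=
  [set rho | [/\ forall x, (0 <= rho x)%E, borel_fun rho &
     forall c, Gamma c -> avoids_infty c -> rectifiable c ->
       (1 <= line_integral rho c)%E]].

Definition modulus (R : realType) (n : nat) (Gamma : set (curve R n)) : \bar R :=
  ereal_inf [set (\int[@lebesgue_measureRn R n]_x (rho x ^+ n))%E |
              rho in admissible Gamma].

Definition ring_Q_homeomorphism_at_finite (R : realType) (n : nat)
    (D : set (Rbar R n)) (Q : 'rV[R]_n -> \bar R)
    (f : Rbar R n -> Rbar R n) (x0 : 'rV[R]_n) : Prop :=
  homeomorphism_onto_image D f /\
  exists2 r0 : R, 0 < r0 &
    forall r1 r2 : R, 0 < r1 -> r1 < r2 -> r2 < r0 ->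
    forall eta : R -> \bar R,
      measurable_fun (`]r1, r2[ : set (lebesgueR R)) eta ->
      (forall r, r1 < r < r2 -> (0 <= eta r)%E) ->
      (1 <= \int[@completed_lebesgue_measure R]_(r in `]r1, r2[) eta r)%E ->
      (modulus (image_paths D f
         (connecting_paths (@fin_pt R n @` esphere x0 r1)
                           (@fin_pt R n @` esphere x0 r2)
                           (@fin_pt R n @` eannulus x0 r1 r2)))
       <= \int[@lebesgue_measureRn R n]_(x in eannulus x0 r1 r2)
            (Q x * eta (enorm (x - x0)) ^+ n))%E.

Definition ring_Q_homeomorphism_at (R : realType) (n : nat)
    (D : set (Rbar R n)) (Q : 'rV[R]_n -> \bar R)
    (f : Rbar R n -> Rbar R n) (x0 : Rbar R n) : Prop :=
  if x0 is Some x then ring_Q_homeomorphism_at_finite D Q f x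
  else ring_Q_homeomorphism_at_finite (@inversion R n @` D)
         (comp_inversion Q) (f \o @inversion R n) 0.

(* Main.v *)
Require Import Defs.
From HB Require Import structures.
From mathcomp Require Import all_boot all_order all_algebra.
From mathcomp Require Import all_classical all_reals all_analysis.
From mathcomp Require Import measurable_realfun.
From mathcomp Require Import ring lra zify.

(** Suppose that [g] has no limit at [y0]. As Rbar is compact, [g] then has two
  distinct cluster points at [y0] along [D'], and both lie on the boundary of
  [D], because [f] is continuous on [D] and [y0] is not in [D']
  ([cluster_boundary]). One of them is a finite point [x0]. Choose radii
  [r1 < r2] for which the ring property of [f] at [x0] holds and such that the
  other cluster point is farther than [r2] from [x0]. Let Gamma be the family of
  the [f]-images of the paths that join the spheres of radii [r1] and [r2] about
  [x0] in the annulus between them. Two bounds for its modulus contradict each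
  other.

  Upper bound. The ring inequality for the constant function
  [eta = 1 / (r2 - r1)] bounds the modulus by a multiple of the integral of [Q]
  over [D], which is finite ([ring_integral_bound]).

  Lower bound: the modulus is infinite ([ring_modulus_infty]). Let U1 and U2 be
  the open sets of the points of [D'] at which [g] is closer than [r1] to [x0],
  respectively farther than [r2]. Both sets meet all small spheres about [y0]
  (all large spheres if [y0] is infinity): the ball about [x0] and the exterior
  of a ball are connected and contain a point outside [D], so that neither can
  be trapped in the image of a compact shell ([shell_trap]). A path from U1 to
  U2 inside [D'] has a subpath in Gamma ([admissible_crossing]). It remains to
  see that two disjoint open sets which meet all spheres of radii between [s']
  and [2 ^ p * s'] are joined by a family of modulus at least [c * p], with [c]
  depending on the dimension only ([ring_lower_bound]).

  For this last estimate spheres are taken in the sup norm and the space is cut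
  into small cubes, of side [h], say. Let [n = d + 1]. For an admissible [rho],
  a cell [z] has the weight [F z], the integral of [rho] over [z] divided by
  [h ^ d], and the energy [E z], the integral of [rho ^ n] over [z]. Let [u z]
  be the least total weight of a chain of adjacent cells from a cell inside U1
  to [z], cut off at 1. A chain of cells carries a family of parallel polygonal
  paths, one for each point of its first cell; averaging the admissibility of
  [rho] over them shows that [u = 1] on the cells inside U2
  ([chain_inequality]). On the surface of a cube of [2 * k] cells per side, [u]
  thus takes the values 0 and 1. As [n] exceeds the dimension [d] of the faces,
  a discrete Morrey inequality applies ([morrey_osc]) and forces an energy of at
  least [c / k] on this surface ([level_estimate]). Summing over [k] gives the
  logarithm of the ratio of the radii ([sum_levels]).

  Hoelder's inequality [F ^ n <= E] is used in Young's form
  [F <= T + T ^- d * E] for all [T > 0], which needs no roots and leaves [T]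
  free to be tuned to the scale. *)

Set Implicit Arguments.
Unset Strict Implicit.
Unset Printing Implicit Defensive.

Import Order.TTheory GRing.Theory Num.Theory.
Import numFieldNormedType.Exports.

Local Open Scope ring_scope.

(** * Lattice boxes and a discrete Morrey inequality *)

Definition upd n M (x : {ffun 'I_n -> 'I_M}) (i : 'I_n) (t : 'I_M) :
  {ffun 'I_n -> 'I_M} := [ffun j => if j == i then t else x j].

(** Interpolates from [x] at [k = 0] to [y] at [k = n], one coordinate at a
  time. The map sending (x, y) to ([mix k x y], [mix k y x]) is an involution,
  so that sums over pairs can be reindexed by it. *)
Definition mix n M (k : nat) (x y : {ffun 'I_n -> 'I_M}) :
  {ffun 'I_n -> 'I_M} := [ffun j : 'I_n => if (j < k)%N then y j else x j].

Definition adj n M (x y : {ffun 'I_n -> 'I_M}) :=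
  exists2 i, (forall j, j != i -> x j = y j) & y i = (x i).+1 :> nat.

Definition lbox n M (o sd : 'I_n -> nat) : pred {ffun 'I_n -> 'I_M} :=
  [pred x : {ffun 'I_n -> 'I_M} | [forall i, (o i <= x i < o i + sd i)%N]].

Arguments lbox {n} M o sd.

Section cells.
Variables (n M : nat).
Implicit Types (x y : {ffun 'I_n -> 'I_M}).

Lemma updE x i t j : upd x i t j = if j == i then t else x j.
Proof. exact: ffunE. Qed.

Lemma mixE k x y (j : 'I_n) : mix k x y j = if (j < k)%N then y j else x j.
Proof. exact: ffunE. Qed.

Lemma upd_id x i : upd x i (x i) = x.
Proof. by apply/ffunP => j; rewrite updE; case: eqP => [->|]. Qed.

Lemma upd_at x i t : upd x i t i = t.
Proof. by rewrite updE eqxx. Qed.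

Lemma upd_upd x i s t : upd (upd x i s) i t = upd x i t.
Proof. by apply/ffunP => j; rewrite !updE; case: eqP. Qed.

Lemma mixK k x y : mix k (mix k x y) (mix k y x) = x.
Proof. by apply/ffunP => j; rewrite !mixE; case: ifP => ->. Qed.

Lemma mix0 x y : mix 0 x y = x.
Proof. by apply/ffunP => j; rewrite mixE ltn0. Qed.

Lemma mixn x y : mix n x y = y.
Proof. by apply/ffunP => j; rewrite mixE ltn_ord. Qed.

Lemma mixS (k : 'I_n) x y : mix k.+1 x y = upd (mix k x y) k (mix k y x k).
Proof.
apply/ffunP => j; rewrite updE !mixE ltnn ltnS leq_eqVlt.
by rewrite (inj_eq val_inj); case: eqP => [->|].
Qed.

Lemma lboxP o sd x :
  reflect (forall i, (o i <= x i < o i + sd i)%N) (x \in lbox M o sd).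
Proof. exact: forallP. Qed.

Lemma lbox_upd o sd x i (t : 'I_M) : x \in lbox M o sd ->
  (o i <= t < o i + sd i)%N -> upd x i t \in lbox M o sd.
Proof.
move=> /lboxP xQ ti; apply/lboxP => j; rewrite updE.
by case: eqP => [->|].
Qed.

Lemma lbox_mix o sd k x y : x \in lbox M o sd -> y \in lbox M o sd ->
  mix k x y \in lbox M o sd.
Proof.
by move=> /lboxP xQ /lboxP yQ; apply/lboxP => j; rewrite mixE; case: ifP.
Qed.

Lemma card_lbox (o sd : 'I_n -> nat) : (forall i, o i + sd i <= M)%N ->
  #|lbox M o sd| = (\prod_i sd i)%N.
Proof.
move=> oM; rewrite (eq_card (B := family (fun i =>
  [pred t : 'I_M | (o i <= t < o i + sd i)%N]))); last first.
  by move=> x; apply/lboxP/familyP.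
rewrite card_family foldrE big_map big_enum /=.
apply: eq_bigr => i _; rewrite -sum1_card.
have := oM i; move: (o i) (sd i) => a b abM.
rewrite (eq_bigl (fun t : 'I_M => (a <= t < a + b)%N)) //.
transitivity (\sum_(a <= t < a + b) 1)%N; last by rewrite sum_nat_const_nat muln1 addKn.
rewrite (big_nat_widen _ _ _ _ _ abM) big_geq_mkord /=.
by apply: eq_bigl => t; rewrite andbC.
Qed.

End cells.

Section Poincare.
Variables (R : realFieldType) (n M : nat).
Implicit Types (x y : {ffun 'I_n -> 'I_M}).
Variables (o sd : 'I_n -> nat) (u F : {ffun 'I_n -> 'I_M} -> R).
Hypothesis F0 : forall x, 0 <= F x.
Local Notation Q := (lbox M o sd).
Hypothesis lip : forall x y, x \in Q -> y \in Q -> adj x y ->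
  `|u x - u y| <= F x + F y.

(** Each of the unit steps from [x i] up to [t] costs the sum of [F] at its two
  ends. *)
Let line_up k x i (t : 'I_M) : x \in Q -> (o i <= t < o i + sd i)%N ->
  t = (x i + k)%N :> nat ->
  `|u x - u (upd x i t)| <=
    \sum_(s : 'I_M | (x i <= s < t)%N) F (upd x i s) +
    \sum_(s : 'I_M | (x i < s <= t)%N) F (upd x i s).
Proof.
move=> xQ; elim: k t => [|k IH] t tI tE.
  have -> : t = x i by apply/val_inj; rewrite /= tE addn0.
  by rewrite upd_id subrr normr0 addr_ge0 // sumr_ge0.
have tM := ltn_ord t.
have t'M : (x i + k < M)%N by lia.
pose t' := Ordinal t'M.
have t'I : (o i <= t' < o i + sd i)%N.
  by have /lboxP/(_ i) := xQ; rewrite /=; lia.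
have := IH t' t'I erefl => H.
have H2 : `|u (upd x i t') - u (upd x i t)| <= F (upd x i t') + F (upd x i t).
  apply: lip; [exact: lbox_upd|exact: lbox_upd|exists i].
    by move=> j /negbTE ji; rewrite !updE ji.
  by rewrite !upd_at /=; lia.
apply: le_trans (ler_distD (u (upd x i t')) _ _) _.
apply: le_trans (lerD H H2) _.
rewrite (bigD1 t' (P := fun s : 'I_M => (x i <= s < t)%N)) /=; last by lia.
rewrite (bigD1 t (P := fun s : 'I_M => (x i < s <= t)%N)) /=; last by lia.
rewrite [leRHS]addrACA [leLHS]addrC lerD2l lerD //.
- rewrite le_eqVlt; apply/orP; left; apply/eqP/eq_bigl => s.
  by rewrite -(inj_eq val_inj) /=; lia.
- rewrite le_eqVlt; apply/orP; left; apply/eqP/eq_bigl => s.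
  by rewrite -(inj_eq val_inj) /=; lia.
Qed.

(** One unit step at a time: every lattice point of the line is an end of at
  most two steps. *)
Lemma lipschitz_line x i (t : 'I_M) : x \in Q -> (o i <= t < o i + sd i)%N ->
  `|u x - u (upd x i t)| <=
    2 * \sum_(s : 'I_M | (o i <= s < o i + sd i)%N) F (upd x i s).
Proof.
move=> xQ tI.
wlog xt : x t xQ tI / (x i <= t)%N => [th|].
  have [/th|tx] := leqP (x i) t; first exact.
  have xI := elimT (lboxP _ _ _) xQ i.
  have := th (upd x i t) (x i) (lbox_upd xQ tI) xI.
  rewrite upd_at upd_upd upd_id distrC => /(_ (ltnW tx)).
  by under eq_bigr do rewrite upd_upd.
have := line_up (k := t - x i) xQ tI => /(_ _)/le_trans; apply; first lia.
have /lboxP/(_ i) xI := xQ.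
rewrite mulr_natl mulr2n lerD //; rewrite ?big_mkcond /= [leLHS]big_mkcond /=;
 rewrite [leRHS]big_mkcond /=; apply: ler_sum => s _; have := F0 (upd x i s);
 case: ifP => ?; case: ifP => // ?; lia.
Qed.

(** The map sending (x, s) to ([upd x i s], [x i]) is an involution of the index
  set. *)
Let resample_sum i :
  \sum_(x in Q) \sum_(s : 'I_M | (o i <= s < o i + sd i)%N) F (upd x i s) =
  \sum_(x in Q) \sum_(s : 'I_M | (o i <= s < o i + sd i)%N) F x.
Proof.
rewrite !pair_big /=.
rewrite (reindex_onto (fun p : _ * 'I_M => (upd p.1 i p.2, p.1 i))
  (fun p : _ * 'I_M => (upd p.1 i p.2, p.1 i))) /=; last first.
  by move=> [x s] _ /=; rewrite upd_upd upd_id upd_at.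
apply: eq_big => [[x s] /=|[x s] _ /=]; last by rewrite upd_upd upd_id.
rewrite upd_upd upd_id upd_at eqxx andbT.
apply/andP/andP => -[xQ sI]; split.
- by rewrite -(upd_id x i) -(upd_upd x i s); apply: lbox_upd.
- by have /lboxP/(_ i) := xQ; rewrite upd_at.
- exact: lbox_upd.
- by have /lboxP/(_ i) := xQ.
Qed.

(** The difference [u x - u y] telescopes through the points [mix k x y]. After
  reindexing by the involution of pairs given by [mix k], the k-th term is a
  difference along a single line, and averaging the sum of [F] over a line costs
  the factor [l]. *)
Lemma lbox_poincare l : (forall i, sd i <= l)%N ->
  \sum_(x in Q) \sum_(y in Q) `|u x - u y| <=
  (2 * n * l * #|Q|)%:R * \sum_(x in Q) F x.
Proof.
move=> sdl.
have step (k : 'I_n) :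
    \sum_(x in Q) \sum_(y in Q) `|u (mix k x y) - u (mix k.+1 x y)| <=
    (2 * l * #|Q|)%:R * \sum_(x in Q) F x.
  rewrite pair_big /=.
  rewrite (reindex_onto (fun p => (mix k p.1 p.2, mix k p.2 p.1))
    (fun p => (mix k p.1 p.2, mix k p.2 p.1))) /=; last first.
    by move=> [x y] _ /=; rewrite !mixK.
  under eq_bigr do rewrite mixS !mixK.
  rewrite (eq_bigl (fun p => (p.1 \in Q) && (p.2 \in Q))); last first.
    move=> [x y] /=; rewrite !mixK eqxx andbT.
    apply/andP/andP => -[xQ yQ]; split; try exact: lbox_mix.
      by rewrite -(mixK k x y); apply: lbox_mix.
    by rewrite -(mixK k y x); apply: lbox_mix.
  rewrite -(pair_big (mem Q) (mem Q) (fun x y => `|u x - u (upd x k (y k))|)) /=.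
  have H : \sum_(x in Q) \sum_(y in Q) `|u x - u (upd x k (y k))| <=
     \sum_(x in Q) \sum_(y in Q)
      (2 * \sum_(s : 'I_M | (o k <= s < o k + sd k)%N) F (upd x k s)).
    apply: ler_sum => x xQ; apply: ler_sum => y yQ.
    by apply: lipschitz_line => //; have /lboxP := yQ.
  apply: le_trans H _.
  under [leLHS]eq_bigr do rewrite sumr_const -mulrnAl.
  rewrite -mulr_sumr resample_sum.
  have H : \sum_(x in Q) \sum_(s : 'I_M | (o k <= s < o k + sd k)%N) F x <=
     \sum_(x in Q) l%:R * F x.
    apply: ler_sum => x xQ.
    rewrite (eq_bigl (fun s => s \in [pred s : 'I_M | (o k <= s < o k + sd k)%N])) //.
    rewrite sumr_const -[leLHS]mulr_natl ler_wpM2r // ler_nat.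
    apply: leq_trans (sdl k).
    rewrite -sum1_card.
    apply: leq_trans (_ : (\sum_(o k <= t < o k + sd k) 1 <= _)%N); last first.
      by rewrite sum_nat_const_nat muln1 addKn.
    rewrite (eq_bigl (fun t : 'I_M => (o k <= t < o k + sd k)%N)) //.
    rewrite -(big_mkord (fun t => (o k <= t < o k + sd k)%N) (fun=> 1%N)).
    rewrite !sum1_count -!size_filter uniq_leq_size // ?filter_uniq ?iota_uniq //.
    by move=> t; rewrite !mem_filter !mem_index_iota /=; lia.
  apply: le_trans (ler_wpM2l _ H) _; first by rewrite mulrn_wge0.
  have -> : 2 *+ #|Q| = (2 * #|Q|)%:R :> R by rewrite natrM mulr_natr.
  rewrite -mulr_sumr mulrA -natrM.
  by rewrite (_ : (2 * #|Q| * l = 2 * l * #|Q|)%N) //; lia.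
have tele x y : `|u x - u y| <= \sum_(k < n) `|u (mix k x y) - u (mix k.+1 x y)|.
  have : forall m, `|u x - u (mix m x y)| <=
     \sum_(0 <= k < m) `|u (mix k x y) - u (mix k.+1 x y)|.
    elim=> [|m IH]; first by rewrite mix0 subrr normr0 big_geq.
    rewrite big_nat_recr //=; apply: le_trans (ler_distD (u (mix m x y)) _ _) _.
    by rewrite lerD2r.
  by move=> /(_ n); rewrite mixn big_mkord.
apply: le_trans (_ : \sum_(k < n) \sum_(x in Q) \sum_(y in Q)
   `|u (mix k x y) - u (mix k.+1 x y)| <= _).
  rewrite [leRHS]exchange_big; apply: ler_sum => x _.
  by rewrite [leRHS]exchange_big; apply: ler_sum => y _; exact: tele.
apply: le_trans (ler_sum _ (fun k _ => step k)) _.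
rewrite sumr_const card_ord -mulrnAl -mulrnA.
by rewrite (_ : (2 * l * #|Q| * n)%N = (2 * n * l * #|Q|)%N) //; ring.
Qed.

End Poincare.

(** The side lengths of a d-dimensional lattice face orthogonal to [i0] when
  there are d + 1 coordinates. *)
Definition fside n (i0 : 'I_n) (l : nat) (i : 'I_n) : nat :=
  if i == i0 then 1 else l.

Lemma card_face d M (i0 : 'I_d.+1) o l :
  (forall i, o i + fside i0 l i <= M)%N -> #|lbox M o (fside i0 l)| = (l ^ d)%N.
Proof.
move=> oM; rewrite card_lbox // (bigD1 i0) //= {1}/fside eqxx mul1n.
rewrite (eq_bigr (fun=> l)); last by move=> i /negbTE; rewrite /fside => ->.
by rewrite prod_nat_const cardC1 card_ord.
Qed.

Lemma face_point n M (i0 : 'I_n) o (x y : {ffun 'I_n -> 'I_M}) :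
  x \in lbox M o (fside i0 1) -> y \in lbox M o (fside i0 1) -> x = y.
Proof.
move=> /lboxP xQ /lboxP yQ; apply/ffunP => i; apply/val_inj => /=.
by move: (xQ i) (yQ i); rewrite /fside if_same; clear; lia.
Qed.

(** The halved face is anchored at [a], but moved back as far as needed to stay
  inside the given face. Rounding up keeps it nonempty. *)
Lemma half_face n M (i0 : 'I_n) o l (a : {ffun 'I_n -> 'I_M}) : (0 < l)%N ->
  (forall i, o i + fside i0 l i <= M)%N -> a \in lbox M o (fside i0 l) ->
  exists oh, [/\ a \in lbox M oh (fside i0 (uphalf l)),
    {subset lbox M oh (fside i0 (uphalf l)) <= lbox M o (fside i0 l)} &
    forall i, (oh i + fside i0 (uphalf l) i <= M)%N].
Proof.
move=> l0 oM /lboxP aQ; set l' := uphalf l.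
have fs i : (0 < fside i0 l' i <= fside i0 l i)%N.
  by rewrite /fside /l'; case: (i == i0) => //; clear -l0; lia.
exists (fun i => minn (a i) (o i + fside i0 l i - fside i0 l' i)%N).
split=> [|x /lboxP xQ|i].
- by apply/lboxP => i; move: (aQ i) (fs i); clear; lia.
- by apply/lboxP => i; move: (xQ i) (aQ i) (fs i); clear; lia.
- by move: (oM i) (fs i); clear; lia.
Qed.

Lemma leq_expn_base m n k : (m <= n)%N -> (m ^ k <= n ^ k)%N.
Proof. by move=> mn; elim: k => // k IHk; rewrite !expnS leq_mul. Qed.

Lemma bernoulli_inequality (R : realFieldType) (x : R) k :
  0 <= x -> x <= 1 -> 1 - k%:R * x <= (1 - x) ^+ k.
Proof.
move=> x0 x1; elim: k => [|k IH]; first by rewrite mul0r subr0 expr0.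
rewrite exprS; apply: le_trans (ler_wpM2l _ IH); last by rewrite subr_ge0.
rewrite -natr1; have : 0 <= k%:R * (x * x) by rewrite !mulr_ge0.
lra.
Qed.

Section Morrey.
Variables (R : realFieldType) (d M : nat) (i0 : 'I_d.+1).
Variables (u F E : {ffun 'I_d.+1 -> 'I_M} -> R) (Etot : R).
Hypothesis F0 : forall x, 0 <= F x.
Hypothesis E0 : forall x, 0 <= E x.
(* [E] plays the part of the local integral of the power d + 1, [F] that of a local
   mean; this is Hoelder's inequality in Young's form. *)
Hypothesis FE : forall x T, 0 < T -> F x <= T + T ^- d * E x.

(** The factor [2 ^ d] compares the numbers of points of a face and of its
  half. *)
Definition poincare_cst : R := (2 * d.+1 * 2 ^ d)%:R.

(** The factor 9 * (d + 1) is what lets the induction of [morrey_sum] close. *)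
Definition morrey_cst : R := 9 * d.+1%:R * poincare_cst.

Let Q o l := lbox M o (fside i0 l).

(** Morrey's inequality in averaged form, by repeated halving of the face around
  [a]. The average of |u a - u y| over the face is at most the average over the
  half plus a mean oscillation, which the Poincare inequality bounds, with
  [T = tau / l] in [FE]. The induction hypothesis is used for the half with
  [tau] replaced by [th * tau], where [th = 1 - 1 / (4 * (d + 1))]: the term
  [tau] shrinks by the factor [th], and so does, by 8 / 9, the term
  [l * tau ^- d * Etot], since [l] drops to at most 2 / 3 of its value while
  [th ^- d <= 4 / 3]. Both gains together pay for the oscillation. *)
Lemma morrey_sum l o a tau : (0 < l)%N -> (forall i, o i + fside i0 l i <= M)%N ->
  (forall x y, x \in Q o l -> y \in Q o l -> adj x y -> `|u x - u y| <= F x + F y) ->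
  \sum_(x in Q o l) E x <= Etot ->
  a \in Q o l -> 0 < tau ->
  \sum_(y in Q o l) `|u a - u y| <=
    (l ^ d)%:R * (morrey_cst * (tau + l%:R * (tau ^- d * Etot))).
Proof.
have c0 : 0 <= poincare_cst by [].
have K0 : 0 <= morrey_cst by rewrite /morrey_cst !mulr_ge0.
elim/ltn_ind: l o tau => l IH o tau l0 oM lip QE aQ tau0.
have Etot0 : 0 <= Etot by apply: le_trans QE; apply: sumr_ge0.
have X0 : 0 <= tau ^- d * Etot by rewrite mulr_ge0 // invr_ge0 exprn_ge0 // ltW.
have [l1|l1] := leqP l 1.
  have Y0 : 0 <= tau + l%:R * (tau ^- d * Etot) by apply: addr_ge0; [exact: ltW|exact: mulr_ge0].
  rewrite big1 ?mulr_ge0 // => y yQ.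
  suff -> : y = a by rewrite subrr normr0.
  have lE : l = 1%N by apply/eqP; rewrite eqn_leq l1.
  by rewrite /Q lE in aQ yQ; exact: face_point yQ aQ.
have [oh [aQ' Q'Q hM]] := half_face l0 oM aQ.
set l' := uphalf l in aQ' Q'Q hM.
have l'E : (0 < l' < l)%N && (3 * l' <= 2 * l)%N && (l <= 2 * l')%N.
  by rewrite /l'; move: l1; clear; lia.
have /andP[/andP[/andP[l'0 l'l] l'3] l'2] := l'E.
have n0 : 0 < d.+1%:R :> R by [].
have x1 : (4 * d.+1%:R)^-1 <= 1 / 4 :> R.
  rewrite invfM mul1r ler_piMr // ?invr_ge0 //.
  by rewrite invf_le1 // ler1n.
have x0 : 0 < (4 * d.+1%:R)^-1 :> R by rewrite invr_gt0 mulr_gt0.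
set w := (4 * d.+1%:R)^-1 in x0 x1 *.
pose th : R := 1 - w.
have th0 : 0 < th by rewrite /th; lra.
(* By Bernoulli's inequality [th ^+ d >= 1 - d / (4 * (d + 1))]. *)
have thd : 3 / 4 <= th ^+ d.
  apply: le_trans (bernoulli_inequality d (ltW x0) _); last lra.
  have : d%:R * w <= 1 / 4 :> R.
    rewrite /w invfM mulrCA mul1r ler_piMr // ?invr_ge0 //.
    by rewrite ler_pdivrMr // mul1r ler_nat.
  by lra.
have IH' : \sum_(y in Q oh l') `|u a - u y| <= (l' ^ d)%:R *
    (morrey_cst * (th * tau + l'%:R * ((th * tau) ^- d * Etot))).
  apply: IH => //; last by rewrite mulr_gt0.
    by move=> x y xQ yQ; apply: lip; exact: Q'Q.
  apply: le_trans QE; rewrite big_mkcond [leRHS]big_mkcond.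
  apply: ler_sum => x _; have := Q'Q x; rewrite -/(Q _ _); case: ifP => [_ -> //|_ _].
  by case: ifP.
have P1 : \sum_(x in Q oh l') \sum_(y in Q o l) `|u x - u y| <=
    (l ^ d)%:R * (l' ^ d)%:R * (poincare_cst * (tau + l%:R * (tau ^- d * Etot))).
  apply: le_trans (_ : \sum_(x in Q o l) \sum_(y in Q o l) `|u x - u y| <= _).
    rewrite big_mkcond [leRHS]big_mkcond.
    apply: ler_sum => x _; have := Q'Q x; rewrite -/(Q _ _); case: ifP => [_ -> //|_ _].
    by case: ifP => // _; apply: sumr_ge0.
  apply: le_trans (lbox_poincare F0 lip (l := l) _) _.
    by move=> i; rewrite /fside; case: ifP.
  have cQ : #|Q o l| = (l ^ d)%N by exact: card_face.
  have lR : 0 < l%:R :> R by rewrite ltr0n.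
  have SF : \sum_(x in Q o l) F x <= (l ^ d)%:R * (tau / l%:R) +
      (tau / l%:R) ^- d * Etot.
    apply: le_trans (ler_sum _ (fun x _ => FE x (divr_gt0 tau0 lR))) _.
    rewrite big_split /= sumr_const cQ -[_ *+ (l ^ d)]mulr_natl lerD2l -mulr_sumr.
    by rewrite ler_wpM2l // invr_ge0 exprn_ge0 // divr_ge0 // ltW.
  rewrite -/(Q o l) cQ.
  apply: le_trans (ler_wpM2l _ SF) _ => //.
  have -> : (2 * d.+1 * l * l ^ d)%:R * ((l ^ d)%:R * (tau / l%:R) +
      (tau / l%:R) ^- d * Etot) =
     (2 * d.+1)%:R * (l ^ d)%:R * (l ^ d)%:R * (tau + l%:R * (tau ^- d * Etot)) :> R.
    rewrite !natrM natrX expr_div_n invf_div.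
    have : l%:R ^+ d != 0 :> R by rewrite expf_neq0 // gt_eqF.
    have : tau ^+ d != 0 by rewrite expf_neq0 // gt_eqF.
    have : l%:R != 0 :> R by rewrite gt_eqF.
    move: (l%:R ^+ d : R) (tau ^+ d) (l%:R : R) => A B C C0 B0 A0.
    by field; rewrite ?A0 ?B0 ?C0.
  rewrite [leRHS]mulrA; apply: ler_wpM2r; first by apply: addr_ge0; [exact: ltW|exact: mulr_ge0].
  rewrite /poincare_cst -!natrM ler_nat.
  have : (l ^ d <= 2 ^ d * l' ^ d)%N.
    by rewrite -expnMn leq_expn_base.
  move: (l ^ d)%N (2 ^ d)%N (l' ^ d)%N d.+1 => A P B m AB.
  apply: leq_trans (_ : 2 * m * A * (P * B) <= _)%N.
    by rewrite leq_mul2l AB orbT.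
  by rewrite leq_eqVlt; apply/orP; left; apply/eqP; ring.
have cQ : #|Q o l| = (l ^ d)%N by exact: card_face.
have cQ' : #|Q oh l'| = (l' ^ d)%N by exact: card_face.
set Y := tau ^- d * Etot in X0 P1 *.
have l'd0 : 0 < (l' ^ d)%:R :> R by rewrite ltr0n expn_gt0 l'0.
rewrite -(ler_pM2l l'd0).
apply: le_trans (_ : (l ^ d)%:R * (\sum_(y in Q oh l') `|u a - u y|) +
   \sum_(x in Q oh l') \sum_(y in Q o l) `|u x - u y| <= _).
  rewrite [leLHS]mulr_natl -cQ' -sumr_const mulr_sumr -big_split /=.
  apply: ler_sum => x xQ; rewrite mulr_natl -cQ -sumr_const -big_split /=.
  by apply: ler_sum => y _; exact: ler_distD.
apply: le_trans (lerD (ler_wpM2l (ler0n _ _) IH') P1) _.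
rewrite [X in X + _ <= _]mulrA -mulrDr [leRHS]mulrCA [leRHS]mulrA.
apply: ler_wpM2l; first by rewrite mulr_ge0.
(* 8 / 9 = 2 / 3 * 4 / 3. *)
set Z := l'%:R * _; have ZY : Z <= 8 / 9 * (l%:R * Y).
  rewrite /Z /Y exprMn invfM -[_ * Etot]mulrA.
  have : l'%:R <= 2 / 3 * l%:R :> R.
    by rewrite mulrAC ler_pdivlMr // mulrC -!natrM ler_nat.
  have : (th ^+ d)^-1 <= 4 / 3.
    rewrite -[leLHS]mul1r ler_pdivrMr ?exprn_gt0 //.
    by move: thd; lra.
  have : 0 <= (th ^+ d)^-1 by rewrite invr_ge0 exprn_ge0 // ltW.
  rewrite -/Y; move: X0 (ler0n R l') (ler0n R l).
  move: ((th ^+ d)^-1) (l'%:R : R) (l%:R : R) (Y) => T v' v y y0 v'0 v0 T0 T43 v'23.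
  have H1 : v' * T <= 8 / 9 * v.
    apply: le_trans (_ : (2 / 3 * v) * (4 / 3) <= _); last by lra.
    by apply: ler_pM.
  by rewrite [leLHS]mulrA [leRHS]mulrA ler_wpM2r.
have lY0 : 0 <= l%:R * Y by rewrite mulr_ge0.
have Kw : morrey_cst * w = 9 / 4 * poincare_cst.
  rewrite /morrey_cst /w; move: n0; move: (d.+1%:R : R) => m m0.
  by field; rewrite gt_eqF.
have m1 : 1 <= d.+1%:R :> R by rewrite ler1n.
have Km : 9 * poincare_cst <= morrey_cst.
  by rewrite /morrey_cst ler_wpM2r // ler_peMr.
have -> : th = 1 - w by [].
move: c0 K0 Kw Km ZY lY0 tau0; move: (morrey_cst) (poincare_cst) Z (l%:R * Y) => K c Z y c0 K0 Kw cK Zy y0 t0.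
have -> : K * ((1 - w) * tau + Z) = K * tau - (K * w) * tau + K * Z by ring.
rewrite Kw.
have : K * Z <= K * (8 / 9 * y) by exact: ler_wpM2l.
have : 0 <= c * tau by rewrite mulr_ge0 // ltW.
have : 9 * c * y <= K * y by exact: ler_wpM2r.
lra.
Qed.

(** Average |u a - u b| <= |u a - u y| + |u b - u y| over the points [y] of the
  face. *)
Lemma morrey_osc l o a b tau : (0 < l)%N -> (forall i, o i + fside i0 l i <= M)%N ->
  (forall x y, x \in Q o l -> y \in Q o l -> adj x y -> `|u x - u y| <= F x + F y) ->
  \sum_(x in Q o l) E x <= Etot ->
  a \in Q o l -> b \in Q o l -> 0 < tau ->
  `|u a - u b| <= 2 * (morrey_cst * (tau + l%:R * (tau ^- d * Etot))).
Proof.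
move=> l0 oM lip QE aQ bQ tau0.
have Ha := morrey_sum l0 oM lip QE aQ tau0.
have Hb := morrey_sum l0 oM lip QE bQ tau0.
have ld0 : 0 < (l ^ d)%:R :> R by rewrite ltr0n expn_gt0 l0.
rewrite -(ler_pM2l ld0) mulrCA [2 * _]mulr_natl mulr2n.
apply: le_trans (lerD Ha Hb).
rewrite -(card_face oM) mulr_natl -sumr_const -big_split /=.
apply: ler_sum => y _; rewrite [X in _ <= _ + X]distrC; exact: ler_distD.
Qed.

End Morrey.

(** * Energy on the surfaces of lattice cubes *)

(** The cells in the cube of half side [k] about the centre of a grid of [2 * N]
  cells per side. *)
Definition cubek n N k : pred {ffun 'I_n -> 'I_(N + N)} :=
  lbox (N + N) (fun=> N - k)%N (fun=> k + k)%N.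
Arguments cubek : clear implicits.

Definition shellk n N k : pred {ffun 'I_n -> 'I_(N + N)} :=
  [pred x | (x \in cubek n N k) && (x \notin cubek n N k.-1)].
Arguments shellk : clear implicits.

(** The face of the cube [cubek n N k] on which the i-th coordinate is [v]; it
  belongs to the surface of the cube when [is_end v]. *)
Definition facek n N k (i : 'I_n) (v : nat) : pred {ffun 'I_n -> 'I_(N + N)} :=
  lbox (N + N) (fun j => if j == i then v else N - k)%N (fside i (k + k)).

Arguments facek {n} N k i v.

Section faces.
Variables (n N k : nat).
Implicit Types (x : {ffun 'I_n -> 'I_(N + N)}) (i j : 'I_n) (v w : nat).
Hypothesis k0 : (0 < k <= N)%N.

Definition is_end v := (v == N - k)%N || (v == N + k - 1)%N.

Lemma cubekP l x :
  reflect (forall i, (N - l <= x i < N - l + (l + l))%N) (x \in cubek n N l).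
Proof. exact: lboxP. Qed.

Lemma facekP i v x : reflect (x i = v :> nat /\ forall j, (N - k <= x j < N + k)%N || (j == i))
  (x \in facek N k i v).
Proof.
apply: (iffP (lboxP _ _ _)) => [xF|[xi xF] j].
  split=> [|j]; first by have := xF i; rewrite /fside eqxx; clear; lia.
  move: (xF j) k0; rewrite /fside; case: eqP => //; clear; lia.
move: (xF j) k0 xi; rewrite /fside; case: eqP => [-> _ _ ->|_]; clear; lia.
Qed.

Lemma face_shell i v x : is_end v -> x \in facek N k i v -> x \in shellk n N k.
Proof.
move=> ve /facekP[xi xF]; rewrite inE; apply/andP; split.
  apply/cubekP => j; move: (xF j) k0 xi ve; rewrite /is_end.
  by case: eqP => [->|_]; clear; lia.
apply/cubekP => /(_ i); move: k0 ve; rewrite xi /is_end; clear; lia.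
Qed.

Lemma shell_face x : x \in shellk n N k ->
  exists i v, is_end v /\ x \in facek N k i v.
Proof.
rewrite inE => /andP[/cubekP xC] /lboxP xn.
have [i xi] : exists i, ~~ (N - k.-1 <= x i < N - k.-1 + (k.-1 + k.-1))%N.
  apply/existsP; rewrite -negb_forall; apply/negP => /forallP H; exact: xn.
exists i, (x i); split; first by move: (xC i) xi k0; rewrite /is_end; clear; lia.
by apply/facekP; split => // j; move: (xC j) k0; clear; lia.
Qed.

(** Moving the j-th coordinate to an end leads into the intersection of two
  faces orthogonal to different axes; this is how faces are linked. *)
Lemma face_upd i j v x (t : 'I_(N + N)) : j != i -> is_end v -> is_end t ->
  x \in facek N k i v -> (upd x j t \in facek N k i v) && (upd x j t \in facek N k j t).
Proof.
move=> ji ve te /facekP[xi xF]; apply/andP; split; apply/facekP; split.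
- by rewrite updE eq_sym (negbTE ji).
- move=> l; rewrite updE; case: eqP => [_|_]; last exact: xF.
  by move: te k0; rewrite /is_end; clear; lia.
- by rewrite updE eqxx.
- move=> l; rewrite updE; case: eqP => [_|_]; first by rewrite orbT.
  by move: (xF l) xi ve k0; rewrite /is_end; case: eqP => [->|_]; clear; lia.
Qed.

Lemma face_sides i v j : is_end v ->
  ((if j == i then v else N - k) + fside i (k + k) j <= N + N)%N.
Proof.
by move: k0; rewrite /is_end /fside; case: (j == i); clear; lia.
Qed.

End faces.

Section Levels.
Variables (R : realFieldType) (d N : nat).
Variables (u F E : {ffun 'I_d.+1 -> 'I_(N + N)} -> R).
Hypothesis d0 : (0 < d)%N.
Hypothesis F0 : forall x, 0 <= F x.
Hypothesis E0 : forall x, 0 <= E x.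
Hypothesis FE : forall x T, 0 < T -> F x <= T + T ^- d * E x.

Local Notation K := (morrey_cst R d).

(** Absorbing the first term of Morrey's inequality takes [tau = 1 / (12 * K)],
  which puts [(12 * K) ^ d] in front of the second. *)
Definition level_cst : R := 2 * (12 * K) ^+ d.+1.

Lemma morrey_cst_gt0 : 0 < K.
Proof.
by rewrite /morrey_cst /poincare_cst; apply: mulr_gt0; [apply: mulr_gt0|];
  rewrite ltr0n ?muln_gt0 ?expn_gt0.
Qed.

Lemma level_cst_gt0 : 0 < level_cst.
Proof.
by apply: mulr_gt0 => //; apply/exprn_gt0/mulr_gt0 => //; exact: morrey_cst_gt0.
Qed.

(** Any two points of the surface of a cube can be joined through at most three
  faces with common points: two faces orthogonal to the same axis are linked by
  a face orthogonal to another one, which exists as [0 < d]. Hence [u]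
  oscillates by at least 1 / 3 on one face, and Morrey's inequality there bounds
  the energy from below. *)
Lemma level_estimate k a b : (0 < k <= N)%N ->
  (forall x y, x \in shellk d.+1 N k -> y \in shellk d.+1 N k -> adj x y ->
     `|u x - u y| <= F x + F y) ->
  a \in shellk d.+1 N k -> b \in shellk d.+1 N k -> u a = 0 -> u b = 1 ->
  (level_cst * k%:R)^-1 <= \sum_(x in shellk d.+1 N k) E x.
Proof.
move=> kN lip aS bS ua ub; set Ek := \sum_(x in _) _.
(* The three faces contribute [3 * 2 * K * tau = 1 / 2], half of the oscillation. *)
pose tau := (12 * K)^-1.
have tau0 : 0 < tau by rewrite invr_gt0 mulr_gt0 // morrey_cst_gt0.
pose X := 2 * (K * (tau + (k + k)%:R * (tau ^- d * Ek))).
have face i v x y : is_end N k v -> x \in facek N k i v -> y \in facek N k i v ->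
    `|u x - u y| <= X.
  move=> ve xF yF; apply: (morrey_osc F0 E0 FE) xF yF tau0.
  - by case/andP: kN => k0 _; rewrite addn_gt0 k0.
  - by move=> j; exact: (face_sides kN).
  - by move=> x' y' xF' yF'; apply: lip; [exact: (face_shell kN ve xF')|exact: (face_shell kN ve yF')].
  - rewrite /Ek big_mkcond [leRHS]big_mkcond; apply: ler_sum => x' _.
    case: ifP => [xF'|_]; last by case: ifP.
    by rewrite (face_shell kN ve xF').
have kM : (N - k < N + N)%N by move: kN; clear; lia.
have [i [v [ve aF]]] := shell_face kN aS.
have [j [w [we bF]]] := shell_face kN bS.
have X0 : 0 <= X by apply: le_trans (face _ _ _ _ ve aF aF).
have two i' v' x : i' != j -> is_end N k v' -> x \in facek N k i' v' ->
    `|u x - u b| <= X + X.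
  move=> ij ve' xF.
  have wE : w = b j by case/(facekP kN): bF.
  have bj : is_end N k (b j) by rewrite -wE.
  rewrite eq_sym in ij.
  have /andP[c1 c2] := face_upd kN ij ve' bj xF.
  rewrite -wE in c2; apply: le_trans (ler_distD (u (upd x j (b j))) _ _) _.
  by apply: lerD; [exact: face xF c1|exact: face c2 bF].
have H : `|u a - u b| <= 3 * X.
  have [ij|ij] := eqVneq i j; last first.
    by apply: le_trans (two _ _ _ ij ve aF) _; lra.
  have [l li] : exists l : 'I_d.+1, l != i.
    have [->|i0] := eqVneq i ord0; last by exists ord0; rewrite eq_sym.
    by exists ord_max; rewrite -(inj_eq val_inj) /= -lt0n.
  have te : is_end N k (Ordinal kM) by rewrite /is_end eqxx.
  have /andP[c1 c2] := face_upd kN li ve te aF.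
  apply: le_trans (ler_distD (u (upd a l (Ordinal kM))) _ _) _.
  rewrite ij in li; have := two _ _ _ li te c2; have := face _ _ _ _ ve aF c1.
  lra.
rewrite ua ub sub0r normrN1 in H.
have k1 : 0 < k%:R :> R by rewrite ltr0n; case/andP: kN.
rewrite -[leLHS]mul1r ler_pdivrMr; last exact: mulr_gt0 level_cst_gt0 k1.
move: H; rewrite /X /level_cst.
have -> : tau ^- d = (12 * K) ^+ d by rewrite /tau exprVn invrK.
have Kt : K * tau = 1 / 12.
  by rewrite /tau; have := morrey_cst_gt0; move: K => c c0; field; rewrite gt_eqF.
rewrite natrD exprS mulrDr Kt; move: ((12 * K) ^+ d) => B H.
have -> : Ek * (2 * (12 * K * B) * k%:R) =
  2 * (3 * (2 * (K * ((k%:R + k%:R) * (B * Ek))))) by ring.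
lra.
Qed.

End Levels.

Section SumLevels.
Variables (R : realFieldType) (n N : nat) (E : {ffun 'I_n -> 'I_(N + N)} -> R).
Hypothesis E0 : forall x, 0 <= E x.
Variable c : R.
Hypothesis c0 : 0 < c.

Let S k := \sum_(x in cubek n N k) E x.

Let cubeS k l x : (l <= k <= N)%N -> x \in cubek n N l -> x \in cubek n N k.
Proof.
move=> lk /cubekP xC; apply/cubekP => i; move: (xC i) lk; clear; lia.
Qed.

(** The sum of [1 / k] over [j < k <= 2 * j] is at least 1 / 2, and there are
  [p] such blocks. *)
Lemma sum_levels m p : (N = m * 2 ^ p)%N -> (0 < m)%N ->
  (forall k, (m < k <= N)%N -> (c * k%:R)^-1 <= \sum_(x in shellk n N k) E x) ->
  p%:R * (2 * c)^-1 <= \sum_x E x.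
Proof.
move=> NE m0 lev.
have step k : (m < k <= N)%N -> S k.-1 + (c * k%:R)^-1 <= S k.
  move=> mk; apply: le_trans (_ : S k.-1 + \sum_(x in shellk n N k) E x <= _).
    by rewrite lerD2l lev.
  rewrite /S big_mkcond [X in _ + X]big_mkcond [leRHS]big_mkcond -big_split.
  apply: ler_sum => x _ /=.
  rewrite -[x \in shellk _ _ _]/((x \in cubek n N k) && (x \notin cubek n N k.-1)).
  have /(_ x) := @cubeS k k.-1; case: (x \in cubek n N k.-1) => /=.
    rewrite andbF addr0 => ->//; move: mk; clear; lia.
  by rewrite andbT add0r.
have double j : (m <= j)%N -> (j + j <= N)%N -> S j + (2 * c)^-1 <= S (j + j)%N.
  move=> mj jN; have j0 : 0 < j%:R :> R by rewrite ltr0n (leq_trans m0).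
  suff H l : (l <= j)%N -> S j + l%:R * (c * (j + j)%:R)^-1 <= S (j + l)%N.
    apply: le_trans (H j (leqnn j)); rewrite lerD2l natrD.
    move: (j%:R : R) j0 => J J0; rewrite le_eqVlt; apply/orP; left; apply/eqP.
    by field; rewrite !gt_eqF ?addr_gt0.
  elim: l => [|l IH] lj; first by rewrite mul0r addr0 addn0.
  have jl : (m < (j + l).+1 <= N)%N by move: lj mj jN; clear; lia.
  rewrite addnS; apply: le_trans (step _ jl).
  rewrite -natr1 mulrDl mul1r addrA lerD //; first by apply: IH; exact: ltnW.
  rewrite lef_pV2 ?posrE ?mulr_gt0 ?ltr0n //; last by move: lj; clear; lia.
  by rewrite ler_pM2l // ler_nat; move: lj; clear; lia.
have fin q : (q <= p)%N -> q%:R * (2 * c)^-1 <= S (m * 2 ^ q)%N.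
  elim: q => [|q IH] qp; first by rewrite mul0r; apply: sumr_ge0.
  rewrite expnS mulnCA mul2n -addnn; apply: le_trans (double _ _ _).
  - by rewrite -natr1 mulrDl mul1r lerD2r; apply: IH; exact: ltnW.
  - by rewrite leq_pmulr // expn_gt0.
  - by rewrite addnn -mul2n mulnCA -expnS NE leq_mul2l leq_exp2l // qp orbT.
apply: le_trans (fin p (leqnn p)) _; rewrite /S big_mkcond.
by apply: ler_sum => x _; case: ifP.
Qed.

End SumLevels.

Local Open Scope classical_set_scope.
Local Open Scope ring_scope.

(** * Lebesgue measure of boxes, Borel sets and translates *)

Section volume.
Context {R : realType}.

Lemma integral_indic_oc (a b : R) (c : \bar R) : (0 <= c)%E ->
  (\int[@lebesgue_measure R]_t (c * (\1_(`]a, b]%classic) t)%:E) =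
   c * (Num.max 0 (b - a))%:E)%E.
Proof.
move=> c0; rewrite ge0_integralZl//.
- rewrite integral_indic// setIT /= lebesgue_measure_itv /= lte_fin.
  have [ab|ba] := ltP a b; first by rewrite -EFinB max_r // subr_ge0 ltW.
  by rewrite max_l // subr_le0.
- by apply/measurable_EFinP.
Qed.

(** Comparison of the volume of a box with the total volume of a countable
  cover, by induction on the dimension. For a fixed last coordinate [t] the
  induction hypothesis applies with each coefficient multiplied by an indicator
  at [t]; integration over [t] then turns the indicators into lengths. The
  coefficients [c] and [w] are there to make this step possible. *)
Lemma box_series n (c : \bar R) (w : nat -> \bar R) (a b : nat -> R)
    (A B : nat -> nat -> R) :
  (0 <= c)%E -> (forall k, 0 <= w k)%E ->
  (forall x : nat -> R,
    c * (\prod_(i < n) \1_(`]a i, b i]%classic) (x i))%:E <=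
    \sum_(k <oo) w k * (\prod_(i < n) \1_(`]A k i, B k i]%classic) (x i))%:E)%E ->
  (c * (\prod_(i < n) Num.max 0 (b i - a i))%:E <=
    \sum_(k <oo) w k * (\prod_(i < n) Num.max 0 (B k i - A k i))%:E)%E.
Proof.
elim: n c w => [|n IH] c w c0 w0 H.
  have := H (fun=> 0); rewrite !big_ord0 => /le_trans; apply.
  by apply: lee_nneseries => [k _ _|k _]; rewrite ?big_ord0 ?mule_ge0 // lee_fin.
have p0 (I : finType) (f : I -> R) : 0 <= \prod_i Num.max 0 (f i).
  by apply: prodr_ge0 => i _; rewrite le_max lexx.
have ci0 (a' b' t : R) (e : \bar R) : (0 <= e)%E ->
    (0 <= e * (\1_(`]a', b']%classic) t)%:E)%E.
  by move=> e0; rewrite mule_ge0 // lee_fin.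
have step t : (c * (\prod_(i < n) Num.max 0 (b i - a i))%:E *
      (\1_(`]a n, b n]%classic) t)%:E <=
    \sum_(k <oo) w k * (\prod_(i < n) Num.max 0 (B k i - A k i))%:E *
      (\1_(`]A k n, B k n]%classic) t)%:E)%E.
  under eq_eseriesr do rewrite muleAC.
  rewrite muleAC; apply: IH; [exact: ci0|move=> k; exact: ci0|move=> x].
  pose x' i := if (i < n)%N then x i else t.
  have E (A' B' : nat -> R) :
      \prod_(i < n.+1) \1_(`]A' i, B' i]%classic) (x' i) =
      \1_(`]A' n, B' n]%classic) t * \prod_(i < n) \1_(`]A' i, B' i]%classic) (x i) :> R.
    rewrite big_ord_recr mulrC /= [x' n]/x' ltnn; congr (_ * _).
    by apply: eq_bigr => i _; rewrite /x' ltn_ord.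
  have := H x'; rewrite E EFinM muleA.
  by under eq_eseriesr do rewrite E EFinM muleA.
have mi (e : \bar R) (a' b' : R) :
    measurable_fun [set: R] (fun t => (e * (\1_(`]a', b']%classic) t)%:E)%E).
  by apply: measurable_funeM; apply/measurable_EFinP.
have wp k : (0 <= w k * (\prod_(i < n) Num.max 0 (B k i - A k i))%:E)%E.
  by rewrite mule_ge0 // lee_fin.
have cp : (0 <= c * (\prod_(i < n) Num.max 0 (b i - a i))%:E)%E.
  by rewrite mule_ge0 // lee_fin.
have L : (\int[@lebesgue_measure R]_t (c * (\prod_(i < n) Num.max 0 (b i - a i))%:E *
      (\1_(`]a n, b n]%classic) t)%:E) <=
   \int[@lebesgue_measure R]_t (
    \sum_(k <oo) w k * (\prod_(i < n) Num.max 0 (B k i - A k i))%:E *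
      (\1_(`]A k n, B k n]%classic) t)%:E))%E.
  apply: ge0_le_integral => //.
  - by move=> t _; exact: ci0.
  - exact: mi.
  - by apply: ge0_emeasurable_sum => [k t _ _|k _]; [exact: ci0|exact: mi].
rewrite integral_indic_oc // integral_nneseries // in L; last 2 first.
  by move=> k; exact: mi.
  by move=> k t _; exact: ci0.
rewrite big_ord_recr /= EFinM muleA; apply: le_trans L _.
apply: lee_nneseries => [k _ _|k _]; first by apply: integral_ge0 => t _; exact: ci0.
by rewrite integral_indic_oc // big_ord_recr /= EFinM muleA.
Qed.

End volume.

Section coordinates.
Context {R : realType} {n : nat}.

Lemma rV_norm_le (x : 'rV[R]_n) (e : R) : 0 <= e ->
  (`|x| <= e) <-> (forall i, `|x 0 i| <= e).
Proof.
have E : `|x| = \big[Num.max/0]_ij `|x ij.1 ij.2| by exact: mx_normrE.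
move=> e0; rewrite E; split=> [H i|H].
  by apply: le_trans H; apply: (le_bigmax _ (fun ij => `|x ij.1 ij.2|) (0, i)).
by apply/bigmax_leP; split => // -[i j] _ /=; rewrite ord1.
Qed.

Lemma rV_norm_lt (x : 'rV[R]_n) (e : R) : 0 < e ->
  (`|x| < e) <-> (forall i, `|x 0 i| < e).
Proof.
have E : `|x| = \big[Num.max/0]_ij `|x ij.1 ij.2| by exact: mx_normrE.
move=> e0; rewrite E; split=> [H i|H].
  by apply: le_lt_trans H; apply: (le_bigmax _ (fun ij => `|x ij.1 ij.2|) (0, i)).
by apply/bigmax_ltP; split => // -[i j] _ /=; rewrite ord1.
Qed.

Lemma coord_le_norm (x : 'rV[R]_n) i : `|x 0 i| <= `|x|.
Proof. by move: i; apply/rV_norm_le. Qed.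

Definition rat_box (p : 'rV[rat]_n * 'rV[rat]_n) : set 'rV[R]_n :=
  box (Some (map_mx ratr p.1, map_mx ratr p.2)).

(** There are only countably many rational boxes, hence measurability of
  preimages of open sets can be tested on boxes, that is, on coordinates. *)
Lemma open_rat_boxes (O : set 'rV[R]_n) : open O ->
  O = \bigcup_(p in [set p | rat_box p `<=` O]) rat_box p.
Proof.
move=> oO; apply/seteqP; split=> [x Ox|x [p /= pO /pO]//].
have : nbhs x O by exact: open_nbhs_nbhs.
move=> /nbhs_ballP[e /= e0 eO].
have lq i : exists q : rat, ratr q \in `](x 0 i - e), (x 0 i)[.
  by apply: rat_in_itvoo; rewrite ltrBlDr ltrDl.
have rq i : exists q : rat, ratr q \in `](x 0 i), (x 0 i + e)[.
  by apply: rat_in_itvoo; rewrite ltrDl.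
have [a aP] := choice lq; have [b bP] := choice rq.
exists (\row_i a i, \row_i b i) => [y yB|i]; last first.
  by rewrite !mxE; move: (aP i) (bP i); rewrite !in_itv /= => /andP[_ ->] /andP[/ltW -> _].
apply: eO; rewrite -ball_normE /=; apply/rV_norm_lt => // i.
move: (yB i) (aP i) (bP i); rewrite !mxE !in_itv /= ltr_norml.
by move=> /andP[? ?] /andP[? ?] /andP[? ?]; apply/andP; split; lra.
Qed.

Lemma measurable_fun_rV d (T : measurableType d) (phi : T -> 'rV[R]_n) :
  (forall i, measurable_fun [set: T] (fun t => phi t 0 i)) ->
  measurable_fun [set: T] (phi : T -> g_sigma_algebraType (@open 'rV[R]_n)).
Proof.
move=> mphi; apply: (@measurability _ _ T (g_sigma_algebraType (@open 'rV[R]_n)) setT phi (@open 'rV[R]_n)) => //.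
move=> _ [V oV <-]; rewrite setTI (open_rat_boxes oV) preimage_bigcup.
rewrite bigcup_mkcond; apply: countable_bigcupT_measurable => // p.
case: ifP => // _.
rewrite (_ : phi @^-1` rat_box p = \bigcap_(i : 'I_n)
   ((fun t => phi t 0 i) @^-1` `]ratr (p.1 0 i), ratr (p.2 0 i)]%classic)).
  apply: fin_bigcap_measurable => // i _.
  by rewrite -[X in measurable X]setTI; apply: mphi.
apply/seteqP; split => [t /= H i _ /=|t H i].
  by move: (H i); rewrite !mxE in_itv.
by have := H i I; rewrite /= !mxE in_itv.
Qed.

End coordinates.

Section lebesgueRn_theory.
Context {R : realType} {n : nat}.
Local Open Scope ereal_scope.
Local Notation outer := (@lebesgue_outer R n).
Local Notation mu := (@lebesgue_measureRn R n).

(** The parts of a box on the two sides of the hyperplane where the i-th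
  coordinate is [c]. Half-open boxes are closed under this operation. *)
Definition box_low (i : 'I_n) (c : R) (B : option ('rV[R]_n * 'rV[R]_n)) :=
  if B is Some (a, b) then
    Some (a, \row_j if j == i then Num.min (b 0 j) c else b 0 j)%R else None.

Definition box_high (i : 'I_n) (c : R) (B : option ('rV[R]_n * 'rV[R]_n)) :=
  if B is Some (a, b) then
    Some (\row_j if j == i then Num.max (a 0 j) c else a 0 j, b)%R else None.

Lemma box_split_volume i c B :
  box_volume B = box_volume (box_low i c B) + box_volume (box_high i c B).
Proof.
case: B => [[a b]|] /=; last by rewrite adde0.
have D1 (f : 'I_n -> R) : (\prod_j f j = f i * \prod_(j | j != i) f j)%R.
  by rewrite (bigD1 i).
rewrite -EFinD !D1 !mxE !eqxx; congr EFin.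
set P := (\prod_(j | j != i) _)%R.
rewrite [X in (_ = _ * X + _)%R](_ : _ = P); last first.
  by apply: eq_bigr => j /negbTE ji; rewrite !mxE ji.
rewrite [X in (_ = _ + _ * X)%R](_ : _ = P); last first.
  by apply: eq_bigr => j /negbTE ji; rewrite !mxE ji.
rewrite -mulrDl; congr (_ * _)%R.
move: (a 0%R i) (b 0%R i) => x y.
by rewrite /Num.max /Num.min; do ! case: ifP; lra.
Qed.

(** Cutting each box of a cover along the hyperplane yields covers of the two
  parts, of the same total volume. *)
Lemma halfspace_caratheodory i (c : R) :
  outer.-caratheodory [set x : 'rV[R]_n | (x 0 i <= c)%R].
Proof.
apply: le_caratheodory_measurable => X; apply: le_ereal_inf_tmp => _ [B XB <-].
under eq_eseriesr do rewrite (box_split_volume i c).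
rewrite nneseriesD; last 2 first.
  by move=> k _ _; exact: box_volume_ge0.
  by move=> k _ _; exact: box_volume_ge0.
apply: leeD; apply: ereal_inf_lbound.
- exists (box_low i c \o B) => // x [/XB[k _ xk] /= xc]; exists k => //=.
  move: (B k) xk => [[a b]|//] /= xk j; rewrite mxE; move: (xk j).
  by case: eqP => // -> /andP[-> /= xb]; rewrite le_min xb.
- exists (box_high i c \o B) => // x [/XB[k _ xk] /= xc]; exists k => //=.
  move: (B k) xk => [[a b]|//] /= xk j; rewrite mxE; move: (xk j).
  by case: eqP => // -> /andP[xa ->]; rewrite gt_max xa andbT ltNge; apply/negP.
Qed.

Lemma measurable_coord (i : 'I_n) :
  measurable_fun [set: lebesgueRn R n] (fun x : 'rV[R]_n => x 0%R i).
Proof.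
apply: (measurability _ (RGenOInfty.measurableE R)) => // _ [_ [c ->] <-].
rewrite setTI preimage_itvoy (_ : [set _ | _] = ~` [set x : 'rV[R]_n | (x 0 i <= c)%R]).
  by apply: measurableC; exact: halfspace_caratheodory.
by apply/seteqP; split => x /=; rewrite ltNge => /negP.
Qed.

Lemma borel_lebesgue_id : measurable_fun [set: lebesgueRn R n]
  (id : lebesgueRn R n -> g_sigma_algebraType (@open 'rV[R]_n)).
Proof. by apply: measurable_fun_rV => i; exact: measurable_coord. Qed.

Lemma borel_lebesgue (A : set 'rV[R]_n) :
  <<s (@open 'rV[R]_n) >> A -> measurable (A : set (lebesgueRn R n)).
Proof.
move=> mA; rewrite -[X in measurable X]setTI.
exact: (borel_lebesgue_id measurableT mA).
Qed.

Lemma open_lebesgue (A : set 'rV[R]_n) :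
  open A -> measurable (A : set (lebesgueRn R n)).
Proof. by move=> oA; apply: borel_lebesgue; exact: sub_gen_smallest. Qed.

Lemma borel_fun_lebesgue (f : 'rV[R]_n -> \bar R) : borel_fun f ->
  measurable_fun [set: lebesgueRn R n] f.
Proof. by move=> bf; exact: (measurableT_comp bf borel_lebesgue_id). Qed.

Lemma outer_shift_le (v : 'rV[R]_n) (X : set 'rV[R]_n) :
  outer ((fun x => (x + v)%R) @^-1` X) <= outer X.
Proof.
apply: le_ereal_inf_tmp => _ [B XB <-]; apply: ereal_inf_lbound.
exists (fun k => if B k is Some (a, b) then Some (a - v, b - v)%R else None).
  move=> x /XB[k _ xk]; exists k => //=.
  move: (B k) xk => [[a b]|//] /= xk j; rewrite !mxE; move: (xk j); rewrite !mxE.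
  by rewrite ltrBlDr lerBrDr.
apply: eq_eseriesr => k _; case: (B k) => [[a b]|//] /=.
by congr EFin; apply: eq_bigr => j _; rewrite !mxE; congr Num.max; lra.
Qed.

Lemma outer_shift (v : 'rV[R]_n) (X : set 'rV[R]_n) :
  outer ((fun x => (x + v)%R) @^-1` X) = outer X.
Proof.
apply/eqP; rewrite eq_le outer_shift_le /=.
have := outer_shift_le (- v)%R ((fun x => (x + v)%R) @^-1` X).
rewrite -comp_preimage (_ : _ \o _ = id) //.
by apply/funext => x /=; rewrite subrK.
Qed.

Lemma outer_box_le B : outer (box B) <= box_volume B.
Proof.
apply: ereal_inf_lbound; exists (fun k => if k == 0%N then B else None).
  by move=> x xB; exists 0%N.
rewrite (nneseries_split _ 1%N); last by move=> k _; case: ifP => //; rewrite box_volume_ge0.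
rewrite big_mkord big_ord1 /= eseries0 ?adde0 // => k.
by rewrite add0n => k1 _; rewrite eqn0Ngt k1.
Qed.

(** Coordinates indexed by all natural numbers, as needed in [box_series]. *)
Let ext (v : 'rV[R]_n) (i : nat) : R :=
  if insub i is Some j then v 0%R (j : 'I_n) else 0%R.

Let extE v (i : 'I_n) : ext v i = v 0%R i.
Proof. by rewrite /ext valK. Qed.

Let prod_ext (x : nat -> R) (a b : 'rV[R]_n) :
  (\prod_(i < n) \1_(`]ext a i, ext b i]%classic) (x i) =
   \1_(box (Some (a, b))) (\row_i x i) :> R)%R.
Proof.
rewrite indicE; have [xB|xB] := pselect (box (Some (a, b)) (\row_i x i)%R).
  by rewrite mem_set // big1 // => i _; rewrite indicE !extE mem_set //= in_itv /=; have := xB i; rewrite mxE.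
have [i xi] : exists i : 'I_n, ~ (a 0 i < x i <= b 0 i)%R.
  by apply/existsNP => H; apply: xB => i; rewrite mxE.
rewrite (memNset xB) (bigD1 i) //= indicE !extE memNset ?mul0r //= in_itv.
Qed.

Lemma outer_box a b : outer (box (Some (a, b))) = box_volume (Some (a, b)).
Proof.
apply/eqP; rewrite eq_le outer_box_le; apply: le_ereal_inf_tmp => _ [B aB <-].
pose w k : \bar R := if B k is Some _ then 1 else 0.
pose lo k := if B k is Some p then p.1 else 0%R.
pose hi k := if B k is Some p then p.2 else 0%R.
have w0 k : 0 <= w k by rewrite /w; case: (B k).
have := @box_series R n 1 w (ext a) (ext b) (fun k => ext (lo k)) (fun k => ext (hi k)).
move=> /(_ (@lee01 _) w0); rewrite mul1e => H.
have -> : box_volume (Some (a, b)) = (\prod_(i < n) Num.max 0 (ext b i - ext a i))%:E.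
  by congr EFin; apply: eq_bigr => i _; rewrite !extE.
rewrite (eq_eseriesr (g := fun k => w k *
    (\prod_(i < n) Num.max 0 (ext (hi k) i - ext (lo k) i))%:E)); last first.
  move=> k _; rewrite /w /hi /lo; case: (B k) => [[a' b']|]; last by rewrite mul0e.
  by rewrite mul1e; congr EFin; apply: eq_bigr => i _; rewrite !extE.
apply: H => x; rewrite mul1e prod_ext.
have s0 k : 0 <= w k * (\prod_(i < n) \1_(`]ext (lo k) i, ext (hi k) i]%classic) (x i))%:E.
  by rewrite mule_ge0 // prod_ext lee_fin.
rewrite indicE; have [xB|xB] := pselect (box (Some (a, b)) (\row_i x i)%R); last first.
  by rewrite memNset //; apply: nneseries_ge0 => k _ _; exact: s0.
have [k _ xk] := aB _ xB; rewrite mem_set //.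
rewrite (nneseriesD1 (n := k)) //= [X in X + _](_ : _ = 1).
  by rewrite leeDl //; apply: nneseries_ge0 => j _ _; exact: s0.
rewrite prod_ext /w /hi /lo; move: xk; case: (B k) => [[a' b']|//] xk.
by rewrite mul1e indicE mem_set.
Qed.

End lebesgueRn_theory.

(** * Averaging over parallel paths *)

Section integrals.
Context {R : realType} {n : nat}.
Local Open Scope ereal_scope.
Local Notation mu := (@lebesgue_measureRn R n).
Local Notation borelRn := (g_sigma_algebraType (@open 'rV[R]_n)).

(** Tonelli's theorem is applied to the product of this measure with the one on
  the line. *)
Lemma lebesgueRn_sigma_finite : sigma_finite [set: lebesgueRn R n] mu.
Proof.
exists (fun k : nat => box (Some (const_mx (- k%:R), const_mx k%:R)%R)).
  apply/esym/seteqP; split => // x _.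
  exists (Num.truncn `|x|%R).+1 => // i; rewrite !mxE.
  have := coord_le_norm x i; have := truncnS_gt `|x|%R.
  rewrite ler_norml => xk /andP[x1 x2]; apply/andP; split.
    by apply: lt_le_trans x1; rewrite ltrN2.
  by apply: le_trans x2 _; exact: ltW.
move=> k; split.
  rewrite (_ : box _ = \bigcap_(i : 'I_n)
   ((fun x : 'rV[R]_n => x 0%R i) @^-1` `](- k%:R)%R, k%:R%R]%classic)); last first.
    apply/seteqP; split => [x /= H i _ /=|x H i].
      by move: (H i); rewrite !mxE in_itv.
    by have := H i I; rewrite /= !mxE in_itv.
  apply: fin_bigcap_measurable => // i _.
  by rewrite -[X in measurable X]setTI; apply: measurable_coord.
by rewrite [X in X < _]outer_box ltry.
Qed.

HB.instance Definition _ := @Measure_isSigmaFinite.Build _ (lebesgueRn R n) R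
  mu lebesgueRn_sigma_finite.

Lemma borel_coord (i : 'I_n) :
  measurable_fun [set: borelRn] (fun x : 'rV[R]_n => x 0%R i).
Proof.
apply: (measurability _ (RGenOInfty.measurableE R)) => // _ [_ [c ->] <-].
rewrite setTI; apply: sub_gen_smallest.
apply: open_comp; last exact: interval_open.
by move=> x _; exact: coord_continuous.
Qed.

Lemma borel_box (B : option ('rV[R]_n * 'rV[R]_n)) : measurable (box B : set borelRn).
Proof.
case: B => [[a b]|]; last exact: measurable0.
rewrite (_ : box _ = \bigcap_(i : 'I_n)
   ((fun x : 'rV[R]_n => x 0%R i) @^-1` `]a 0%R i, b 0%R i]%classic)); last first.
  apply/seteqP; split => [x /= H i _ /=|x H i].
    by move: (H i); rewrite in_itv.
  by have := H i I; rewrite /= in_itv.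
apply: fin_bigcap_measurable => // i _.
by rewrite -[X in measurable X]setTI; apply: borel_coord.
Qed.

Lemma measurable_box (B : option ('rV[R]_n * 'rV[R]_n)) :
  measurable (box B : set (lebesgueRn R n)).
Proof. by apply: borel_lebesgue; exact: borel_box. Qed.

Lemma measurable_shift (v : 'rV[R]_n) :
  measurable_fun [set: lebesgueRn R n] ((fun x => (x + v)%R) : lebesgueRn R n -> borelRn).
Proof.
apply: measurable_fun_rV => i.
rewrite (_ : (fun _ => _) = (fun x : 'rV[R]_n => x 0%R i + v 0%R i)%R); last first.
  by apply/funext => x; rewrite mxE.
apply: (@measurable_funD _ (lebesgueRn R n) R setT (fun x : 'rV[R]_n => x 0%R i)
  (fun=> v 0%R i)); [exact: measurable_coord|exact: measurable_cst].
Qed.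

Lemma integral_shift (rho : 'rV[R]_n -> \bar R) (v : 'rV[R]_n) (D : set borelRn) :
  borel_fun rho -> (forall x, 0 <= rho x) -> measurable D ->
  \int[mu]_(x in (fun x => (x + v)%R) @^-1` D) rho (x + v)%R = \int[mu]_(x in D) rho x.
Proof.
move=> mrho rho0 mD.
have mrhoD : measurable_fun D rho by exact: measurable_funTS.
pose m1 := measure_function_pushforward__canonical__measure_function_Measure
  mu (measurable_shift v).
pose m2 := measure_function_pushforward__canonical__measure_function_Measure
  mu (@borel_lebesgue_id R n).
transitivity (\int[m1]_(x in D) rho x).
  by apply/esym; apply: (ge0_integral_pushforward (measurable_shift v)) => // y _.
transitivity (\int[m2]_(x in D) rho x); last first.
  by apply: (ge0_integral_pushforward (@borel_lebesgue_id R n)) => // y _.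
apply: (@eq_measure_integral _ borelRn R D m2 m1 rho) => A mA _.
change (lebesgue_outer ((fun x : 'rV[R]_n => (x + v)%R) @^-1` A) =
  lebesgue_outer (A : set 'rV[R]_n)).
exact: outer_shift.
Qed.

(** Either [t <= T], or [t <= t * (t / T) ^ d]. *)
Lemma young_ereal d (t : \bar R) (T : R) : 0 <= t -> (0 < T)%R ->
  t <= T%:E + (T ^- d)%:E * t ^+ d.+1.
Proof.
move=> t0 T0; have Td : (0 < T ^- d)%R by rewrite invr_gt0 exprn_gt0.
case: t t0 => [t||//] t0; last first.
  have -> : (+oo : \bar R) ^+ d.+1 = +oo.
    by elim: d {Td} => // d IH; rewrite expeS IH mulyy.
  by rewrite gt0_muley // addey.
rewrite -EFin_expe -EFinM -EFinD lee_fin.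
have {}t0 : (0 <= t)%R by rewrite lee_fin in t0.
have [tT|/ltW Tt] := leP t T.
  by apply: le_trans tT _; rewrite lerDl mulr_ge0 ?exprn_ge0 // ltW.
apply: le_trans (_ : T ^- d * t ^+ d.+1 <= _)%R; last by rewrite lerDr ltW.
rewrite exprS mulrCA -[leLHS]mulr1 ler_wpM2l // mulrC -expr_div_n.
by apply: exprn_ege1; rewrite ler_pdivlMr // mul1r.
Qed.

Lemma measurable_expe d (T : measurableType d) (f : T -> \bar R) k :
  measurable_fun setT f -> measurable_fun setT (fun x => f x ^+ k).
Proof.
move=> mf; elim: k => [|k IH]; first exact: measurable_cst.
under eq_fun do rewrite expeS.
exact: emeasurable_funM.
Qed.

Lemma integral_young d (rho : 'rV[R]_n -> \bar R) (A : set (lebesgueRn R n)) (T : R) :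
  borel_fun rho -> (forall x, 0 <= rho x) -> measurable A -> (0 < T)%R ->
  \int[mu]_(x in A) rho x <=
    T%:E * mu A + (T ^- d)%:E * \int[mu]_(x in A) (rho x ^+ d.+1).
Proof.
move=> mrho rho0 mA T0.
have mr : measurable_fun A rho by apply: measurable_funTS; exact: borel_fun_lebesgue.
have mrd : measurable_fun A (fun x => rho x ^+ d.+1).
  by apply: measurable_funTS; apply: measurable_expe; exact: borel_fun_lebesgue.
have Td : (0 <= (T ^- d)%:E :> \bar R) by rewrite lee_fin invr_ge0 exprn_ge0 // ltW.
have rd0 x : 0 <= rho x ^+ d.+1 by apply: expe_ge0.
have E1 : \int[mu]_(x in A) T%:E = T%:E * mu A by exact: (integral_cst mu mA).
have E2 : \int[mu]_(x in A) ((T ^- d)%:E * rho x ^+ d.+1) =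
    (T ^- d)%:E * \int[mu]_(x in A) (rho x ^+ d.+1).
  by apply: ge0_integralZl => // x _.
have mrd2 : measurable_fun A (fun x => (T ^- d)%:E * rho x ^+ d.+1).
  exact: measurable_funeM.
have E3 : \int[mu]_(x in A) (T%:E + (T ^- d)%:E * rho x ^+ d.+1) =
    \int[mu]_(x in A) T%:E + \int[mu]_(x in A) ((T ^- d)%:E * rho x ^+ d.+1).
  apply: ge0_integralD => // [x _|x _].
  - by rewrite lee_fin ltW.
  - by rewrite mule_ge0.
rewrite -E1 -E2 -E3.
apply: (@ge0_le_integral _ (lebesgueRn R n) R mu A mA rho
  (fun x => T%:E + (T ^- d)%:E * rho x ^+ d.+1) (fun x _ => rho0 x) mr).
- by apply: emeasurable_funD => //; exact: measurable_cst.
- by move=> x _; exact: young_ereal.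
Qed.

Lemma integral_cover2 (rho : 'rV[R]_n -> \bar R) (D A B : set (lebesgueRn R n)) :
  borel_fun rho -> (forall x, 0 <= rho x) ->
  measurable D -> measurable A -> measurable B -> D `<=` A `|` B ->
  \int[mu]_(x in D) rho x <= \int[mu]_(x in A) rho x + \int[mu]_(x in B) rho x.
Proof.
move=> mrho rho0 mD mA mB DAB.
have mr (E : set (lebesgueRn R n)) : measurable_fun E rho.
  by apply: measurable_funTS; exact: borel_fun_lebesgue.
apply: le_trans (_ : \int[mu]_(x in A `|` (B `\` A)) rho x <= _).
  apply: ge0_subset_integral => //; first by apply: measurableU => //; exact: measurableD.
  by rewrite setUDr setDv setD0.
rewrite ge0_integral_setU //; last 2 first.
- exact: measurableD.
- by rewrite disj_set2E setDE setICA setICr setI0.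
by rewrite leeD2l // ge0_subset_integral //; exact: measurableD.
Qed.

Lemma measurable_path_sum (p : R -> 'rV[R]_n) :
  (forall i, measurable_fun [set: R] (fun s => p s 0%R i)) ->
  measurable_fun [set: lebesgueRn R n * R]
    ((fun q => (q.1 + p q.2)%R) : lebesgueRn R n * R -> borelRn).
Proof.
move=> mp; apply: measurable_fun_rV => i.
rewrite (_ : (fun _ => _) = (fun q : lebesgueRn R n * R =>
   (q.1 : 'rV[R]_n) 0%R i + p q.2 0%R i)%R); last first.
  by apply/funext => q; rewrite mxE.
apply: (@measurable_funD _ (lebesgueRn R n * R)%type R setT
  (fun q => (q.1 : 'rV[R]_n) 0%R i) (fun q => p q.2 0%R i)).
- exact: (measurableT_comp (measurable_coord i) measurable_fst).
- exact: (measurableT_comp (mp i) measurable_snd).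
Qed.

Lemma borel_shift (v : 'rV[R]_n) (C : set borelRn) : measurable C ->
  measurable (((fun x => (x + v)%R) @^-1` C) : set borelRn).
Proof.
move=> mC; rewrite -[X in measurable X]setTI.
suff mf : measurable_fun [set: borelRn] ((fun x => (x + v)%R) : borelRn -> borelRn).
  exact: mf.
apply: measurable_fun_rV => i.
rewrite (_ : (fun _ => _) = (fun x : 'rV[R]_n => x 0%R i + v 0%R i)%R); last first.
  by apply/funext => x; rewrite mxE.
apply: (@measurable_funD _ borelRn R setT (fun x : 'rV[R]_n => x 0%R i)
  (fun=> v 0%R i)); [exact: borel_coord|exact: measurable_cst].
Qed.

(** Integrate the admissibility along the translates [x + p s] of one path over
  the starting points [x] in [C], and exchange the integrals. For a parameter
  [s] in the k-th step the set of the points [x + p s] is covered by [G k] and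
  [G k.+1], and Lebesgue measure is invariant under translation; the step lasts
  for the time [h]. *)
Lemma chain_inequality (rho : 'rV[R]_n -> \bar R) (C : set borelRn)
    (p : R -> 'rV[R]_n) (m : nat) (h : R) (G : nat -> set borelRn) :
  borel_fun rho -> (forall x, 0 <= rho x) ->
  measurable C -> (forall k, measurable (G k)) ->
  (forall i, measurable_fun [set: R] (fun s => p s 0%R i)) ->
  (0 < h)%R -> (0 < m)%N ->
  (forall k s x, (k < m)%N -> (k%:R * h <= s <= k.+1%:R * h)%R -> C x ->
     G k (x + p s)%R \/ G k.+1 (x + p s)%R) ->
  (forall x, C x ->
     1 <= \int[@lebesgue_measure R]_(s in `[0%R, (m%:R * h)%R]) rho (x + p s)%R) ->
  mu C <= \sum_(k < m) (\int[mu]_(x in G k) rho x + \int[mu]_(x in G k.+1) rho x) * h%:E.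
Proof.
move=> mrho rho0 mC mG mp h0 m0 cover adm.
set I := `[0%R, (m%:R * h)%R]%classic.
pose J k := `[(k%:R * h)%R, (k.+1%:R * h)%R]%classic.
pose H (q : lebesgueRn R n * R) := (\1_C q.1)%:E * ((\1_I q.2)%:E * rho (q.1 + p q.2)%R).
have H0 q : 0 <= H q by rewrite !mule_ge0 // lee_fin.
have mC' : measurable (C : set (lebesgueRn R n)) by exact: borel_lebesgue.
have mH : measurable_fun setT H.
  have mI : measurable_fun [set: R] (\1_I : R -> R) by apply: measurable_indic; exact: measurable_itv.
  have mC1 : measurable_fun [set: lebesgueRn R n] (\1_C : lebesgueRn R n -> R).
    exact: measurable_indic.
  apply: emeasurable_funM.
    by apply/measurable_EFinP; exact: (measurableT_comp mC1 measurable_fst).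
  apply: emeasurable_funM.
    by apply/measurable_EFinP; exact: (measurableT_comp mI measurable_snd).
  exact: (measurableT_comp mrho (measurable_path_sum mp)).
pose S k := \int[mu]_(x in G k) rho x + \int[mu]_(x in G k.+1) rho x.
have S0 k : 0 <= S k by rewrite adde_ge0 // integral_ge0.
have mS k : measurable_fun [set: R] (fun s : R => S k * (\1_(J k) s)%:E).
  by apply: measurable_funeM; apply/measurable_EFinP; apply: measurable_indic; exact: measurable_itv.
have SJ0 k s : 0 <= S k * (\1_(J k) s)%:E by rewrite mule_ge0 // lee_fin.
apply: (@le_trans _ _ (\int[mu]_x \int[@lebesgue_measure R]_s H (x, s))).
  rewrite -[leLHS]mul1e -(integral_cst mu mC') integral_mkcond.
  apply: (@ge0_le_integral _ (lebesgueRn R n) R mu setT measurableT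
    ((cst 1) \_ C) (fun x => \int[@lebesgue_measure R]_s H (x, s))).
  - by move=> x _; rewrite patchE; case: ifP.
  - by apply/(measurable_restrictT _ mC').1; exact: measurable_cst.
  - exact: (@measurable_fun_fubini_tonelli_F _ _ (lebesgueRn R n) (measurableTypeR R) R
      (@lebesgue_measure R) H mH H0).
  - move=> x _; rewrite patchE; case: ifPn => [|_]; last by apply: integral_ge0.
    rewrite inE => Cx; apply: le_trans (adm x Cx) _.
    rewrite integral_mkcond le_eqVlt; apply/orP; left; apply/eqP.
    apply: eq_integral => s _; rewrite patchE.
    have -> : H (x, s) = (\1_I s)%:E * rho (x + p s)%R.
      by rewrite /H /= (indicE _ C) mem_set // mul1e.
    rewrite indicE.
    by case: ifPn => _; rewrite ?mul1e ?mul0e.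
rewrite (@fubini_tonelli _ _ (lebesgueRn R n) (measurableTypeR R) R mu
  (@lebesgue_measure R) H mH H0).
apply: (@le_trans _ _ (\int[@lebesgue_measure R]_s \sum_(k < m) S k * (\1_(J k) s)%:E)).
  apply: (@ge0_le_integral _ _ R (@lebesgue_measure R) setT measurableT
    (fun s => \int[mu]_x H (x, s)) (fun s => \sum_(k < m) S k * (\1_(J k) s)%:E)).
  - by move=> s _; apply: integral_ge0.
  - exact: (@measurable_fun_fubini_tonelli_G _ _ (lebesgueRn R n) (measurableTypeR R) R
      mu H mH H0).
  - by apply: emeasurable_sum => k; exact: (mS k).
  move=> s _; have [sI|sI] := pselect (I s); last first.
    rewrite integral0_eq; first by apply: sume_ge0 => k _.
    move=> x _; have -> : H (x, s) = (\1_C x)%:E * ((\1_I s)%:E * rho (x + p s)%R) by [].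
    by rewrite (indicE _ I) memNset // mul0e mule0.
  have [k km sk] : exists2 k, (k < m)%N & (k%:R * h <= s <= k.+1%:R * h)%R.
    have : exists k, (s <= k.+1%:R * h)%R.
      by exists m.-1; rewrite prednK //; move: sI; rewrite /I /= in_itv => /andP[].
    move=> /ex_minnP[k sk kmin]; exists k.
      rewrite ltnNge; apply/negP => mk.
      have := kmin m.-1; rewrite prednK //.
      move: sI; rewrite /I /= in_itv /= => /andP[_ ->] /(_ isT).
      by rewrite leqNgt => /negP; apply; rewrite prednK.
    rewrite sk andbT; case: k sk kmin => [|k] sk kmin.
      by rewrite mul0r; move: sI; rewrite /I /= in_itv => /andP[].
    by rewrite leNgt; apply/negP => /ltW /kmin; rewrite ltnn.
  have -> : \int[mu]_x H (x, s) = \int[mu]_(x in C) rho (x + p s)%R.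
    rewrite [RHS]integral_mkcond; apply: eq_integral => x _.
    have -> : H (x, s) = (\1_C x)%:E * rho (x + p s)%R.
      by rewrite /H /= (indicE _ I) mem_set // mul1e.
    rewrite patchE indicE.
    by case: ifPn => _; rewrite ?mul1e ?mul0e.
  pose D : set borelRn := (fun x => (x - p s)%R) @^-1` C.
  have mD : measurable D by exact: borel_shift.
  have -> : C = (fun x => (x + p s)%R) @^-1` D.
    by apply/seteqP; split => x; rewrite /D /= addrK.
  rewrite (integral_shift _ mrho rho0 mD).
  apply: (@le_trans _ _ (S k)).
    apply: integral_cover2 => //.
    - exact: (borel_lebesgue mD).
    - exact: (borel_lebesgue (mG k)).
    - exact: (borel_lebesgue (mG k.+1)).
    move=> y Dy; have [] := cover k s _ km sk Dy; rewrite subrK; by [left|right].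
  rewrite (bigD1 (Ordinal km)) //= indicE mem_set ?mule1; last by rewrite /J /= in_itv.
  by rewrite leeDl // sume_ge0.
rewrite (@ge0_integral_sum _ _ R (@lebesgue_measure R) setT measurableT 'I_m
  (fun k s => S k * (\1_(J k) s)%:E) (fun k => mS k) (fun k s _ => SJ0 k s)).
apply: lee_sum => k _; rewrite ge0_integralZl //; last by apply/measurable_EFinP; apply: measurable_indic; exact: measurable_itv.
rewrite integral_indic //; last exact: measurable_itv.
rewrite setIT /= lebesgue_measure_itv /= lte_fin.
rewrite -/(S k) lee_wpmul2l //; case: ifP => _; last by rewrite lee_fin ltW.
by rewrite -EFinB lee_fin -mulrBl -natr1 addrAC subrr add0r mul1r.
Qed.

End integrals.

(** * Polygonal paths along the coordinate axes *)

Section shift1.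
Context {R : realType}.
Local Open Scope ereal_scope.
Local Notation leb := (@lebesgue_measure R).

Lemma lebesgue_measure_shift (a : R) (A : set R) : measurable A ->
  pushforward leb ((fun x => x + a)%R : _ -> measurableTypeR R) A = leb A.
Proof.
have ma : measurable_fun [set: measurableTypeR R]
    ((fun x => x + a)%R : measurableTypeR R -> measurableTypeR R).
  by apply: measurable_funD => //; exact: measurable_cst.
move=> mA; apply/esym/lebesgue_measure_unique => //= _ [[b c]] _ <-.
rewrite /pushforward (_ : _ @^-1` _ = `](b - a)%R, (c - a)%R]%classic).
  rewrite !lebesgue_measure_itv/= !lte_fin ltrBlDr subrK.
  by case: ifP => // _; rewrite -!EFinB; congr EFin; ring.
by apply/seteqP; split => x /=; rewrite !in_itv /= ltrBlDr lerBrDr.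
Qed.

Lemma integral_shift1_le (f : R -> \bar R) (a b L : R) :
  measurable_fun [set: R] f -> (forall x, 0 <= f x) -> (0 <= a)%R -> (b <= L)%R ->
  \int[leb]_(s in `[0%R, (b - a)%R]) f (s + a)%R <= \int[leb]_(s in `[0%R, L]) f s.
Proof.
move=> mf f0 a0 bL.
have ma : measurable_fun [set: measurableTypeR R]
    ((fun x => x + a)%R : measurableTypeR R -> measurableTypeR R).
  by apply: measurable_funD => //; exact: measurable_cst.
rewrite (_ : `[0%R, (b - a)%R]%classic =
    ((fun x => x + a)%R : _ -> measurableTypeR R) @^-1` `[a, b]); last first.
  by apply/seteqP; split => x /=; rewrite !in_itv /= lerBrDr lerDr.
have mfab : measurable_fun `[a, b]%classic f by exact: measurable_funS mf.
rewrite -(@ge0_integral_pushforward _ _ _ _ _ _ ma leb `[a, b]%classic f) //.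
rewrite (eq_measure_integral leb); last by move=> A mA _; exact: lebesgue_measure_shift.
apply: ge0_subset_integral => //; first exact: measurable_funS mf.
by move=> x /=; rewrite !in_itv /= => /andP[ax xb]; apply/andP; split; [exact: le_trans ax|exact: le_trans bL].
Qed.

End shift1.

Section clamp.
Context {R : realType}.
Implicit Types (h t s : R).

(** The projection of [t] to the interval from 0 to [h]. *)
Definition clamp h t : R := Num.max 0 (Num.min t h).

Lemma clampE h t : 0 <= h ->
  clamp h t = if t <= 0 then 0 else if t <= h then t else h.
Proof.
rewrite /clamp => h0; have [t0|t0] := leP t 0.
  by rewrite max_l // ge_min t0.
have [th|/ltW th] := leP t h; first by rewrite max_r // ltW.
by rewrite max_r.
Qed.

Lemma clamp_mono h t s : 0 <= h -> t <= s -> clamp h t <= clamp h s.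
Proof. by move=> h0 ts; rewrite !clampE //; do ! case: ifP => ?; lra. Qed.

Lemma clamp_lip h t s : 0 <= h -> t <= s -> clamp h s - clamp h t <= s - t.
Proof. by move=> h0 ts; rewrite !clampE //; do ! case: ifP => ?; lra. Qed.

Lemma sum_clamp h m t : 0 <= h ->
  \sum_(k < m) clamp h (t - k%:R * h) = clamp (m%:R * h) t.
Proof.
move=> h0; elim: m => [|m IH].
  by rewrite big_ord0 mul0r clampE //; do ! case: ifP => ?; lra.
have m0 : 0 <= m%:R * h by rewrite mulr_ge0.
rewrite big_ord_recr /= IH -natr1 mulrDl mul1r.
move: (m%:R * h) m0 => b b0.
by rewrite !clampE ?addr_ge0 //; do ! case: ifP => ?; lra.
Qed.

Lemma clamp0 h t : 0 <= h -> t <= 0 -> clamp h t = 0.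
Proof. by move=> h0 t0; rewrite clampE // t0. Qed.

Lemma clamp_top h t : 0 <= h -> h <= t -> clamp h t = h.
Proof. by move=> h0 ht; rewrite clampE //; do ! case: ifP => ?; lra. Qed.

Lemma clamp_mid h t : 0 <= t <= h -> clamp h t = t.
Proof.
by move=> /andP[t0 th]; rewrite clampE ?(le_trans t0) //; do ! case: ifP => ?; lra.
Qed.

End clamp.

Section euclidean.
Context {R : realType} {n : nat}.
Implicit Types x y : 'rV[R]_n.

Definition l1norm x : R := \sum_i `|x 0 i|.

Lemma enorm_ge0 x : 0 <= enorm x.
Proof. exact: sqrtr_ge0. Qed.

Lemma enorm_l1 x : enorm x <= l1norm x.
Proof.
have l0 : 0 <= l1norm x by apply: sumr_ge0.
have -> : l1norm x = Num.sqrt (l1norm x ^+ 2) by rewrite sqrtr_sqr ger0_norm.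
apply: ler_wsqrtr; rewrite expr2 {1}/l1norm mulr_suml; apply: ler_sum => i _.
rewrite -real_normK ?num_real // expr2 ler_wpM2l //.
by rewrite /l1norm (bigD1 i) //= lerDl sumr_ge0.
Qed.

Lemma enormZ a x : enorm (a *: x) = `|a| * enorm x.
Proof.
rewrite /enorm -sqrtr_sqr -sqrtrM ?sqr_ge0 // mulr_sumr; congr Num.sqrt.
by apply: eq_bigr => i _; rewrite mxE exprMn.
Qed.

Lemma enormN x : enorm (- x) = enorm x.
Proof. by rewrite -scaleN1r enormZ normrN1 mul1r. Qed.

Lemma l1normZ a x : l1norm (a *: x) = `|a| * l1norm x.
Proof. by rewrite /l1norm mulr_sumr; apply: eq_bigr => i _; rewrite mxE normrM. Qed.

Lemma l1norm_sum (I : Type) (r : seq I) (F : I -> 'rV[R]_n) :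
  l1norm (\sum_(k <- r) F k) <= \sum_(k <- r) l1norm (F k).
Proof.
elim: r => [|k r IH].
  by rewrite !big_nil /l1norm big1 // => i _; rewrite mxE normr0.
rewrite !big_cons; apply: le_trans (lerD (lexx _) IH); rewrite /l1norm -big_split /=.
by apply: ler_sum => i _; rewrite mxE; exact: ler_normD.
Qed.

Lemma coord_le_enorm x i : `|x 0 i| <= enorm x.
Proof.
rewrite -sqrtr_sqr; apply: ler_wsqrtr.
by rewrite (bigD1 i) //= lerDl; apply: sumr_ge0 => j _; exact: sqr_ge0.
Qed.

Lemma norm_le_enorm x : `|x| <= enorm x.
Proof. by apply/rV_norm_le => [|i]; [exact: enorm_ge0|exact: coord_le_enorm]. Qed.

Lemma enorm0 : enorm (0 : 'rV[R]_n) = 0.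
Proof. by rewrite -(scale0r 0) enormZ normr0 mul0r. Qed.

Lemma continuous_enorm : continuous (@enorm R n).
Proof.
have cs : continuous (fun x : 'rV[R]_n => \sum_(i < n) x 0 i ^+ 2).
  apply: continuous_big => [|i _ x]; first exact: add_continuous.
  apply: (@continuous_comp _ _ _ (fun x : 'rV[R]_n => x 0 i) (fun y : R => y ^+ 2)).
    exact: coord_continuous.
  exact: exprn_continuous.
move=> x; apply: (@continuous_comp _ _ _ (fun x : 'rV[R]_n => \sum_(i < n) x 0 i ^+ 2) Num.sqrt).
  exact: cs.
exact: sqrt_continuous.
Qed.

Definition axis_unit x := exists i, exists2 e : R, `|e| = 1 & x = e *: delta_mx 0 i.

Lemma enorm_axis x : axis_unit x -> enorm x = 1.
Proof.
move=> [i [e e1 ->]]; rewrite enormZ e1 mul1r /enorm (bigD1 i) //= mxE !eqxx.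
by rewrite big1 ?addr0 ?expr1n ?sqrtr1 // => j /negbTE ji; rewrite mxE ji andbF expr0n.
Qed.

Lemma l1norm_axis x : axis_unit x -> l1norm x = 1.
Proof.
move=> [i [e e1 ->]]; rewrite l1normZ e1 mul1r /l1norm (bigD1 i) //= mxE !eqxx normr1.
by rewrite big1 ?addr0 // => j /negbTE ji; rewrite mxE ji andbF normr0.
Qed.

End euclidean.

Section axis_path.
Context {R : realType} {n : nat}.
Variables (h : R) (m : nat) (w : nat -> 'rV[R]_n).
Hypothesis h0 : 0 < h.
Hypothesis w1 : forall k, (k < m)%N -> axis_unit (w k.+1 - w k).

(** The polygonal path with the vertices [h *: (w k - w 0)], run through with
  unit speed when all edges [w k.+1 - w k] are axis-parallel of length 1. As a
  sum of clamped edges it is constant before its start and after its end. *)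
Definition axis_path (s : R) : 'rV[R]_n :=
  \sum_(k < m) clamp h (s - k%:R * h) *: (w k.+1 - w k).

Lemma axis_pathE k s : (k < m)%N -> k%:R * h <= s <= k.+1%:R * h ->
  axis_path s = h *: (w k - w 0%N) + (s - k%:R * h) *: (w k.+1 - w k).
Proof.
move=> km /andP[ks sk].
have h0' := ltW h0.
rewrite /axis_path -(big_mkord xpredT (fun j => clamp h (s - j%:R * h) *: (w j.+1 - w j))).
rewrite (big_cat_nat (n := k)) //=; last exact: ltnW.
rewrite (big_ltn km) addrA -[RHS]addr0; congr (_ + _); last first.
  rewrite big_nat big1 // => j /andP[kj jm]; rewrite clamp0 ?scale0r //.
  by rewrite subr_le0; apply: le_trans sk _; rewrite ler_wpM2r // ler_nat.
congr (_ + _).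
  rewrite -telescope_sumr // scaler_sumr big_nat [RHS]big_nat.
  apply: eq_bigr => j /andP[_ jk]; rewrite clamp_top //.
  rewrite lerBrDr; apply: le_trans ks.
  by rewrite -[X in X + _]mul1r -mulrDl ler_wpM2r // addrC natr1 ler_nat.
by rewrite clamp_mid // subr_ge0 ks /= lerBlDr -[X in X + _]mul1r -mulrDl addrC natr1.
Qed.

(** In the l1 norm the edges add up: the increments of the clamped parameters
  telescope to that of [clamp (m%:R * h)] by [sum_clamp]. *)
Lemma axis_path_l1 s t : s <= t -> l1norm (axis_path t - axis_path s) <= t - s.
Proof.
move=> st; rewrite /axis_path -sumrB.
apply: le_trans (l1norm_sum _ _) _.
have -> : \sum_(k < m) l1norm (clamp h (t - k%:R * h) *: (w k.+1 - w k) -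
    clamp h (s - k%:R * h) *: (w k.+1 - w k)) =
    \sum_(k < m) (clamp h (t - k%:R * h) - clamp h (s - k%:R * h)).
  apply: eq_bigr => k _; rewrite -scalerBl l1normZ l1norm_axis ?mulr1; last exact: w1.
  by rewrite ger0_norm // subr_ge0; apply: clamp_mono; rewrite ?lerB ?(ltW h0).
rewrite sumrB !sum_clamp ?(ltW h0) //; apply: clamp_lip => //.
by rewrite mulr_ge0 ?(ltW h0).
Qed.

Lemma axis_path_lip s t : enorm (axis_path t - axis_path s) <= `|t - s|.
Proof.
have [st|/ltW ts] := leP s t.
  by rewrite ger0_norm ?subr_ge0 //; apply: le_trans (enorm_l1 _) _; exact: axis_path_l1.
rewrite distrC -enormN opprB ger0_norm ?subr_ge0 //.
by apply: le_trans (enorm_l1 _) _; exact: axis_path_l1.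
Qed.

Lemma axis_path_continuous : continuous axis_path.
Proof.
move=> s; apply/cvgrPdist_lt => e e0; near=> t.
apply: le_lt_trans (norm_le_enorm _) _; apply: le_lt_trans (axis_path_lip _ _) _.
near: t; exact: cvgr_dist_lt.
Unshelve. all: by end_near. Qed.

Lemma axis_path0 : axis_path 0 = 0.
Proof.
rewrite /axis_path big1 // => k _; rewrite clamp0 ?scale0r //; first exact: ltW.
by rewrite sub0r oppr_le0 mulr_ge0 // ltW.
Qed.

Lemma axis_path_end : axis_path (m%:R * h) = h *: (w m - w 0%N).
Proof.
rewrite /axis_path -(big_mkord xpredT (fun j => clamp h (m%:R * h - j%:R * h) *: (w j.+1 - w j))).
rewrite -telescope_sumr // scaler_sumr big_nat [RHS]big_nat.
apply: eq_bigr => j /andP[_ jm]; rewrite clamp_top ?(ltW h0) //.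
rewrite lerBrDr -[X in X + _]mul1r -mulrDl ler_wpM2r ?(ltW h0) //.
by rewrite addrC natr1 ler_nat.
Qed.

Lemma axis_path_speed k s t : (k < m)%N -> k%:R * h <= s -> s <= t -> t <= k.+1%:R * h ->
  enorm (axis_path t - axis_path s) = t - s.
Proof.
move=> km ks st tk.
rewrite !(axis_pathE km) ?ks ?tk ?(le_trans ks st) ?(le_trans st tk) //.
rewrite opprD addrACA subrr add0r -scalerBl enormZ enorm_axis ?mulr1; last exact: w1.
have -> : t - k%:R * h - (s - k%:R * h) = t - s by ring.
by rewrite ger0_norm // subr_ge0.
Qed.

Lemma polygon_length_cons (c : R -> 'rV[R]_n) a x s :
  polygon_length c a (x :: s) = enorm (c x - c a) + polygon_length c x s.
Proof. by rewrite /polygon_length /= big_cons. Qed.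

Lemma polygon_length_cat (c : R -> 'rV[R]_n) a s t :
  polygon_length c a (s ++ t) = polygon_length c a s + polygon_length c (last a s) t.
Proof.
elim: s a => [|x s IH] a; first by rewrite /polygon_length big_nil add0r.
by rewrite cat_cons !polygon_length_cons IH addrA.
Qed.

Variable x0 : 'rV[R]_n.
Let c (s : R) : 'rV[R]_n := x0 + axis_path s.

Let cB s t : c t - c s = axis_path t - axis_path s.
Proof. by rewrite /c opprD addrACA subrr add0r. Qed.

(** The partition consists of the parameters of the vertices, between which the
  path moves on a line with unit speed. *)
Lemma axis_path_partition a b : 0 <= a -> a <= b -> b <= m%:R * h ->
  exists2 s, itv_partition a b s & polygon_length c a s = b - a.
Proof.
have nilP x : exists2 s, itv_partition x x s & polygon_length c x s = x - x.
  by exists [::]; [split=> /=|rewrite /polygon_length /= big_nil subrr].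
suff H k : (k <= m)%N -> forall x y, 0 <= x -> x <= y -> y <= k%:R * h ->
    exists2 s, itv_partition x y s & polygon_length c x s = y - x.
  by move=> a0 ab bm; exact: (H m).
elim: k => [|k IH] km x y x0' xy yk.
  have -> : y = x by rewrite mul0r in yk; lra.
  exact: nilP.
have [yk'|/ltW yk'] := leP y (k%:R * h); first exact: IH (ltnW km) _ _ _ _ _.
have cell z : k%:R * h <= z -> z <= y ->
    exists2 s, itv_partition z y s & polygon_length c z s = y - z.
  move=> kz; rewrite le_eqVlt => /orP[/eqP ->|zy]; first exact: nilP.
  exists [:: y]; first exact: itv_partition1.
  rewrite polygon_length_cons /polygon_length big_nil addr0 cB.
  exact: (axis_path_speed km kz (ltW zy) yk).
have [xk|/ltW kx] := leP x (k%:R * h); last exact: cell.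
have [s1 p1 l1] := IH (ltnW km) x (k%:R * h) x0' xk (lexx _).
have [s2 p2 l2] := cell _ (lexx (k%:R * h)) yk'.
exists (s1 ++ s2); first exact: itv_partition_cat p1 p2.
have [_ /eqP e1] := p1.
by rewrite polygon_length_cat e1 l1 l2; ring.
Qed.

Lemma axis_path_arc_length a b : 0 <= a -> a <= b -> b <= m%:R * h ->
  arc_length c a b = (b - a)%:E.
Proof.
move=> a0 ab bm; apply/eqP; rewrite eq_le; apply/andP; split.
  apply: ge_ereal_sup => _ [s sP <-]; rewrite lee_fin.
  elim: s a sP {a0 ab} => [|x s IH] a.
    by move=> /itv_partition_nil ->; rewrite /polygon_length big_nil subrr.
  move=> xP; rewrite polygon_length_cons; have := IH x (itv_partition_cons xP).
  have ax : a < x by case: xP => /= /andP[].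
  rewrite cB; have := axis_path_lip a x; rewrite ger0_norm ?subr_ge0 ?(ltW ax) //.
  lra.
have [s sP sl] := axis_path_partition a0 ab bm.
by apply: ereal_sup_ubound; exists s => //; rewrite sl.
Qed.

(** The path is parametrized by arc length, up to a shift by [a], so that its
  normal representation is the path itself. *)
Lemma axis_path_line_integral (rho : 'rV[R]_n -> \bar R) (a b : R) :
  borel_fun rho -> (forall x, 0 <= rho x)%E ->
  0 <= a -> a <= b -> b <= m%:R * h ->
  (line_integral rho (Curve a b (fun t => fin_pt (c t))) <=
   \int[@lebesgue_measure R]_(s in `[0%R, (m%:R * h)%R]) rho (c s))%E.
Proof.
move=> mrho rho0 a0 ab bm; rewrite /line_integral /=.
have ft : finite_trace (Curve a b (fun t => fin_pt (c t))) = c by [].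
rewrite ft axis_path_arc_length //=.
have mrc : measurable_fun [set: R] (fun s => rho (c s)).
  have mc : measurable_fun [set: R] (c : R -> g_sigma_algebraType (@open 'rV[R]_n)).
    apply: measurable_fun_rV => i; apply: continuous_measurable_fun => s.
    apply: (@continuous_comp _ _ _ c (fun x : 'rV[R]_n => x 0 i)); last exact: coord_continuous.
    apply: (@cvgD _ 'rV[R]_n); [exact: cvg_cst|exact: axis_path_continuous].
  exact: (measurableT_comp mrho mc).
apply: le_trans (integral_shift1_le mrc (fun s => rho0 (c s)) a0 bm).
rewrite le_eqVlt; apply/orP; left; apply/eqP; apply: eq_integral => s.
rewrite inE /= in_itv /= => /andP[s0 sb]; congr rho.
rewrite /normal_repr ft; congr c.
case: xgetP => [t _ [/andP[at' tb]]|]; last first.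
  have asa : a <= s + a by rewrite lerDr.
  have sab : s + a <= b by rewrite -lerBrDr.
  move=> /(_ (s + a))[]; split => /=; first by rewrite asa.
  by rewrite axis_path_arc_length ?addrK // (le_trans sab).
rewrite axis_path_arc_length // ?(le_trans tb) //.
by move=> [<-]; rewrite subrK.
Qed.

End axis_path.

(** * The cells of a cubical grid *)

Section levels.
Context {R : realType} {n : nat}.

(** The points [a] of the level [t0] in [U], moved radially to the neighbouring
  levels, serve for these levels as well; compactness of the interval of levels
  then gives one radius for all. *)
Lemma uniform_level (yc : 'rV[R]_n) (U : set 'rV[R]_n) (s' s : R) :
  0 < s' -> open U ->
  (forall t, s' <= t <= s -> exists2 a, U a & `|a - yc| = t) ->
  exists2 e : R, 0 < e & forall t, s' <= t <= s ->
    exists2 a, `|a - yc| = t & forall y, `|y - a| <= e -> U y.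
Proof.
move=> s0 oU H.
pose P (e t : R) := exists2 a, `|a - yc| = t & forall y, `|y - a| <= e -> U y.
have /compact_near_coveringP := @segment_compact R s' s.
move=> /(_ _ (0^'+) P _) [].
  move=> t0 /= t0I; have t00 : 0 < t0 by move: t0I; rewrite /= in_itv /= => /andP[+ _]; exact: lt_le_trans.
  have [a0 Ua0 at0] : exists2 a, U a & `|a - yc| = t0 by apply: H; rewrite in_itv in t0I.
  have : nbhs a0 U by exact: open_nbhs_nbhs.
  move=> /nbhs_ballP[e /= e0 eU].
  have e2 : 0 < e / 2 by rewrite divr_gt0.
  exists ([set t | `|t0 - t| < Num.min (e / 2) t0], [set d | d < e / 2]) => /=.
    split; first by exists (Num.min (e / 2) t0) => //=; rewrite lt_min e2.
    by exists (e / 2) => // d /=; rewrite sub0r normrN => de _; apply: le_lt_trans de; exact: ler_norm.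
  move=> [t d] /= [tt de]; move: tt; rewrite lt_min => /andP[te tt0].
  have tp : 0 < t by move: tt0; rewrite ltr_norml; lra.
  exists (yc + (t / t0) *: (a0 - yc)).
    rewrite addrC addKr normrZ at0 ger0_norm ?divr_ge0 ?(ltW tp) ?(ltW t00) //.
    by rewrite divfK // gt_eqF.
  move=> y yd; apply: eU; rewrite -ball_normE /= distrC.
  apply: le_lt_trans (ler_distD (yc + (t / t0) *: (a0 - yc)) _ _) _.
  have -> : yc + (t / t0) *: (a0 - yc) - a0 = (t / t0 - 1) *: (a0 - yc).
    by rewrite scalerBl scale1r opprB addrCA addrA.
  have -> : `|(t / t0 - 1) *: (a0 - yc)| = `|t0 - t|.
    rewrite normrZ at0 -{2}(ger0_norm (ltW t00)) -normrM mulrBl mul1r divfK ?gt_eqF //.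
    exact: distrC.
  by rewrite [e]splitr; apply: ltrD => //; apply: le_lt_trans de.
move=> e /= e0 eP.
have [d [d0 dP]] : exists d, 0 < d /\ d < e by exists (e / 2); lra.
exists d => // t tI; apply: (eP d) => //=.
by rewrite sub0r normrN gtr0_norm.
Qed.

End levels.

Lemma nat_cell (R : realType) (M : nat) (r : R) : 0 < r -> r <= M%:R ->
  exists z : 'I_M, (z%:R < r <= z.+1%:R).
Proof.
move=> r0 rM.
have M0 : (0 < M)%N by rewrite -(ltr_nat R); exact: lt_le_trans rM.
have ex : exists k, r <= k.+1%:R by exists M.-1; rewrite prednK.
have [k rk kmin] := ex_minnP ex.
have kM : (k < M)%N.
  by rewrite -[M]prednK // ltnS; apply: kmin; rewrite prednK.
exists (Ordinal kM) => /=; rewrite rk andbT.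
case: k rk kmin {kM} => [//|k] rk kmin.
by rewrite ltNge; apply/negP => /kmin; rewrite ltnn.
Qed.

Section lattice.
Context {R : realType} {n : nat}.
Variables (yc : 'rV[R]_n) (h : R) (N : nat).
Hypothesis h0 : 0 < h.
Local Notation cellt := {ffun 'I_n -> 'I_(N + N)}.
Implicit Types (z : cellt) (x y : 'rV[R]_n).

(** Integer coordinates of a cell. Only differences of corners matter, so the
  centre and the mesh of the grid do not enter. *)
Definition corner z : 'rV[R]_n := \row_i ((z i)%:R : R).

(** The half-open cube of side [h] with index [z] in the grid of [2 * N] cells
  per side centred at [yc]. *)
Definition cell z : set 'rV[R]_n :=
  box (Some (\row_i (yc 0 i + h * ((z i)%:R - N%:R)),
             \row_i (yc 0 i + h * ((z i)%:R - N%:R) + h))).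

Lemma cellP z x : cell z x <->
  forall i, h * (z i)%:R < x 0 i - yc 0 i + h * N%:R <= h * (z i)%:R + h.
Proof.
by split => H i; move: (H i); rewrite /cell !mxE => /andP[a b]; apply/andP; split; lra.
Qed.

Lemma cell_inj z z' x : cell z x -> cell z' x -> z = z'.
Proof.
move=> /cellP zx /cellP zx'; apply/ffunP => i; apply/val_inj => /=.
have := zx i; have := zx' i; set q := _ - _ + _; clearbody q => /andP[a b] /andP[c e].
have L (a' b' : nat) : h * a'%:R < q -> q <= h * b'%:R + h -> (a' <= b')%N.
  move=> H1 H2; rewrite -ltnS -(ltr_nat R) -(ltr_pM2l h0) -natr1 mulrDr mulr1.
  exact: lt_le_trans H1 H2.
by apply/eqP; rewrite eqn_leq !L.
Qed.

Lemma cell_dist z x y : cell z x -> cell z y -> `|x - y| <= h.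
Proof.
move=> /cellP zx /cellP zy; apply/rV_norm_le => [|i]; first exact: ltW.
rewrite !mxE ler_norml; move: (zx i) (zy i) => /andP[a b] /andP[c e].
by apply/andP; split; lra.
Qed.

Lemma cell_in_big z x : cell z x -> `|x - yc| <= h * N%:R.
Proof.
move=> /cellP zx; apply/rV_norm_le => [|i]; first by rewrite mulr_ge0 // ltW.
rewrite !mxE ler_norml; move: (zx i) => /andP[a b].
have z0 : 0 <= h * (z i)%:R by rewrite mulr_ge0 // ltW.
have zN : h * (z i)%:R + h <= h * N%:R + h * N%:R.
  rewrite -{2}[h]mulr1 -!mulrDr ler_wpM2l ?(ltW h0) //.
  by rewrite natr1 -natrD ler_nat ltn_ord.
by apply/andP; split; lra.
Qed.

Lemma cell_out k z x : (k <= N)%N -> cell z x -> z \notin cubek n N k ->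
  h * k%:R <= `|x - yc|.
Proof.
move=> kN zx; rewrite leNgt => /cubekP zk; apply/negP => xk; apply: zk => i.
move/cellP: zx => /(_ i) /andP[a b].
have k0 : 0 < h * k%:R by apply: le_lt_trans xk.
have := (rV_norm_lt (x - yc) k0).1 xk i; rewrite !mxE ltr_norml => /andP[c e].
have L (p q : nat) : h * p%:R < h * q%:R -> (p < q)%N.
  by rewrite ltr_pM2l // ltr_nat.
apply/andP; split.
  rewrite -ltnS; apply: L; rewrite -natr1 mulrDr mulr1 natrB // mulrBr; lra.
have -> : (N - k + (k + k) = N + k)%N by move: kN; clear; lia.
by apply: L; rewrite natrD mulrDr; lra.
Qed.

(** The level [h * (k - 1 / 2)] runs in the middle of the k-th layer of cells,
  which makes it insensitive to the choice of the closed side of the half-open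
  cells. *)
Lemma cell_of_level (k : nat) a : (0 < k <= N)%N ->
  `|a - yc| = h * (k%:R - 1 / 2) ->
  exists2 z, cell z a & z \in shellk n N k.
Proof.
move=> /andP[k0 kN] ak.
have hk : 0 < h * (k%:R - 1 / 2).
  rewrite mulr_gt0 // subr_gt0; apply: (@lt_le_trans _ _ 1); first lra.
  by rewrite ler1n.
have n0 : a - yc != 0 by rewrite -normr_gt0 ak.
have [i0 i0E] : exists i, `|(a - yc) 0 i| = h * (k%:R - 1 / 2).
  have := mx_norm_neq0 (x := a - yc); rewrite -[mx_norm _]/(`|a - yc|) ak.
  move=> /(_ _)[]; first by rewrite gt_eqF.
  by move=> [j i] /= ->; exists i; rewrite ord1.
pose r i := (a 0 i - yc 0 i) / h + N%:R.
have rb i : N%:R - k%:R + 1 / 2 <= r i <= N%:R + k%:R - 1 / 2.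
  have := coord_le_norm (a - yc) i; rewrite ak !mxE ler_norml /r => /andP[b c].
  have hN : h != 0 by rewrite gt_eqF.
  apply/andP; split.
    suff : - (k%:R - 1 / 2) <= (a 0 i - yc 0 i) / h by lra.
    by rewrite ler_pdivlMr // mulNr mulrC.
  suff : (a 0 i - yc 0 i) / h <= k%:R - 1 / 2 by lra.
  by rewrite ler_pdivrMr // mulrC.
have kNR : k%:R <= N%:R :> R by rewrite ler_nat.
have cz i : exists z : 'I_(N + N), z%:R < r i <= z.+1%:R.
  by apply: nat_cell; have /andP[] := rb i; rewrite ?natrD; lra.
have [z zP] := choice cz.
have L (p q : nat) : (p%:R : R) < q%:R -> (p < q)%N by rewrite ltr_nat.
have NkE : (N - k)%:R = N%:R - k%:R :> R by rewrite natrB.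
have NkE' : (N + k)%:R = N%:R + k%:R :> R by rewrite natrD.
exists [ffun i => z i].
  apply/cellP => i; rewrite ffunE; have /andP[b c] := zP i.
  have -> : a 0 i - yc 0 i + h * N%:R = h * r i.
    by rewrite /r mulrDr mulrCA divff ?mulr1 // gt_eqF.
  rewrite ltr_pM2l // b /= -[X in _ + X]mulr1 -mulrDr natr1.
  by rewrite ler_pM2l.
rewrite -[_ \in _]/((_ \in cubek n N k) && (_ \notin cubek n N k.-1)).
apply/andP; split.
  apply/cubekP => i; rewrite ffunE; have /andP[b c] := zP i; have /andP[b' c'] := rb i.
  rewrite -natr1 in c.
  apply/andP; split.
    rewrite -ltnS; apply: L; rewrite -natr1 NkE; lra.
  have -> : (N - k + (k + k) = N + k)%N by move: kN; clear; lia.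
  by apply: L; rewrite NkE'; lra.
apply/cubekP => /(_ i0); rewrite ffunE; have /andP[b c] := zP i0.
rewrite -natr1 in c.
have : r i0 = N%:R + (k%:R - 1 / 2) \/ r i0 = N%:R - (k%:R - 1 / 2).
  move: i0E; rewrite !mxE /r => i0E.
  have [p|p] := leP 0 (a 0 i0 - yc 0 i0).
    by left; rewrite ger0_norm // in i0E; rewrite i0E; field; rewrite gt_eqF.
  right; rewrite ltr0_norm // in i0E.
  have -> : a 0 i0 - yc 0 i0 = - (h * (k%:R - 1 / 2)) by lra.
  by field; rewrite gt_eqF.
case=> rE.
  have : (N + k < (z i0).+2)%N.
    by apply: L; rewrite -natr1 -natr1 NkE'; lra.
  by move: k0 kN; clear; lia.
have : (z i0 < (N - k).+1)%N.
  by apply: L; rewrite -natr1 NkE; lra.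
by move: k0 kN; clear; lia.
Qed.

End lattice.

(** * The modulus of the paths joining two sets across a ring *)

Definition lattice_step n M (z z' : {ffun 'I_n -> 'I_M}) := adj z z' \/ adj z' z.

Section chain_cost.
Context {R : realType} {T : Type}.
Variables (F : T -> R) (region black : T -> Prop) (step : T -> T -> Prop).
Hypothesis F0 : forall z, 0 <= F z.
Hypothesis step_sym : forall z z', step z z' -> step z' z.

(** The weights of the chains from a black point to [z] through the region,
  where a step costs the sum of [F] at its two ends. *)
Definition chain_cost (z : T) : set R := [set r | exists m (v : nat -> T),
  [/\ black (v 0%N), v m = z, (forall k, (k <= m)%N -> region (v k)),
      (forall k, (k < m)%N -> step (v k) (v k.+1)) &
      r = \sum_(k < m) (F (v k) + F (v k.+1))]].

(** The distance to the black points for these weights, cut off at 1; the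
  cut-off also gives a value to the points that no chain reaches. *)
Definition cost (z : T) : R := inf ([set 1] `|` chain_cost z).

Let cost_lb z : lbound ([set 1] `|` chain_cost z) 0.
Proof.
move=> r [->|[m [v [_ _ _ _ ->]]]]; first exact: ler01.
by apply: sumr_ge0 => k _; rewrite addr_ge0.
Qed.

Let cost_has_lb z : has_lbound ([set 1] `|` chain_cost z).
Proof. by exists 0; exact: cost_lb. Qed.

Let cost_nonempty z : ([set 1] `|` chain_cost z) !=set0.
Proof. by exists 1; left. Qed.

Lemma cost_black z : black z -> region z -> cost z = 0.
Proof.
move=> bz rz; apply/eqP; rewrite eq_le; apply/andP; split.
  apply: ge_inf; first exact: cost_has_lb.
  right; exists 0%N, (fun=> z); split => //.
  by rewrite big_ord0.
by apply: lb_le_inf; [exact: cost_nonempty|exact: cost_lb].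
Qed.

Lemma cost_eq1 z : (forall r, chain_cost z r -> 1 <= r) -> cost z = 1.
Proof.
move=> H; apply/eqP; rewrite eq_le; apply/andP; split.
  by apply: ge_inf; [exact: cost_has_lb|left].
by apply: lb_le_inf => [|r [->//|/H//]]; exact: cost_nonempty.
Qed.

Let cost_lip1 z z' : region z' -> step z z' -> cost z' <= cost z + (F z + F z').
Proof.
move=> rz' zz'; rewrite -lerBlDr; apply: lb_le_inf; first exact: cost_nonempty.
move=> r [->|[m [v [bv vm rv sv ->]]]]; rewrite lerBlDr.
  apply: (@le_trans _ _ 1); last by rewrite lerDl addr_ge0.
  by apply: ge_inf; [exact: cost_has_lb|left].
apply: ge_inf; first exact: cost_has_lb.
right; exists m.+1, (fun k => if (k <= m)%N then v k else z'); split => //.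
- by rewrite ltnn.
- by move=> k km; case: ifP => [kk|_]; [exact: rv|by []].
- move=> k km; rewrite -ltnS km; case: ifP => [|/negbT]; first exact: sv.
  rewrite -leqNgt => mk; suff -> : k = m by rewrite vm.
  by apply/eqP; rewrite eqn_leq mk andbT -ltnS.
rewrite big_ord_recr /= leqnn ltnn vm; congr (_ + _).
by apply: eq_bigr => k _; rewrite ltn_ord (ltnW (ltn_ord k)).
Qed.

(** A chain to one end of a step, followed by the step, is a chain to its other
  end. *)
Lemma cost_lip z z' : region z -> region z' -> step z z' ->
  `|cost z - cost z'| <= F z + F z'.
Proof.
move=> rz rz' zz'; have := cost_lip1 rz' zz'; have := cost_lip1 rz (step_sym zz').
by rewrite ler_norml => H1 H2; apply/andP; split; lra.
Qed.

End chain_cost.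

Section lattice_chain.
Context {R : realType} {n : nat}.
Variables (yc : 'rV[R]_n) (h : R) (N : nat).
Hypothesis h0 : 0 < h.
Local Notation cellt := {ffun 'I_n -> 'I_(N + N)}.
Implicit Types (z : cellt) (x y : 'rV[R]_n).

Lemma lattice_step_sym z z' : lattice_step z z' -> lattice_step z' z.
Proof. by case; [right|left]. Qed.

Lemma lattice_step_diff z z' : lattice_step z z' ->
  exists i (e : R), [/\ e = 1 \/ e = -1, (z' i)%:R = (z i)%:R + e :> R &
    forall j, j != i -> z j = z' j].
Proof.
case=> -[i zj zi]; exists i.
  by exists 1; split => //; [left|rewrite zi natr1].
exists (-1); split; [by right|by rewrite zi -natr1 addrK|].
by move=> j ji; rewrite zj.
Qed.

Lemma lattice_step_axis z z' : lattice_step z z' ->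
  axis_unit (corner (R := R) z' - corner z).
Proof.
move=> /lattice_step_diff[i [e [e1 zi zj]]]; exists i; exists e.
  by case: e1 => ->; rewrite ?normrN normr1.
apply/rowP => j; rewrite !mxE eqxx /=; case: eqVneq => [->|ji].
  by rewrite zi addrAC subrr add0r mulr1.
by rewrite (zj _ ji) subrr mulr0.
Qed.

(** Along the step from [z] to [z'] a point of a cell with changed i-th
  coordinate stays in the union of the two cells, whatever its position in the
  cell. *)
Lemma lattice_step_cover z z' z0 x (th : R) : cell yc h z0 x ->
  lattice_step z z' -> 0 <= th <= h ->
  let y := x + (h *: (corner z - corner z0) + th *: (corner z' - corner z)) in
  cell yc h z y \/ cell yc h z' y.
Proof.
move=> /cellP zx /lattice_step_diff[i [e [e1 zi zj]]] /andP[t0 th1] y.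
pose r j := x 0 j - yc 0 j + h * N%:R - h * (z0 j)%:R.
have rb j : 0 < r j <= h by have := zx j; rewrite /r => /andP[? ?]; apply/andP; split; lra.
have yE j : y 0 j - yc 0 j + h * N%:R = h * (z j)%:R + r j + th * ((z' j)%:R - (z j)%:R).
  by rewrite /y !mxE /r; ring.
have other (w : cellt) j : j != i -> w j = z j ->
    h * (w j)%:R < y 0 j - yc 0 j + h * N%:R <= h * (w j)%:R + h.
  move=> ji ->; rewrite yE -(zj _ ji) subrr mulr0 addr0.
  by have /andP[? ?] := rb j; apply/andP; split; lra.
have yi : y 0 i - yc 0 i + h * N%:R = h * (z i)%:R + r i + th * e.
  by rewrite yE zi; ring.
have /andP[r0 r1] := rb i.
have close (w : cellt) : (forall j, j != i -> w j = z j) ->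
    h * (w i)%:R < y 0 i - yc 0 i + h * N%:R <= h * (w i)%:R + h -> cell yc h w y.
  by move=> wz wi; apply/cellP => j; case: (eqVneq j i) => [->|ji] //; apply: other (wz _ ji).
have zz : forall j, j != i -> z j = z j by [].
have z'z : forall j, j != i -> z' j = z j by move=> j /zj.
have h'E : h * (z' i)%:R = h * (z i)%:R + h * e by rewrite zi mulrDr.
case: e1 => eE; rewrite eE ?mulr1 ?mulrN1 in yi h'E.
  have [b|b] := leP (r i + th) h; [left; apply: close zz _|right; apply: close z'z _];
    by rewrite yi ?h'E; apply/andP; split; lra.
have [b|b] := leP (r i - th) 0; [right; apply: close z'z _|left; apply: close zz _];
  by rewrite yi ?h'E; apply/andP; split; lra.
Qed.

(** Outside its parameter interval the path rests at its ends, so that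
  conditions on the path need to be checked on this interval only. *)
Lemma axis_path_clamp m (w : nat -> 'rV[R]_n) s :
  axis_path h m w s = axis_path h m w (clamp (m%:R * h) s).
Proof.
apply: eq_bigr => k _; congr (_ *: _).
have km : k.+1%:R * h <= m%:R * h by rewrite ler_pM2r // ler_nat ltn_ord.
have k0 : 0 <= k%:R * h by rewrite mulr_ge0 // ltW.
rewrite -natr1 mulrDl mul1r in km; move: (k%:R * h) (m%:R * h) k0 km => a b a0 ab.
have b0 : 0 <= b := le_trans (addr_ge0 a0 (ltW h0)) ab.
have hab : h <= b - a by rewrite lerBrDr addrC.
rewrite [clamp b s]clampE //; have [t0|t0] := leP s 0.
  rewrite [RHS]clamp0 ?(ltW h0) ?sub0r ?oppr_le0 // clamp0 ?(ltW h0) //.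
  by rewrite subr_le0 (le_trans t0).
have [//|/ltW tb] := leP s b.
rewrite [RHS]clamp_top ?(ltW h0) // clamp_top ?(ltW h0) //.
by apply: le_trans hab _; rewrite lerD2r.
Qed.

Lemma cell_volume z :
  @lebesgue_measureRn R n (cell yc h z) = (h ^+ n)%:E.
Proof.
rewrite [LHS]outer_box /=; congr EFin.
rewrite (eq_bigr (fun=> h)); first by rewrite prodr_const card_ord.
by move=> i _; rewrite !mxE addrAC subrr add0r max_r // ltW.
Qed.

End lattice_chain.

(** Admissibility for the axis-parallel polygonal paths that join [U1] to [U2]
  in the shell between the radii [s'] and [s]. *)
Definition crossing_admissible (R : realType) n (yc : 'rV[R]_n) (s' s : R)
    (U1 U2 : set 'rV[R]_n) (rho : 'rV[R]_n -> \bar R) :=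
  forall h m w x0, 0 < h -> (forall k, (k < m)%N -> axis_unit (w k.+1 - w k)) ->
    (forall t, s' <= `|x0 + axis_path h m w t - yc| <= s) ->
    U1 x0 -> U2 (x0 + axis_path h m w (m%:R * h)) ->
    (1 <= \int[@lebesgue_measure R]_(t in `[0%R, (m%:R * h)%R])
       rho (x0 + axis_path h m w t)%R)%E.

Definition ring_cst (R : realType) d : R := (2 * level_cst R d)^-1.

Lemma ring_cst_gt0 (R : realType) d : 0 < ring_cst R d.
Proof. by rewrite invr_gt0 mulr_gt0 // level_cst_gt0. Qed.

(** The choice [T / h] in Young's inequality over a cell of side [h] makes both
  terms scale in the same way. *)
Lemma young_rescale (R : realFieldType) d (T h E : R) : 0 < T -> 0 < h ->
  T / h * h ^+ d.+1 + (T / h) ^- d * E = (T + T ^- d * E) * h ^+ d.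
Proof.
move=> T0 h0; rewrite exprS expr_div_n invf_div.
have := exprn_gt0 d T0; have := exprn_gt0 d h0.
move: (T ^+ d) (h ^+ d) => t' h' h'0 t'0.
by field; rewrite !gt_eqF.
Qed.

Section lower_bound.
Context {R : realType} {d : nat}.
Local Notation n := d.+1.
Local Notation mu := (@lebesgue_measureRn R n).
Hypothesis d0 : (0 < d)%N.

(** The mesh [h] is so small that a point of the level [h * (k - 1 / 2)] can be
  chosen in [U1], and another one in [U2], together with their cells
  ([uniform_level]). Cells inside [U1] are black and cells inside [U2] are
  white; [u], the cost of a cell, vanishes on black cells, and it is 1 on white
  ones because a chain that ends at a white cell has weight at least 1, by
  [chain_inequality] applied to the polygonal paths along the chain. So
  [level_estimate] applies on every layer, and [sum_levels] adds up the
  energies. *)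
Lemma ring_lower_bound (yc : 'rV[R]_n) (s' : R) (p : nat) (U1 U2 : set 'rV[R]_n)
    (rho : 'rV[R]_n -> \bar R) :
  0 < s' -> open U1 -> open U2 -> U1 `&` U2 = set0 ->
  (forall t, s' <= t <= s' * 2 ^+ p -> exists2 a, U1 a & `|a - yc| = t) ->
  (forall t, s' <= t <= s' * 2 ^+ p -> exists2 a, U2 a & `|a - yc| = t) ->
  borel_fun rho -> (forall x, (0 <= rho x)%E) ->
  crossing_admissible yc s' (s' * 2 ^+ p) U1 U2 rho ->
  ((p%:R * ring_cst R d)%:E <= \int[mu]_x (rho x ^+ n))%E.
Proof.
move=> s0 oU1 oU2 U12 lev1 lev2 mrho rho0 adm.
have mrn : measurable_fun [set: lebesgueRn R n] (fun x => rho x ^+ n)%E.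
  by apply: measurable_expe; exact: borel_fun_lebesgue.
have rn0 x : (0 <= rho x ^+ n)%E by apply: expe_ge0.
have In0 : (0 <= \int[mu]_x (rho x ^+ n))%E by apply: integral_ge0.
have [->|Ifin] := eqVneq (\int[mu]_x (rho x ^+ n))%E +oo%E; first by rewrite leey.
have [e1 e10 H1] := uniform_level s0 oU1 lev1.
have [e2 e20 H2] := uniform_level s0 oU2 lev2.
(* The inner radius [s'] is [m0] times the mesh, and the outer one [N = m0 * 2 ^ p] times. *)
pose m0 := (Num.truncn (s' / Num.min e1 e2)).+1.
pose h := s' / m0%:R.
have m00 : 0 < m0%:R :> R by [].
have h0 : 0 < h by rewrite divr_gt0.
have e0 : 0 < Num.min e1 e2 by rewrite lt_min e10.
have he : h < Num.min e1 e2.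
  by rewrite /h ltr_pdivrMr // mulrC -ltr_pdivrMr // truncnS_gt.
have [he1 he2] : h <= e1 /\ h <= e2 by move: he; rewrite lt_min => /andP[/ltW ? /ltW ?].
pose N := (m0 * 2 ^ p)%N.
have s'E : h * m0%:R = s' by rewrite /h divfK // gt_eqF.
have sE : h * N%:R = s' * 2 ^+ p by rewrite natrM natrX mulrA s'E.
pose cl := @cell R n yc h N.
pose Er z := (\int[mu]_(x in cl z) (rho x ^+ n))%E.
have mcl z : measurable (cl z : set (lebesgueRn R n)) by exact: measurable_box.
have Er0 z : (0 <= Er z)%E by apply: integral_ge0.
have ErI z : (Er z <= \int[mu]_x (rho x ^+ n))%E.
  by apply: ge0_subset_integral => //; exact: measurable_funTS.
have ErE z : Er z = (fine (Er z))%:E.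
  rewrite fineK // ge0_fin_numE //; apply: le_lt_trans (ErI z) _.
  by rewrite ltey.
pose Ir z := (\int[mu]_(x in cl z) rho x)%E.
have Ir0 z : (0 <= Ir z)%E by apply: integral_ge0.
have Iry z T : 0 < T -> (Ir z <= (T * h ^+ n + T ^- d * fine (Er z))%:E)%E.
  move=> T0; apply: le_trans (integral_young d mrho rho0 (mcl z) T0) _.
  by rewrite (cell_volume _ h0) EFinD !EFinM -ErE.
have IrE z : Ir z = (fine (Ir z))%:E.
  rewrite fineK // ge0_fin_numE //; apply: le_lt_trans (Iry z 1 ltr01) _.
  exact: ltry.
pose E z := fine (Er z).
pose F z := fine (Ir z) / h ^+ d.
have E0 z : 0 <= E z by apply: fine_ge0.
have hd0 : 0 < h ^+ d by rewrite exprn_gt0.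
have F0 z : 0 <= F z by rewrite divr_ge0 ?fine_ge0 // ltW.
have FE z T : 0 < T -> F z <= T + T ^- d * E z.
  move=> T0; have := Iry z (T / h) (divr_gt0 T0 h0).
  rewrite IrE lee_fin /F ler_pdivrMr // => /le_trans; apply.
  rewrite le_eqVlt; apply/orP; left; apply/eqP.
  exact: young_rescale.
pose region (z : {ffun 'I_n -> 'I_(N + N)}) : Prop := z \notin cubek n N m0.
pose black (z : {ffun 'I_n -> 'I_(N + N)}) : Prop := cl z `<=` U1.
pose white (z : {ffun 'I_n -> 'I_(N + N)}) : Prop := cl z `<=` U2.
pose u := cost F region black (@lattice_step n (N + N)).
have m0N : (m0 <= N)%N by rewrite leq_pmulr // expn_gt0.
have nonempty z : cl z !=set0.
  exists (\row_i (yc 0 i + h * ((z i)%:R - N%:R) + h)) => i.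
  by rewrite !mxE lexx andbT ltrDl.
have chain1 z : white z -> forall r, chain_cost F region black (@lattice_step n (N + N)) z r -> 1 <= r.
  move=> wz r [m [v [bv vm rv sv ->]]].
  have m1 : (0 < m)%N.
    (* A chain without steps would lie in a cell that is black and white. *)
    rewrite lt0n; apply/eqP => m1; have [x xz] := nonempty z.
    have : (U1 `&` U2) x by split; [apply: bv; rewrite -m1 vm|exact: wz].
    by rewrite U12.
  pose w k : 'rV[R]_n := corner (v k).
  have w1 k : (k < m)%N -> axis_unit (w k.+1 - w k).
    by move=> km; apply: lattice_step_axis; exact: sv.
  have cover k s x : (k < m)%N -> k%:R * h <= s <= k.+1%:R * h -> cl (v 0%N) x ->
      cl (v k) (x + axis_path h m w s) \/ cl (v k.+1) (x + axis_path h m w s).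
    move=> km ks x0; rewrite (axis_pathE w h0 km ks).
    apply: lattice_step_cover => //; first exact: sv.
    by move: ks => /andP[k1 k2]; rewrite subr_ge0 k1 lerBlDr -[X in X + _]mul1r -mulrDl addrC natr1.
  have inreg z' y : region z' -> cl z' y -> s' <= `|y - yc| <= s' * 2 ^+ p.
    by move=> rz zy; rewrite -{1}s'E -sE (cell_in_big h0 zy) andbT; apply: (cell_out h0 m0N zy rz).
  have := @chain_inequality R n rho (cl (v 0%N)) (axis_path h m w) m h (fun k => cl (v k))
    mrho rho0.
  have bcl z' : measurable (cl z' : set (g_sigma_algebraType (@open 'rV[R]_n))).
    exact: borel_box.
  move=> /(_ (bcl _) (fun k => bcl _)).
  have mp i : measurable_fun [set: R] (fun s => axis_path h m w s 0 i).
    apply: continuous_measurable_fun => s.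
    apply: (@continuous_comp _ _ _ (axis_path h m w) (fun x : 'rV[R]_n => x 0 i)); last exact: coord_continuous.
    exact: (axis_path_continuous h0 w1).
  move=> /(_ mp h0 m1 cover).
  rewrite (cell_volume _ h0) => /(_ _)/wrap[].
    move=> x x0; apply: adm => //.
    - move=> t; rewrite (axis_path_clamp h0); set t' := clamp _ _.
      have [t'0 t'm] : 0 <= t' /\ t' <= m%:R * h.
        have mh0 : 0 <= m%:R * h by rewrite mulr_ge0 ?(ltW h0).
        rewrite /t' (clampE _ mh0).
        have [t0|/ltW t0] := leP t 0; first by split; rewrite ?lexx.
        by have [tm|_] := leP t (m%:R * h); split.
      have [k km kt] : exists2 k, (k < m)%N & k%:R * h <= t' <= k.+1%:R * h.
        have : exists k, t' <= k.+1%:R * h by exists m.-1; rewrite (prednK m1).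
        move=> /ex_minnP[k tk kmin]; exists k.
          by rewrite -(prednK m1) ltnS; apply: kmin; rewrite (prednK m1).
        rewrite tk andbT; case: k tk kmin => [|k] tk kmin; first by rewrite mul0r.
        by rewrite leNgt; apply/negP => /ltW /kmin; rewrite ltnn.
      have [H|H] := cover k t' x km kt x0.
        exact: (inreg _ _ (rv _ (ltnW km)) H).
      exact: (inreg _ _ (rv _ km) H).
    - exact: bv.
    - rewrite (axis_path_end m w h0); apply: wz; rewrite -vm; apply/cellP => i.
      have := (cellP yc h (v 0%N) x).1 x0 i; rewrite !mxE => /andP[? ?].
      by apply/andP; split; lra.
  move=> H'; have {H'}H : h ^+ n <= (\sum_(k < m) (fine (Ir (v k)) + fine (Ir (v k.+1)))) * h.
    rewrite -lee_fin; apply: le_trans H' _.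
    rewrite mulr_suml -sumEFin; apply: lee_sum => k _.
    by rewrite [leRHS](EFinM _ h) EFinD -!IrE.
  have -> : \sum_(k < m) (F (v k) + F (v k.+1)) =
      (\sum_(k < m) (fine (Ir (v k)) + fine (Ir (v k.+1)))) / h ^+ d.
    by rewrite mulr_suml; apply: eq_bigr => k _; rewrite mulrDl.
  rewrite ler_pdivlMr // mul1r -(ler_pM2r h0).
  by rewrite -exprSr.
have lev k : (m0 < k <= N)%N ->
    (level_cst R d * k%:R)^-1 <= \sum_(x in shellk n N k) E x.
  move=> /andP[mk kN].
  have k0 : (0 < k <= N)%N by rewrite kN (leq_ltn_trans _ mk).
  have shell_region z : z \in shellk n N k -> region z.
    rewrite -[_ \in _]/((_ \in cubek n N k) && (_ \notin cubek n N k.-1)).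
    move=> /andP[_]; apply: contra => /cubekP zm; apply/cubekP => i.
    by move: (zm i) mk kN; clear; lia.
  have tI : s' <= h * (k%:R - 1 / 2) <= s' * 2 ^+ p.
    rewrite -sE -{1}s'E !ler_pM2l //; apply/andP; split.
      have : m0.+1%:R <= k%:R :> R by rewrite ler_nat.
      by rewrite -natr1; lra.
    have : k%:R <= N%:R :> R by rewrite ler_nat.
    by lra.
  have [a ak aU] := H1 _ tI; have [b bk bU] := H2 _ tI.
  have [z za zS] := cell_of_level h0 k0 ak.
  have [z' zb zS'] := cell_of_level h0 k0 bk.
  apply: (level_estimate (u := u) d0 F0 E0 FE k0 _ zS zS').
  - move=> x y xS yS xy; apply: cost_lip => //; first exact: lattice_step_sym.
    + exact: shell_region.
    + exact: shell_region.
    + by left.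
  - apply: cost_black => //; last exact: shell_region.
    by move=> y zy; apply: aU; apply: le_trans he1; exact: (cell_dist h0 zy za).
  - apply: cost_eq1 => //; apply: chain1.
    by move=> y zy; apply: bU; apply: le_trans he2; exact: (cell_dist h0 zy zb).
have := sum_levels E0 (level_cst_gt0 R d) (erefl N) isT lev.
rewrite -lee_fin => /le_trans; apply.
rewrite -sumEFin (eq_bigr Er); last by move=> z _; rewrite -ErE.
have uT : uniq (index_enum {ffun 'I_n -> 'I_(N + N)}) by exact: index_enum_uniq.
have tcl : trivIset [set` index_enum {ffun 'I_n -> 'I_(N + N)}] cl.
  by move=> z z' _ _ [x [zx zx']]; exact: (cell_inj h0 zx zx').
have mU : measurable_fun (\big[setU/set0]_(z <- index_enum {ffun 'I_n -> 'I_(N + N)}) cl z :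
    set (lebesgueRn R n)) (fun x => rho x ^+ n)%E by exact: measurable_funTS.
have := @ge0_integral_bigsetU _ (lebesgueRn R n) R mu _ cl (fun x => rho x ^+ n)%E _
  mcl uT tcl mU (fun x _ => rn0 x).
move=> <-; apply: ge0_subset_integral => //.
exact: bigsetU_measurable.
Qed.

End lower_bound.

(** * Connectedness of balls and their exteriors *)

Section segments.
Context {R : realType} {n : nat}.
Local Notation V := ('rV[R]_n).

Definition seg (p q : V) : set V := (fun t : R => p + t *: (q - p)) @` `[0, 1].

Lemma seg_connected p q : connected (seg p q).
Proof.
apply: connected_continuous_connected; first exact: segment_connected.
apply: continuous_subspaceT => t; apply: (@cvgD _ V); first exact: cvg_cst.
by apply: (@cvgZr_tmp _ V); exact: cvg_id.
Qed.

Lemma seg_l p q : seg p q p.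
Proof. by exists 0; rewrite /= ?in_itv /= ?lexx ?ler01 // scale0r addr0. Qed.

Lemma seg_r p q : seg p q q.
Proof. by exists 1; rewrite /= ?in_itv /= ?lexx ?ler01 // scale1r addrCA subrr addr0. Qed.

End segments.

Section connectedness.
Context {R : realType} {n : nat}.
Hypothesis hn : (2 <= n)%N.
Local Notation V := ('rV[R]_n).

(** Every point is joined to a basis vector [b] by a segment, except for the
  points on the ray opposite to [b]; these are reached through a second basis
  vector. *)
Lemma connected_punctured : connected [set x : V | x != 0].
Proof.
pose i0 : 'I_n := Ordinal (ltnW hn); pose i1 : 'I_n := Ordinal hn.
have i01 : i1 != i0 by [].
pose b : V := delta_mx 0 i0; pose q : V := delta_mx 0 i1.
have b0 : b 0 i0 = 1 by rewrite mxE !eqxx.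
have b1 : b 0 i1 = 0 by rewrite mxE.
have q0 : q 0 i0 = 0 by rewrite mxE.
have q1 : q 0 i1 = 1 by rewrite mxE !eqxx.
pose S p : set V := if pselect (seg b p (0 : V)) then seg b q `|` seg q p else seg b p.
rewrite (_ : [set x : V | x != 0] = \bigcup_(p in [set x : V | x != 0]) S p).
  apply: bigcup_connected.
    exists b => p _; rewrite /S; case: pselect => /= _; last exact: seg_l.
    by left; exact: seg_l.
  move=> p _; rewrite /S; case: pselect => /= _; last exact: seg_connected.
  apply: connectedU; [|exact: seg_connected..].
  by exists q; split; [exact: seg_r|exact: seg_l].
apply/seteqP; split=> [p p0|x [p /= p0]].
  exists p => //; rewrite /S; case: pselect => /= _; last exact: seg_r.
  by right; exact: seg_r.
rewrite /S; case: pselect => /= [[t /= tI t0]|bp]; last first.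
  by move=> bx; apply/eqP => x0; apply: bp; rewrite -x0.
have p_coord j : (1 - t) * b 0 j + t * p 0 j = 0.
  have := congr1 (fun v : V => v 0 j) t0; rewrite !mxE => <-; ring.
have t1 : t != 0.
  apply/eqP => tz; have := p_coord i0; rewrite tz b0 subr0 mul1r mul0r addr0 => /eqP.
  by rewrite oner_eq0.
have pj j : j != i0 -> p 0 j = 0.
  move=> ji; have := p_coord j; rewrite [b 0 j]mxE eqxx (negbTE ji) mulr0 add0r.
  by move=> /eqP; rewrite mulf_eq0 (negbTE t1) => /eqP.
have pi0 : p 0 i0 != 0.
  apply: contraNneq p0 => pz; apply/eqP/rowP => j; rewrite mxE.
  by have [->|/pj] := eqVneq j i0.
case=> -[s /= sI <-]; apply/eqP => /(congr1 (fun v : V => (v 0 i0, v 0 i1))) [].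
  rewrite !mxE eqxx /= => e0 e1.
  have : s = 1 by lra.
  by move: e1; lra.
move: (pj _ i01) pi0; move: (q0) (q1).
move=> q0' q1' p1' pi0; rewrite !mxE in q0' q1' *.
rewrite q0' q1' p1' => e0 e1.
have s1 : s = 1 by lra.
by move/eqP: pi0; apply; rewrite s1 in e0; lra.
Qed.

End connectedness.

Section exteriors.
Context {R : realType} {n : nat}.
Hypothesis hn : (2 <= n)%N.
Local Notation V := ('rV[R]_n).
Variable nu : V -> R.
Hypothesis nu_cont : continuous nu.
Hypothesis nuZ : forall a x, nu (a *: x) = `|a| * nu x.
Hypothesis nu_gt0 : forall x, x != 0 -> 0 < nu x.

Let nu0 : nu 0 = 0.
Proof. by have := nuZ 0 0; rewrite scale0r normr0 mul0r. Qed.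

(** Images of the punctured space under radial maps. *)
Let radial_connected (c : V) (phi : R -> R) (A : set V) :
  (forall x, x != 0 -> {for nu x, continuous phi}) ->
  A = (fun x => c + phi (nu x) *: x) @` [set x : V | x != 0] -> connected A.
Proof.
move=> cphi ->; apply: connected_continuous_connected; first exact: connected_punctured.
rewrite continuous_subspace_in => x; rewrite inE /= => x0.
have C : {for x, continuous (fun x => c + phi (nu x) *: x)}.
  have H : phi (nu y) @[y --> x] --> phi (nu x).
    by apply: (@continuous_comp _ _ _ nu phi); [exact: nu_cont|exact: cphi].
  exact: (cvgD (cvg_cst c) (cvgZ H cvg_id)).
exact: (@continuous_subspaceT_for _ _ [set x : V | x != 0] _ x x0 C).
Qed.

Lemma connected_exterior (c : V) (r : R) : 0 <= r ->
  connected [set x : V | r < nu (x - c)].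
Proof.
move=> r0; apply: (@radial_connected c (fun t => 1 + r / t)).
  move=> x /nu_gt0 x0; apply: cvgD; first exact: cvg_cst.
  apply: cvgM; first exact: cvg_cst.
  by apply: cvgV; [rewrite gt_eqF|exact: cvg_id].
apply/seteqP; split=> [z /= rz|_ [x /= x0 <-]]; last first.
  have nx := nu_gt0 x0.
  rewrite addrC addKr nuZ ger0_norm ?addr_ge0 ?divr_ge0 ?(ltW nx) //.
  by rewrite mulrDl mul1r divfK ?gt_eqF // ltrDr.
have nz : 0 < nu (z - c) by exact: le_lt_trans rz.
have a0 : 0 < 1 - r / nu (z - c) by rewrite subr_gt0 ltr_pdivrMr // mul1r.
exists ((1 - r / nu (z - c)) *: (z - c)).
  rewrite /= scaler_eq0 negb_or gt_eqF //=; apply: contraTneq nz => ->.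
  by rewrite nu0 ltxx.
rewrite nuZ gtr0_norm // scalerA (_ : _ * _ = 1); first by rewrite scale1r addrC subrK.
move: a0 nz; move: (nu (z - c)) => t a0 t0.
rewrite mulrDl mul1r [X in _ + X](_ : _ = r / t).
  by rewrite subrK.
have a1 : t - r != 0.
  by rewrite gt_eqF // subr_gt0; move: a0; rewrite subr_gt0 ltr_pdivrMr // mul1r.
have a2 : (1 - r / t) * t = t - r by rewrite mulrBl mul1r divfK // gt_eqF.
rewrite a2; field; rewrite gt_eqF //=.
Qed.

Lemma connected_punctured_ball (c : V) (r : R) : 0 < r ->
  connected [set x : V | 0 < nu (x - c) < r].
Proof.
move=> r0; apply: (@radial_connected c (fun t => r / (1 + t))).
  move=> x /nu_gt0 x0; apply: cvgM; first exact: cvg_cst.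
  apply: cvgV; first by rewrite gt_eqF // addr_gt0.
  by apply: cvgD; [exact: cvg_cst|exact: cvg_id].
apply/seteqP; split=> [z /= /andP[z0 zr]|_ [x /= x0 <-]]; last first.
  have nx := nu_gt0 x0; have nx1 : 0 < 1 + nu x by rewrite addr_gt0.
  rewrite addrC addKr nuZ ger0_norm ?divr_ge0 ?(ltW nx1) ?(ltW r0) //.
  rewrite mulr_gt0 ?divr_gt0 //= mulrAC ltr_pdivrMr // mulrDr mulr1.
  by rewrite ltrDr.
exists ((r - nu (z - c))^-1 *: (z - c)).
  rewrite /= scaler_eq0 negb_or invr_eq0 gt_eqF ?subr_gt0 //=; apply: contraTneq z0 => ->.
  by rewrite nu0 ltxx.
have rz : 0 < r - nu (z - c) by rewrite subr_gt0.
rewrite nuZ gtr0_norm ?invr_gt0 // scalerA (_ : _ * _ = 1); first by rewrite scale1r addrC subrK.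
move: rz z0 zr; move: (nu (z - c)) => t a0 t0 tr.
field; rewrite !gt_eqF //=; lra.
Qed.

Lemma connected_ball (c : V) (r : R) : 0 < r -> connected [set x : V | nu (x - c) < r].
Proof.
move=> r0; rewrite (_ : [set _ | _] = \bigcup_(p in [set x | nu (x - c) < r]) seg c p).
  apply: bigcup_connected => [|p _]; last exact: seg_connected.
  by exists c => p _; exact: seg_l.
apply/seteqP; split=> [p pr|x [p /= pr [t tI <-]]]; first by exists p => //; exact: seg_r.
move: tI; rewrite /= in_itv /= => /andP[t0 t1]; rewrite addrC addKr nuZ ger0_norm //.
have nu_ge0 : 0 <= nu (p - c).
  by have [->|/nu_gt0 /ltW //] := eqVneq (p - c) 0; rewrite nu0.
by apply: le_lt_trans pr; rewrite ler_piMl.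
Qed.

End exteriors.

(** * The one-point compactification and trapping in a shell *)

Section Rbar.
Context {R : realType} {n : nat}.
Local Notation V := ('rV[R]_n).
Local Notation Rb := (Rbar R n).

Lemma bounded_ball_compact (c : V) (r : R) : compact [set x : V | `|x - c| <= r].
Proof.
apply: bounded_closed_compact.
  exists (r + `|c|); split; first exact: num_real.
  move=> M rM x /= xr; apply: le_trans (ltW rM).
  by rewrite -[x](subrK c); apply: le_trans (ler_normD _ _) _; rewrite lerD2r.
apply: (@closed_comp _ _ (fun x : V => `|x - c|) [set t : R | t <= r]); last exact: closed_le.
move=> x _; apply: (@continuous_comp _ _ _ (fun x : V => x - c) (fun y : V => `|y|)).
  exact: (cvgB cvg_id (cvg_cst c)).
exact: norm_continuous.
Qed.

Lemma Rbar_hausdorff : hausdorff_space Rb.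
Proof.
apply: one_point_compactification_hausdorff; last exact: norm_hausdorff.
move=> x _; rewrite withinET; exists [set y : V | `|y - x| <= 1].
  apply/nbhs_ballP; exists 1 => //= y; rewrite -ball_normE /= distrC; exact: ltW.
have c := @bounded_ball_compact x 1.
by split=> //; apply: compact_closed c; exact: norm_hausdorff.
Qed.

Lemma fin_continuous : continuous (@fin_pt R n).
Proof. exact: one_point_compactification_some_continuous. Qed.

Lemma open_fin (U : set V) : open U -> open (@fin_pt R n @` U).
Proof. exact: one_point_compactification_open_some. Qed.

Lemma open_fin_preimage (O : set Rb) : open O -> open (@fin_pt R n @^-1` O).
Proof. by move=> oO; apply: open_comp => // x _; exact: fin_continuous. Qed.

Lemma nbhs_fin (y : V) (U : set Rb) : nbhs (fin_pt y) U ->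
  exists2 e : R, 0 < e & forall z, `|z - y| < e -> U (fin_pt z).
Proof.
move=> yU; have : nbhs y (@fin_pt R n @^-1` U) by exact: yU.
move=> /nbhs_ballP[e /= e0 eU]; exists e => // z zy; apply: eU.
by rewrite -ball_normE /= distrC.
Qed.

Lemma fin_nbhs (y : V) (e : R) : 0 < e -> nbhs (fin_pt y) (@fin_pt R n @` [set z | `|z - y| < e]).
Proof.
move=> e0; apply: one_point_compactification_some_nbhs.
by apply/nbhs_ballP; exists e => //= z; rewrite -ball_normE /= distrC.
Qed.

Lemma nbhs_infty (U : set Rb) : nbhs (infty_pt R n) U ->
  exists2 e : R, 0 < e & forall z, e < `|z| -> U (fin_pt z).
Proof.
move=> [K [cK _] KU].
have [M [_ HM]] := compact_bounded cK.
exists (Num.max 1 (M + 1)); first by rewrite lt_max ltr01.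
move=> z; rewrite gt_max => /andP[z1 zM]; apply: KU; left; exists z => // Kz.
have MM : M < M + 1 by rewrite ltrDl.
have zb : `|z| <= M + 1 := HM _ MM z Kz.
by rewrite leNgt zM in zb.
Qed.

Lemma infty_nbhs (r : R) :
  nbhs (infty_pt R n) ((@fin_pt R n @` [set z | r < `|z|]) `|` [set infty_pt R n]).
Proof.
have c := @bounded_ball_compact 0 r.
exists [set x : V | `|x - 0| <= r].
  by split=> //; apply: compact_closed c; exact: norm_hausdorff.
move=> _ [[z /= /negP zr <-]|->]; last by right.
by left; exists z => //=; rewrite ltNge; move: zr; rewrite subr0.
Qed.

(** The Euclidean distance to [c], truncated at [M] in order to extend
  continuously to infinity. *)
Definition tdist (c : V) (M : R) (x : Rb) : R :=
  if x is Some y then Num.min (enorm (y - c)) M else M.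

Lemma tdist_continuous c M : continuous (tdist c M).
Proof.
have cf : continuous (fun y : V => Num.min (enorm (y - c)) M).
  move=> y; apply: (@continuous_min _ _ (fun y : V => enorm (y - c) : R^o) (fun=> M)); last exact: cst_continuous.
  apply: (@continuous_comp _ _ _ (fun x : V => x - c) (@enorm R n)).
    exact: (cvgB cvg_id (cvg_cst c)).
  exact: continuous_enorm.
move=> [y|] U /= yU; first exact: cf yU.
have := infty_nbhs (M + `|c|); apply: filterS => x [[z /= zM <-]|->].
  rewrite /= min_r; first exact: nbhs_singleton yU.
  apply: le_trans (norm_le_enorm _).
  by apply: le_trans (lerB_dist _ _); rewrite lerBrDr ltW.
exact: nbhs_singleton yU.
Qed.

End Rbar.

Section boundary.
Context {R : realType} {n : nat}.
Hypothesis hn : (2 <= n)%N.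
Local Notation V := ('rV[R]_n).
Local Notation Rb := (Rbar R n).

(** Away from the boundary of [D], the trace of [D] on [A] is both open and
  closed. *)
Lemma connected_sub_domain (D : set Rb) (A : set V) : open D -> connected A ->
  (forall x, A x -> ~ boundary D (fin_pt x)) ->
  (exists2 x, A x & D (fin_pt x)) -> forall x, A x -> D (fin_pt x).
Proof.
move=> oD cA AD [a Aa Da].
have E : A `&` (@fin_pt R n @^-1` D) = A `&` (@fin_pt R n @^-1` closure D).
  apply/seteqP; split=> x [Ax Dx]; split => //; first exact: subset_closure.
  apply: contrapT => nDx; apply: (AD x Ax); split => //.
  by rewrite ((interior_id D).1 oD).
have : A `&` (@fin_pt R n @^-1` D) = A.
  apply: cA; first by exists a.
    by exists (@fin_pt R n @^-1` D) => //; exact: open_fin_preimage.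
  exists (@fin_pt R n @^-1` closure D) => //.
  by apply: closed_comp; [move=> x _; exact: fin_continuous|exact: closed_closure].
by move=> AE x; rewrite -{1}AE => -[].
Qed.

Lemma norm_gt0_rV (x : V) : x != 0 -> 0 < `|x|.
Proof. by rewrite normr_gt0. Qed.

(** A punctured ball about [y] that contains no boundary point of [D] is
  connected and meets [D]. *)
Lemma isolated_boundary_finite (D : set Rb) (y : V) : open D ->
  isolated (boundary D) (fin_pt y) ->
  exists2 e : R, 0 < e & forall z, 0 < `|z - y| < e -> D (fin_pt z).
Proof.
move=> oD [/set_mem [yD nyD] [W yW WD]].
have nDy : ~ D (fin_pt y) by rewrite ((interior_id D).1 oD) in nyD.
have [e e0 eW] := nbhs_fin yW.
exists e => // ; apply: connected_sub_domain => //.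
- exact: (connected_punctured_ball hn (@norm_continuous _ V) (@normrZ _ V) norm_gt0_rV).
- move=> x /= /andP[x0 xe] xD.
  have : (W `&` boundary D) (fin_pt x) by split => //; exact: eW.
  rewrite WD /= => -[xy]; move: x0; rewrite xy subrr normr0 ltxx //.
have [x [Dx [z /= zy zx]]] := yD _ (fin_nbhs y e0).
exists z; last by rewrite zx.
rewrite /= zy andbT normr_gt0 subr_eq0; apply/eqP => zE.
by apply: nDy; rewrite -zE zx.
Qed.

Lemma isolated_boundary_infty (D : set Rb) : open D ->
  isolated (boundary D) (infty_pt R n) ->
  exists2 e : R, 0 < e & forall z, e < `|z| -> D (fin_pt z).
Proof.
move=> oD [/set_mem [yD nyD] [W yW WD]].
have nDy : ~ D (infty_pt R n) by rewrite ((interior_id D).1 oD) in nyD.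
have [e e0 eW] := nbhs_infty yW.
exists e => // ; apply: connected_sub_domain => //.
- have C := @connected_exterior R n hn _ (@norm_continuous _ V) (@normrZ _ V) norm_gt0_rV 0 e (ltW e0).
  have E : [set x : V | e < `|x - 0|] = [set x : V | e < `|x|].
    by apply/seteqP; split => z /=; rewrite subr0.
  by rewrite E in C.
- move=> x /= xe xD.
  have : (W `&` boundary D) (fin_pt x) by split => //; exact: eW.
  by rewrite WD.
have [x [Dx []]] := yD _ (infty_nbhs e).
  by move=> [z /= ze zx]; exists z => //; rewrite zx.
by move=> xE; rewrite xE in Dx.
Qed.

End boundary.

Section trap.
Context {R : realType} {n : nat}.
Local Notation V := ('rV[R]_n).
Local Notation Rb := (Rbar R n).
Variables (D D' : set Rb) (g f : Rb -> Rb).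
Hypothesis oD : open D.
Hypothesis hgf : homeomorphism D' D g f.

Lemma homeomorphism_fg z : D z -> D' (f z) /\ g (f z) = z.
Proof.
have [gD gK _ _] := hgf; rewrite -gD => -[w Dw <-].
by rewrite gK ?inE.
Qed.

Lemma homeomorphism_gf w : D' w -> D (g w) /\ f (g w) = w.
Proof.
have [gD gK _ _] := hgf; move=> Dw; split; last by rewrite gK ?inE.
by rewrite -gD; exists w.
Qed.

Lemma homeomorphism_open_image (U : set Rb) : open U -> open (D `&` f @^-1` U).
Proof.
have [_ _ _ cf] := hgf; move=> oU.
rewrite (continuous_open_subspace _ oD) in cf.
rewrite openE => z [Dz Uz]; apply: filterI; first exact: open_nbhs_nbhs.
by apply: cf; [rewrite inE|exact: open_nbhs_nbhs].
Qed.

(** The image of the shell is compact, so its trace on [O] is closed in [O]; it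
  is also open in [O], since it coincides with the image of the open shell as
  long as the image of the two bounding spheres avoids [O]. By connectedness [O]
  would lie in the image of the shell, hence in [D], if it met it. *)
Lemma shell_trap (O : set Rb) (p : Rb) (c : V) (t t' : R) :
  open O -> connected O -> O p -> ~ D p ->
  (forall y, t <= `|y - c| <= t' -> D' (fin_pt y)) ->
  (forall y, `|y - c| = t -> ~ O (g (fin_pt y))) ->
  (forall y, `|y - c| = t' -> ~ O (g (fin_pt y))) ->
  forall y, t <= `|y - c| <= t' -> ~ O (g (fin_pt y)).
Proof.
move=> oO cO Op nDp KD tO t'O y yK Oy.
pose K := [set y : V | t <= `|y - c| <= t'].
pose GK := g @` (@fin_pt R n @` K).
have [_ _ cg _] := hgf.
have dist_cont : continuous (fun x : V => `|x - c|).
  move=> x; apply: (@continuous_comp _ _ _ (fun x : V => x - c) (fun y : V => `|y|)).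
    exact: (cvgB cvg_id (cvg_cst c)).
  exact: norm_continuous.
have cK : compact K.
  rewrite (_ : K = [set x : V | `|x - c| <= t'] `&` [set x : V | t <= `|x - c|]).
    apply: compact_closedI; first exact: bounded_ball_compact.
    apply: (@closed_comp _ _ (fun x : V => `|x - c|) [set s : R | t <= s]); last exact: closed_ge.
    by move=> x _; exact: dist_cont.
  by apply/seteqP; split => x /=; [move=> /andP[? ?]; split|move=> [? ?]; apply/andP; split].
have clGK : closed GK.
  apply: compact_closed; first exact: Rbar_hausdorff.
  apply: continuous_compact.
    by apply: continuous_subspaceW cg => _ [x /= xK <-]; exact: KD.
  apply: continuous_compact => //; apply: continuous_subspaceT; exact: fin_continuous.
have GKD : GK `<=` D by move=> _ [_ [x xK <-] <-]; have [] := homeomorphism_gf (KD x xK).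
have : O `&` GK = O.
  apply: cO.
  - by exists (g (fin_pt y)); split => //; exists (fin_pt y) => //; exists y.
  - exists (D `&` f @^-1` (@fin_pt R n @` [set x : V | t < `|x - c| < t'])).
      apply: homeomorphism_open_image; apply: open_fin.
      rewrite (_ : [set _ | _] = [set x : V | t < `|x - c|] `&` [set x : V | `|x - c| < t']).
        apply: openI.
          apply: (@open_comp _ _ (fun x : V => `|x - c|) [set s : R | t < s]); last exact: open_gt.
          by move=> x _; exact: dist_cont.
        apply: (@open_comp _ _ (fun x : V => `|x - c|) [set s : R | s < t']); last exact: open_lt.
        by move=> x _; exact: dist_cont.
      by apply/seteqP; split => x /=; [move=> /andP[? ?]; split|move=> [? ?]; apply/andP; split].
    apply/seteqP; split => z.
      move=> [Oz GKz]; split => //; split; first exact: GKD.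
      move: GKz => [w [x /andP[tx xt'] xE] zE]; rewrite -xE in zE.
      have [_ fg] := homeomorphism_gf (KD x (introT andP (conj tx xt'))).
      rewrite /preimage /= -zE fg; exists x => //=.
      rewrite !lt_neqAle tx xt' !andbT; apply/andP; split; apply/eqP.
        by move=> tE; apply: (tO x) => //; rewrite zE.
      by move=> tE; apply: (t'O x) => //; rewrite zE.
    move=> [Oz [Dz [x /andP[/ltW tx /ltW xt'] xE]]]; split => //.
    have [_ gf] := homeomorphism_fg Dz; exists (f z) => //.
    by exists x => //; rewrite /K /= tx.
  - by exists GK.
by move=> E; apply: nDp; apply: GKD; have : O p by []; rewrite -{1}E => -[].
Qed.

Let hits (O : set Rb) (c : V) (t : R) := exists2 y, `|y - c| = t & O (g (fin_pt y)).

(** If [O] is avoided on a level [t], take [y] below this level with [g y] in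
  [O]. A further avoided level below [y] would trap [O] in the shell between the
  two levels. *)
Lemma small_levels_hit (O : set Rb) (p : Rb) (c : V) (r : R) :
  open O -> connected O -> O p -> ~ D p -> 0 < r ->
  (forall y, 0 < `|y - c| < r -> D' (fin_pt y)) ->
  (forall e, 0 < e -> exists2 y, 0 < `|y - c| < e & O (g (fin_pt y))) ->
  exists2 r', 0 < r' & forall t, 0 < t < r' -> hits O c t.
Proof.
move=> oO cO Op nDp r0 rD acc.
have [H|] := pselect (forall t, 0 < t < r -> hits O c t); first by exists r.
move=> /existsNP[t /not_implyP[/andP[t0 tr] nt]].
have [y /andP[y0 yt] Oy] := acc t t0.
exists `|y - c| => // t' /andP[t'0 t'y]; apply: contrapT => nt'.
apply: (@shell_trap O p c t' t) Oy => //.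
- move=> z /andP[z0 zt]; apply: rD.
  by rewrite (lt_le_trans t'0 z0) (le_lt_trans zt).
- by move=> z zt Oz; apply: nt'; exists z.
- by move=> z zt Oz; apply: nt; exists z.
- by rewrite !ltW.
Qed.

(** As in [small_levels_hit], with the two avoided levels in the opposite
  order. *)
Lemma large_levels_hit (O : set Rb) (p : Rb) (r : R) :
  open O -> connected O -> O p -> ~ D p ->
  (forall y, r < `|y| -> D' (fin_pt y)) ->
  (forall e, exists2 y, e < `|y| & O (g (fin_pt y))) ->
  exists r', forall t, r' < t -> hits O 0 t.
Proof.
move=> oO cO Op nDp rD acc.
have [H|] := pselect (forall t, r < t -> hits O 0 t); first by exists r.
move=> /existsNP[t /not_implyP[tr nt]].
have [y yt Oy] := acc t.
exists `|y| => // t' t'y; apply: contrapT => nt'.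
apply: (@shell_trap O p 0 t t') Oy => //.
- by move=> z /andP[z0 zt]; apply: rD; rewrite subr0 in z0; exact: lt_le_trans z0.
- by move=> z zt Oz; apply: nt; exists z.
- by move=> z zt Oz; apply: nt'; exists z.
- by rewrite subr0 !ltW.
Qed.

End trap.

(** * Paths crossing a ring *)

Lemma first_hit (R : realType) (psi : R -> R) (L r : R) : continuous psi ->
  0 <= L -> psi 0 < r -> r <= psi L ->
  exists b, [/\ 0 < b, b <= L, psi b = r & forall t, 0 <= t -> t < b -> psi t < r].
Proof.
move=> cpsi L0 p0 pL.
pose S := [set t | 0 <= t <= L /\ r <= psi t].
have S0 : S !=set0 by exists L; split => //; rewrite L0 lexx.
have Slb : lbound S 0 by move=> t [/andP[]].
have hS : has_inf S by split => //; exists 0.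
pose b := inf S.
have b0 : 0 <= b by exact: lb_le_inf.
have bL : b <= L by apply: ge_inf; [exists 0|split => //; rewrite L0 lexx].
have Sb t : S t -> b <= t by apply: ge_inf; exists 0.
have rb : r <= psi b.
  rewrite leNgt; apply/negP => pb.
  have /cvgrPdist_lt /(_ (r - psi b)) := cpsi b.
  rewrite subr_gt0 => /(_ pb) /nbhs_ballP[e /= e0 He].
  have [t St te] := inf_adherent e0 hS.
  have bt := Sb t St.
  have := He t; rewrite /ball /= => /(_ _).
  have -> : `|b - t| < e by rewrite distrC ger0_norm ?subr_ge0 // ltrBlDl.
  move=> /(_ isT); rewrite ltr_norml => /andP[+ _]; case: St => _; lra.
have bne : b != 0 by apply/eqP => bz; move: rb; rewrite bz; lra.
have bpos : 0 < b by rewrite lt_neqAle eq_sym bne.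
exists b; split => //.
- have cw : {within `[0, b], continuous psi} by exact: continuous_subspaceT.
  have [|c cI pc] := @IVT R psi 0 b r b0 cw.
    by rewrite ge_min (ltW p0) /= le_max rb orbT.
  move: cI; rewrite in_itv /= => /andP[c0 cb].
  suff -> : b = c by [].
  apply/eqP; rewrite eq_le cb andbT; apply: Sb; split; last by rewrite pc.
  by rewrite c0 (le_trans cb).
- move=> t t0 tb; rewrite ltNge; apply/negP => rt.
  have : b <= t by apply: Sb; split => //; rewrite t0 (le_trans (ltW tb)).
  by rewrite leNgt tb.
Qed.

(** Take for [b] the first time at which the level [r2] is reached and for [a]
  the last time before [b] at which the level is [r1]. *)
Lemma crossing_interval (R : realType) (psi : R -> R) (L r1 r2 : R) :
  continuous psi -> 0 <= L -> r1 < r2 -> psi 0 < r1 -> r2 < psi L ->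
  exists a b, [/\ 0 <= a, a < b & b <= L] /\
    [/\ psi a = r1, psi b = r2 & forall t, a < t -> t < b -> r1 < psi t < r2].
Proof.
move=> cpsi L0 r12 p0 pL.
have [b [b0 bL pb bt]] := first_hit cpsi L0 (lt_trans p0 r12) (ltW pL).
have c' : continuous (fun t => - psi (b - t)).
  move=> t; apply: cvgN; apply: (@continuous_comp _ _ _ (fun t => b - t) psi).
    exact: (cvgB (cvg_cst b) cvg_id).
  exact: cpsi.
have [||a' [a0 ab pa at']] := first_hit c' (ltW b0) (r := - r1).
- by rewrite subr0 pb ltrN2.
- by rewrite subrr lerN2 ltW.
exists (b - a'), b; split; split => //.
- by rewrite subr_ge0.
- by rewrite ltrBlDr ltrDl.
- by apply/eqP; rewrite -eqr_opp pa.
move=> t ta tb; apply/andP; split.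
  have := at' (b - t); rewrite opprB addrCA subrr addr0 ltrN2; apply.
    by rewrite subr_ge0 ltW.
  by rewrite ltrBlDr -ltrBlDl.
by apply: bt => //; apply: ltW; apply: le_lt_trans ta; rewrite subr_ge0.
Qed.

Section crossing.
Context {R : realType} {n : nat}.
Local Notation V := ('rV[R]_n).
Local Notation Rb := (Rbar R n).
Variables (D D' : set Rb) (g f : Rb -> Rb).
Hypothesis oD : open D.
Hypothesis oD' : open D'.
Hypothesis hgf : homeomorphism D' D g f.
Variables (x0 : V) (r1 r2 : R).
Hypothesis r12 : r1 < r2.

Definition ring_paths := image_paths D f
  (connecting_paths (@fin_pt R n @` esphere x0 r1) (@fin_pt R n @` esphere x0 r2)
     (@fin_pt R n @` eannulus x0 r1 r2)).

Let phi : Rb -> R := tdist x0 (r2 + 1).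

(** The truncation level [r2 + 1] exceeds [r2], so that infinity counts as
  far. *)
Definition near_set : set V := [set y | D' (fin_pt y) /\ phi (g (fin_pt y)) < r1].
Definition far_set : set V := [set y | D' (fin_pt y) /\ r2 < phi (g (fin_pt y))].

Let phi_fin (z : Rb) (r : R) : r < r2 + 1 -> phi z = r ->
  exists2 x, fin_pt x = z & enorm (x - x0) = r.
Proof.
case: z => [x|] rr /=; last by move=> rE; rewrite rE ltxx in rr.
move=> xr; exists x => //; move: xr; rewrite /Num.min; case: ifP => // _ rE.
by rewrite rE ltxx in rr.
Qed.

Let g_cont (y : V) : D' (fin_pt y) -> {for y, continuous (fun y => g (fin_pt y))}.
Proof.
move=> Dy; have [_ _ cg _] := hgf.
rewrite (continuous_open_subspace _ oD') in cg.
apply: (@continuous_comp _ _ _ (@fin_pt R n) g); first exact: fin_continuous.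
by apply: cg; rewrite inE.
Qed.

Let phig_cont (y : V) : D' (fin_pt y) -> {for y, continuous (fun y => phi (g (fin_pt y)))}.
Proof.
move=> Dy; apply: (@continuous_comp _ _ _ (fun y => g (fin_pt y)) phi).
  exact: g_cont.
exact: tdist_continuous.
Qed.

Lemma open_near_set : open near_set.
Proof.
rewrite openE => y [Dy py].
have oN : nbhs y (fun y => D' (fin_pt y)).
  by apply: open_nbhs_nbhs; split => //; exact: open_fin_preimage.
have pN : nbhs (phi (g (fin_pt y))) [set t | t < r1] by apply: open_nbhs_nbhs; split => //; exact: open_lt.
exact: filterI oN (phig_cont Dy pN).
Qed.

Lemma open_far_set : open far_set.
Proof.
rewrite openE => y [Dy py].
have oN : nbhs y (fun y => D' (fin_pt y)).
  by apply: open_nbhs_nbhs; split => //; exact: open_fin_preimage.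
have pN : nbhs (phi (g (fin_pt y))) [set t | r2 < t] by apply: open_nbhs_nbhs; split => //; exact: open_gt.
exact: filterI oN (phig_cont Dy pN).
Qed.

Lemma near_far_disjoint : near_set `&` far_set = set0.
Proof.
by apply/seteqP; split => // y [[_ a] [_ b]]; have := lt_trans (lt_trans b a) r12; rewrite ltxx.
Qed.

(** Along the path the truncated distance of [g] to [x0] crosses from below [r1]
  to above [r2]. The part between the last exit at [r1] and the first arrival at
  [r2] is the [f]-image of a path in the annulus, and the rest of the path only
  adds to the integral of [rho]. *)
Lemma admissible_crossing (c : V) (s' s : R) (rho : V -> \bar R) :
  (forall y, s' <= `|y - c| <= s -> D' (fin_pt y)) ->
  admissible ring_paths rho ->
  crossing_admissible c s' s near_set far_set rho.
Proof.
move=> shell [rho0 mrho adm] h m w x h0 w1 inshell [_ nx] [_ fx].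
pose q t := x + axis_path h m w t.
have Dq t : D' (fin_pt (q t)) by apply: shell; exact: inshell.
have cq : continuous q.
  by move=> t; apply: (@cvgD _ 'rV[R]_n); [exact: cvg_cst|exact: axis_path_continuous].
pose psi t := phi (g (fin_pt (q t))).
have cpsi : continuous psi.
  move=> t; apply: (@continuous_comp _ _ _ q (fun y => phi (g (fin_pt y)))); first exact: cq.
  exact: phig_cont.
have L0 : 0 <= m%:R * h by rewrite mulr_ge0 // ltW.
have p0 : psi 0 < r1 by rewrite /psi /q (axis_path0 m w h0) addr0.
have [a [b [[a0 ab bL] [pa pb pt]]]] := crossing_interval cpsi L0 r12 p0 fx.
apply: le_trans (axis_path_line_integral h0 w1 x mrho rho0 a0 (ltW ab) bL).
apply: adm => //; last first.
  rewrite /rectifiable /= (_ : finite_trace _ = fun t => x + axis_path h m w t) //.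
  by rewrite axis_path_arc_length // ?ltry // ltW.
exists (Curve a b (fun t => g (fin_pt (q t)))); last first.
  congr Curve; apply/funext => t /=.
  by have [_ ->] := homeomorphism_gf hgf (Dq t).
split => /=; last by move=> t _; have [] := homeomorphism_gf hgf (Dq t).
have r2M : r2 < r2 + 1 by rewrite ltrDl.
split => //=.
- apply: continuous_subspaceT => t.
  by apply: (@continuous_comp _ _ _ q (fun y => g (fin_pt y))); [exact: cq|exact: g_cont].
- by have [y yE ye] := phi_fin (lt_trans r12 r2M) pa; exists y.
- by have [y yE ye] := phi_fin r2M pb; exists y.
move=> t /andP[ta tb]; have /andP[t1 t2] := pt t ta tb.
have [y yE ye] := phi_fin (lt_trans t2 r2M) (erefl (psi t)).
by exists y => //; rewrite /eannulus /= ye t1.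
Qed.

End crossing.

Section upper_bound.
Context {R : realType}.

Lemma integral_cst_completed (r1 r2 : R) : r1 < r2 ->
  (\int[@completed_lebesgue_measure R]_(r in `]r1, r2[) ((r2 - r1)^-1)%:E = 1)%E.
Proof.
move=> r12.
have mI : measurable (`]r1, r2[%classic : set (lebesgueR R)).
  by apply: sub_caratheodory; exact: measurable_itv.
rewrite (integral_cst (@completed_lebesgue_measure R) mI).
apply: (@etrans _ _ (((r2 - r1)^-1)%:E * (r2 - r1)%:E)%E); last first.
  by rewrite -EFinM mulVf // gt_eqF // subr_gt0.
congr (_ * _)%E; change (lebesgue_measure (`]r1, r2[%classic : set R) = (r2 - r1)%:E).
by rewrite lebesgue_measure_itv /= lte_fin r12 -EFinD.
Qed.

(** [Q] vanishes outside [D], so the annulus may be replaced by [D]. *)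
Lemma ring_integral_bound n (Q : 'rV[R]_n -> \bar R) (D : set (Rbar R n)) (x0 : 'rV[R]_n)
    (r1 r2 k : R) :
  open D -> (forall x, (0 <= Q x)%E) ->
  measurable_fun [set: lebesgueRn R n] Q ->
  (forall x, ~ D (fin_pt x) -> Q x = 0%E) -> 0 <= k ->
  (\int[@lebesgue_measureRn R n]_(x in eannulus x0 r1 r2) (Q x * k%:E ^+ n) <=
   (k ^+ n)%:E * \int[@lebesgue_measureRn R n]_(x in [set x | D (fin_pt x)]) Q x)%E.
Proof.
move=> oD Q0 mQ Qout k0.
have kn0 : (0 <= (k ^+ n)%:E :> \bar R)%E by rewrite lee_fin exprn_ge0.
have oA : open (eannulus x0 r1 r2).
  have cn : continuous (fun x : 'rV[R]_n => enorm (x - x0)).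
    move=> x; apply: (@continuous_comp _ _ _ (fun x : 'rV[R]_n => x - x0) (@enorm R n)).
      exact: (cvgB cvg_id (cvg_cst x0)).
    exact: continuous_enorm.
  rewrite (_ : eannulus _ _ _ = [set x | r1 < enorm (x - x0)] `&` [set x | enorm (x - x0) < r2]).
    apply: openI.
      apply: (@open_comp _ _ (fun x : 'rV[R]_n => enorm (x - x0)) [set s : R | r1 < s]); last exact: open_gt.
      by move=> x _; exact: cn.
    apply: (@open_comp _ _ (fun x : 'rV[R]_n => enorm (x - x0)) [set s : R | s < r2]); last exact: open_lt.
    by move=> x _; exact: cn.
  by apply/seteqP; split => x; rewrite /eannulus /=; [move=> /andP[? ?]; split|move=> [? ?]; apply/andP; split].
have mA := open_lebesgue oA.
have mD : measurable ([set x | D (fin_pt x)] : set (lebesgueRn R n)).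
  by apply: open_lebesgue; exact: open_fin_preimage.
have mQA : measurable_fun (eannulus x0 r1 r2 : set (lebesgueRn R n)) Q by exact: measurable_funTS.
have E1 : (\int[@lebesgue_measureRn R n]_(x in eannulus x0 r1 r2) (Q x * k%:E ^+ n) =
   (k ^+ n)%:E * \int[@lebesgue_measureRn R n]_(x in eannulus x0 r1 r2) Q x)%E.
  under eq_integral do rewrite -EFin_expe muleC.
  by apply: ge0_integralZl => // x _.
rewrite E1; apply: lee_wpmul2l => //.
rewrite integral_mkcond [leRHS]integral_mkcond.
apply: (@ge0_le_integral _ (lebesgueRn R n) R (@lebesgue_measureRn R n) setT measurableT
  (Q \_ (eannulus x0 r1 r2)) (Q \_ [set x | D (fin_pt x)])).
- by move=> x _; rewrite patchE; case: ifP.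
- exact: (measurable_restrictT _ mA).1.
- by apply: (measurable_restrictT _ mD).1; exact: measurable_funTS.
move=> x _; rewrite !patchE; case: ifPn => [_|_]; case: ifPn => //.
by rewrite notin_setE /= => /Qout ->.
Qed.

End upper_bound.

(** * Cluster points at an isolated boundary point *)

Section Rbar_balls.
Context {R : realType} {n : nat}.
Local Notation V := ('rV[R]_n).
Local Notation Rb := (Rbar R n).

Lemma enorm_gt0 (x : V) : x != 0 -> 0 < enorm x.
Proof. by rewrite -normr_gt0 => x0; exact: lt_le_trans x0 (norm_le_enorm x). Qed.

Lemma connected_near (c : V) (M r : R) : 0 < r -> r < M ->
  connected [set z : Rb | tdist c M z < r].
Proof.
move=> r0 rM; rewrite (_ : [set _ | _] = @fin_pt R n @` [set x | enorm (x - c) < r]).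
  apply: connected_continuous_connected; last by apply: continuous_subspaceT; exact: fin_continuous.
  exact: (connected_ball (@enormZ R n) enorm_gt0).
apply/seteqP; split=> [[x|] /=|_ [x /= xr <-]] /=; last by rewrite gt_min xr.
  by rewrite gt_min => /orP[xr|Mr]; [exists x|have := lt_trans rM Mr; rewrite ltxx].
by move=> Mr; have := lt_trans rM Mr; rewrite ltxx.
Qed.

Lemma infty_closure (c : V) (s : R) : (0 < n)%N -> 0 <= s ->
  closure (@fin_pt R n @` [set x | s < enorm (x - c)]) (infty_pt R n).
Proof.
move=> n0 s0 U /nbhs_infty[e e0 eU].
(* A point whose coordinates exceed both [e] and [s + |c|]. *)
pose x : V := const_mx (e + s + `|c| + 1).
have c0 := normr_ge0 c.
have xe : e + s + `|c| + 1 <= `|x|.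
  have := coord_le_norm x (Ordinal n0); rewrite mxE; apply: le_trans.
  exact: ler_norm.
exists (fin_pt x); split; last by apply: eU; lra.
exists x => //=; apply: lt_le_trans (norm_le_enorm _).
by apply: lt_le_trans (lerB_dist _ _); lra.
Qed.

(** The finite points form a connected exterior; infinity is added with the
  closure of a smaller exterior. *)
Lemma connected_far (c : V) (M r : R) : (2 <= n)%N -> 0 <= r -> r < M ->
  connected [set z : Rb | r < tdist c M z].
Proof.
move=> hn r0 rM.
pose ext s := @fin_pt R n @` [set x | s < enorm (x - c)].
have cext s : 0 <= s -> connected (ext s).
  move=> s0; apply: connected_continuous_connected; last first.
    by apply: continuous_subspaceT; exact: fin_continuous.
  exact: (connected_exterior hn (@continuous_enorm R n) (@enormZ R n) enorm_gt0).
pose s := (r + M) / 2.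
have rs : r < s by rewrite /s; lra.
have sM : s < M by rewrite /s; lra.
have s0 : 0 <= s by lra.
have cl : closure (ext s) `<=` [set z | s <= tdist c M z].
  have cS : closed [set z : Rb | s <= tdist c M z].
    apply: (@closed_comp _ _ (tdist c M) [set t : R | s <= t]); last exact: closed_ge.
    by move=> z _; exact: tdist_continuous.
  rewrite [X in _ `<=` X]((closure_id _).1 cS); apply: closure_subset.
  by move=> _ [x /= xs <-] /=; rewrite le_min (ltW xs) ltW.
have n0 : (0 < n)%N by exact: ltnW.
rewrite (_ : [set _ | _] = ext r `|` closure (ext s)).
  apply: connectedU; [|exact: cext|by apply: connected_closure; exact: cext].
  have [z [Ez _]] := infty_closure c n0 s0 filterT.
  exists z; split; last exact: subset_closure.
  by case: Ez => x /= xs <-; exists x => //=; exact: lt_trans xs.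
apply/seteqP; split=> [[x|] /= xr|z [[x /= xr <-]|/cl /=]] /=.
- by left; exists x => //=; move: xr; rewrite lt_min => /andP[].
- by right; exact: infty_closure.
- by rewrite lt_min xr.
- exact: lt_le_trans.
Qed.

(** Rbar is compact and Hausdorff, so a filter with a single cluster point
  converges to it. *)
Lemma Rbar_cluster (F : set_system Rb) : ProperFilter F ->
  (exists l : Rb, F --> l) \/ exists p q, [/\ p <> q, cluster F p & cluster F q].
Proof.
move=> PF; have cT : compact [set: Rb] by exact: one_point_compactification_compact.
have [p [_ Fp]] := cT F PF filterT.
have [[q [Fq pq]]|nq] := pselect (exists q, cluster F q /\ p <> q).
  by right; exists p, q.
left; exists p; apply: (compact_cluster_set1 Rbar_hausdorff cT filterT PF filterT).
apply/seteqP; split=> [q Fq|_ -> //].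
by apply: contrapT => qp; apply: nq; exists q; split => // pq; apply: qp; rewrite pq.
Qed.

End Rbar_balls.

Section two_clusters.
Context {R : realType} {n : nat}.
Hypothesis hn : (2 <= n)%N.
Local Notation V := ('rV[R]_n).
Local Notation Rb := (Rbar R n).
Variables (D D' : set Rb) (g f : Rb -> Rb).
Hypothesis oD : open D.
Hypothesis oD' : open D'.
Hypothesis hgf : homeomorphism D' D g f.
Variable y0 : Rb.
Hypothesis y0D' : ~ D' y0.

Let F := g @ within D' (nbhs y0).

Let F_image (W : set Rb) : nbhs y0 W -> F (g @` (D' `&` W)).
Proof.
move=> y0W; change (nbhs y0 [set y | D' y -> (g @` (D' `&` W)) (g y)]).
by apply: filterS y0W => y Wy Dy; exists y.
Qed.

(** Cluster points are limits of values of [g], hence in the closure of [D]. At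
  a cluster point [p] in [D], continuity of [f] would make [f p] and [y0]
  inseparable, although only [f p] is in [D']. *)
Lemma cluster_boundary p : cluster F p -> boundary D p.
Proof.
move=> Fp; have image_sub W : g @` (D' `&` W) `<=` D.
  by move=> _ [y [Dy _] <-]; have [] := homeomorphism_gf hgf Dy.
split.
  move=> B pB; have [z [/image_sub Dz Bz]] := Fp _ _ (F_image filterT) pB.
  by exists z.
rewrite ((interior_id D).1 oD) => Dp.
have [Dfp _] := homeomorphism_fg hgf Dp.
apply: y0D'; rewrite -(_ : f p = y0) //; apply: Rbar_hausdorff => A B fpA y0B.
have pA : nbhs p (D `&` f @^-1` A).
  apply: filterI; first exact: open_nbhs_nbhs.
  have [_ _ _ cf] := hgf; rewrite (continuous_open_subspace _ oD) in cf.
  by apply: cf; rewrite ?inE.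
have [_ [[y [Dy By] <-] [_ Ay]]] := Fp _ _ (F_image y0B) pA.
exists y; split => //; move: Ay.
by rewrite /= (homeomorphism_gf hgf Dy).2.
Qed.

Lemma cluster_finite (c : V) (p : Rb) (U : set Rb) : y0 = fin_pt c -> cluster F p ->
  open U -> U p -> forall e, 0 < e -> exists2 y, 0 < `|y - c| < e & U (g (fin_pt y)).
Proof.
move=> y0c Fp oU Up e e0.
have y0e : nbhs y0 (@fin_pt R n @` [set z | `|z - c| < e]) by rewrite y0c; exact: fin_nbhs.
have [_ [[w [Dw [y /= ye yw]] <-] Uw]] := Fp _ _ (F_image y0e) (open_nbhs_nbhs (conj oU Up)).
exists y; last by rewrite yw.
rewrite ye andbT normr_gt0 subr_eq0; apply/eqP => yc.
by apply: y0D'; rewrite y0c -yc yw.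
Qed.

Lemma cluster_infty (p : Rb) (U : set Rb) : y0 = infty_pt R n -> cluster F p ->
  open U -> U p -> forall e, exists2 y, e < `|y| & U (g (fin_pt y)).
Proof.
move=> y0c Fp oU Up e.
have y0e : nbhs y0 ((@fin_pt R n @` [set z | e < `|z|]) `|` [set infty_pt R n]).
  by rewrite y0c; exact: infty_nbhs.
have [_ [[w [Dw [[y /= ye yw]|wE]] <-] Uw]] := Fp _ _ (F_image y0e) (open_nbhs_nbhs (conj oU Up)).
  by exists y => //; rewrite yw.
by case: y0D'; rewrite y0c -wE.
Qed.

Hypothesis iso : isolated (boundary D') y0.

(** Finite and infinite [y0] lead to the same conclusion: a dilation factor
  [2 ^+ p] is available near a finite point by taking [s'] small, and near
  infinity by taking it large. *)
Lemma common_levels (U1 U2 : set Rb) (q1 q2 : Rb) (p : nat) :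
  open U1 -> connected U1 -> U1 q1 -> cluster F q1 ->
  open U2 -> connected U2 -> U2 q2 -> cluster F q2 ->
  exists c s', [/\ 0 < s',
    forall y, s' <= `|y - c| <= s' * 2 ^+ p -> D' (fin_pt y),
    forall t, s' <= t <= s' * 2 ^+ p -> exists2 y, `|y - c| = t & U1 (g (fin_pt y)) &
    forall t, s' <= t <= s' * 2 ^+ p -> exists2 y, `|y - c| = t & U2 (g (fin_pt y))].
Proof.
move=> oU1 cU1 U1q F1 oU2 cU2 U2q F2.
have nD1 : ~ D q1 by have [_] := cluster_boundary F1; rewrite ((interior_id D).1 oD).
have nD2 : ~ D q2 by have [_] := cluster_boundary F2; rewrite ((interior_id D).1 oD).
have P0 : 0 < 2 ^+ p :> R by rewrite exprn_gt0.
case E : y0 => [c|].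
  have y0E : y0 = fin_pt c by [].
  have [|e e0 eD] := isolated_boundary_finite (y := c) hn oD' _; first by rewrite -y0E.
  have [a a0 aH] := small_levels_hit oD hgf oU1 cU1 U1q nD1 e0 eD (cluster_finite y0E F1 oU1 U1q).
  have [b b0 bH] := small_levels_hit oD hgf oU2 cU2 U2q nD2 e0 eD (cluster_finite y0E F2 oU2 U2q).
  pose s := Num.min e (Num.min a b) / 2.
  have s0 : 0 < s by rewrite divr_gt0 // !lt_min e0 a0 b0.
  have [se sa sb] : [/\ s < e, s < a & s < b].
    have H : s < Num.min e (Num.min a b) by rewrite /s; move: s0; rewrite /s; lra.
    by move: H; rewrite !lt_min => /andP[? /andP[? ?]].
  have s's : s / 2 ^+ p * 2 ^+ p = s by rewrite divfK // gt_eqF.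
  have s'0 : 0 < s / 2 ^+ p by rewrite divr_gt0.
  exists c, (s / 2 ^+ p); rewrite s's; split => //.
  - by move=> y /andP[y1 y2]; apply: eD; rewrite (lt_le_trans s'0 y1) (le_lt_trans y2).
  - by move=> t /andP[y1 y2]; apply: aH; rewrite (lt_le_trans s'0 y1) (le_lt_trans y2).
  - by move=> t /andP[y1 y2]; apply: bH; rewrite (lt_le_trans s'0 y1) (le_lt_trans y2).
have y0E : y0 = infty_pt R n by [].
have [|e e0 eD] := isolated_boundary_infty hn oD' _; first by rewrite -y0E.
have [a aH] := large_levels_hit oD hgf oU1 cU1 U1q nD1 eD (cluster_infty y0E F1 oU1 U1q).
have [b bH] := large_levels_hit oD hgf oU2 cU2 U2q nD2 eD (cluster_infty y0E F2 oU2 U2q).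
pose s := Num.max e (Num.max a b) + 1.
have : Num.max e (Num.max a b) < s by rewrite ltrDl.
rewrite !gt_max => /andP[se /andP[sa sb]].
exists 0, s; split; first exact: lt_trans se.
- by move=> y /andP[y1 _]; apply: eD; rewrite subr0 in y1; exact: lt_le_trans y1.
- by move=> t /andP[y1 _]; apply: aH; exact: lt_le_trans y1.
- by move=> t /andP[y1 _]; apply: bH; exact: lt_le_trans y1.
Qed.

End two_clusters.

Section contradiction.
Context {R : realType} {d : nat}.
Local Notation n := d.+1.
Hypothesis hn : (2 <= n)%N.
Local Notation V := ('rV[R]_n).
Local Notation Rb := (Rbar R n).
Variables (D D' : set Rb) (Q : V -> \bar R) (g f : Rb -> Rb).
Hypothesis oD : open D.
Hypothesis oD' : open D'.
Hypothesis hgf : homeomorphism D' D g f.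
Variable y0 : Rb.
Hypothesis y0D' : ~ D' y0.
Hypothesis iso : isolated (boundary D') y0.

Let F := g @ within D' (nbhs y0).

(** The number [p] of doublings of the radius in [ring_lower_bound] is
  arbitrary. *)
Lemma ring_modulus_infty (x0 : V) (r1 r2 : R) (q : Rb) : 0 < r1 -> r1 < r2 ->
  r2 < tdist x0 (r2 + 1) q -> cluster F (fin_pt x0) -> cluster F q ->
  modulus (ring_paths D f x0 r1 r2) = +oo%E.
Proof.
move=> r10 r12 r2q F1 F2; apply/eqyP => K K0.
pose U1 := [set z : Rb | tdist x0 (r2 + 1) z < r1].
pose U2 := [set z : Rb | r2 < tdist x0 (r2 + 1) z].
have r2M : r2 < r2 + 1 by rewrite ltrDl.
have oU1 : open U1.
  apply: (@open_comp _ _ (tdist x0 (r2 + 1)) [set t : R | t < r1]); last exact: open_lt.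
  by move=> z _; exact: tdist_continuous.
have oU2 : open U2.
  apply: (@open_comp _ _ (tdist x0 (r2 + 1)) [set t : R | r2 < t]); last exact: open_gt.
  by move=> z _; exact: tdist_continuous.
have U1x : U1 (fin_pt x0) by rewrite /U1 /= subrr enorm0 gt_min r10.
have c0 := ring_cst_gt0 R d.
have [p Kp] : exists p : nat, K <= p%:R * ring_cst R d.
  exists (Num.truncn (K / ring_cst R d)).+1.
  by rewrite -ler_pdivrMr // ltW // truncnS_gt.
have [c [s' [s0 shell hit1 hit2]]] := common_levels hn oD oD' hgf y0D' iso p
  oU1 (connected_near r10 (lt_trans r12 r2M)) U1x F1
  oU2 (connected_far hn (ltW (lt_trans r10 r12)) r2M) r2q F2.
apply: le_ereal_inf_tmp => _ [rho adm <-].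
apply: (@le_trans _ _ (p%:R * ring_cst R d)%:E); first by rewrite lee_fin.
have [rho0 mrho _] := adm.
have lev1 t : s' <= t <= s' * 2 ^+ p -> exists2 y, near_set D' g x0 r1 r2 y & `|y - c| = t.
  move=> tI; have [y yt Uy] := hit1 t tI; exists y => //; split => //.
  by apply: shell; rewrite yt.
have lev2 t : s' <= t <= s' * 2 ^+ p -> exists2 y, far_set D' g x0 r2 y & `|y - c| = t.
  move=> tI; have [y yt Uy] := hit2 t tI; exists y => //; split => //.
  by apply: shell; rewrite yt.
have adm' := admissible_crossing oD' hgf r12 shell adm.
have disj := near_far_disjoint D' g x0 r12.
have o1 : open (near_set D' g x0 r1 r2) by apply: (open_near_set oD' hgf).
have o2 : open (far_set D' g x0 r2) by apply: (open_far_set oD' hgf).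
exact: (ring_lower_bound hn s0 o1 o2 disj lev1 lev2 mrho rho0 adm').
Qed.

Hypothesis Q_ge0 : forall x, (0 <= Q x)%E.
Hypothesis Q_meas : measurable_fun [set: lebesgueRn R n] Q.
Hypothesis Q_out : forall x, ~ D (fin_pt x) -> Q x = 0%E.
Hypothesis Q_L1 : (\int[@lebesgue_measureRn R n]_(x in [set x | D (fin_pt x)]) Q x < +oo)%E.

(** Otherwise the ring inequality for a constant function would bound an
  infinite modulus by a multiple of the integral of [Q]. *)
Lemma finite_cluster_unique (x0 : V) (q : Rb) :
  ring_Q_homeomorphism_at_finite D Q f x0 ->
  cluster F (fin_pt x0) -> cluster F q -> q = fin_pt x0.
Proof.
move=> [_ [r0 r00 ring]] F1 F2; apply: contrapT => qx.
(* If [q] is infinity, any radius will do. *)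
pose e := if q is Some x then enorm (x - x0) else 1.
have e0 : 0 < e.
  rewrite /e; case: (q) qx => [x xx|//]; apply: enorm_gt0.
  by rewrite subr_eq0; apply/eqP => xE; apply: xx; rewrite xE.
pose r2 := Num.min r0 e / 2; pose r1 := r2 / 2.
have m0 : 0 < Num.min r0 e by rewrite lt_min r00.
have r20 : 0 < r2 by rewrite divr_gt0.
have r10 : 0 < r1 by rewrite divr_gt0.
have r12 : r1 < r2 by rewrite /r1; lra.
have : r2 < Num.min r0 e by rewrite /r2; lra.
rewrite lt_min => /andP[r2r0 r2e].
have r2M : r2 < r2 + 1 by rewrite ltrDl.
have r2q : r2 < tdist x0 (r2 + 1) q.
  by move: r2e; rewrite /e; case: (q) => [x|_] //=; rewrite lt_min => ->.
have k0 : 0 <= (r2 - r1)^-1 by rewrite invr_ge0 subr_ge0 ltW.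
have H : (modulus (ring_paths D f x0 r1 r2) <= \int[@lebesgue_measureRn R n]_(x in eannulus x0 r1 r2)
    (Q x * ((r2 - r1)^-1)%:E ^+ n))%E.
  apply: (ring r1 r2 r10 r12 r2r0 (fun=> ((r2 - r1)^-1)%:E)).
  - exact: measurable_cst.
  - by move=> r _; rewrite lee_fin.
  - by rewrite integral_cst_completed.
rewrite (ring_modulus_infty r10 r12 r2q F1 F2) in H.
have := le_trans H (ring_integral_bound x0 r1 r2 oD Q_ge0 Q_meas Q_out k0).
rewrite leye_eq => /eqP I.
have I0 : (0 <= \int[@lebesgue_measureRn R n]_(x in [set x | D (fin_pt x)]) Q x)%E.
  by apply: integral_ge0.
have : (((r2 - r1)^-1 ^+ n)%:E *
    \int[@lebesgue_measureRn R n]_(x in [set x | D (fin_pt x)]) Q x < +oo)%E.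
  by apply: lte_mul_pinfty => //; rewrite lee_fin exprn_ge0.
by rewrite I ltxx.
Qed.

End contradiction.

Lemma continuous_extension (T : topologicalType) (U : topologicalType) (A : set T)
    (g : T -> U) (y0 : T) (l : U) : open A -> ~ A y0 ->
  {within A, continuous g} -> g @ within A (nbhs y0) --> l ->
  exists gbar : T -> U, {within A `|` [set y0], continuous gbar} /\
    forall y, A y -> gbar y = g y.
Proof.
move=> oA nAy cg gl; pose gbar y := if y == y0 then l else g y.
have gbarE y : A y -> gbar y = g y.
  by rewrite /gbar => Ay; case: eqP => // yE; rewrite yE in Ay.
have gbar0 : gbar y0 = l by rewrite /gbar eqxx.
exists gbar; split => //; rewrite continuous_subspace_in => x; rewrite inE => Ax W xW.
rewrite (continuous_open_subspace _ oA) in cg.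
have sub : within (A `|` [set y0]) (nbhs x) `<=` nbhs (x : subspace (A `|` [set y0])).
  by rewrite (nbhs_subspace_in Ax).
apply: sub; have {}xW : nbhs (gbar x) W by exact: xW.
case: Ax xW => [Ax|->].
  rewrite gbarE // => xW.
  have N : nbhs x (A `&` g @^-1` W).
    by apply: filterI; [exact: open_nbhs_nbhs|apply: cg => //; rewrite inE].
  apply: (filterS (P := A `&` g @^-1` W)) N => y [Ay Wy] _; change (W (gbar y)).
  by rewrite gbarE.
rewrite gbar0 => lW; have N : nbhs y0 [set y | A y -> W (g y)] by exact: gl.
apply: (filterS (P := [set y | A y -> W (g y)])) N => y Wy Ay; change (W (gbar y)).
case: Ay => [Ay|->].
  by rewrite gbarE //; exact: Wy.
by rewrite gbar0; exact: nbhs_singleton lW.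
Qed.

Unset Implicit Arguments.
Set Strict Implicit.
Set Printing Implicit Defensive.

Theorem mainTheorem1 (R : realType) (n : nat) (hn : (2 <= n)%N)
    (D D' : set (Rbar R n)) (hD : domain D) (hD' : domain D')
    (Q : 'rV[R]_n -> \bar R)
    (Q_ge0 : forall x, (0 <= Q x)%E)
    (Q_meas : measurable_fun [set: lebesgueRn R n] Q)
    (Q_out : forall x : 'rV[R]_n, ~ D (fin_pt x) -> Q x = 0%E)
    (g f : Rbar R n -> Rbar R n)
    (hgf : homeomorphism D' D g f)
    (hf : forall x0, boundary D x0 -> ring_Q_homeomorphism_at D Q f x0)
    (Q_L1 : (\int[@lebesgue_measureRn R n]_(x in [set x | D (fin_pt x)]) Q x
               < +oo)%E)
    (y0 : Rbar R n) (hy0 : isolated (boundary D') y0) :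
  exists gbar : Rbar R n -> Rbar R n,
    {within D' `|` [set y0], continuous gbar} /\
    (forall y, D' y -> gbar y = g y).
Proof.
destruct n as [|d]; first by [].
have [_ oD _] := hD; have [_ oD' _] := hD'.
have [/set_mem[y0cl y0int] _] := hy0.
have y0D' : ~ D' y0 by rewrite ((interior_id D').1 oD') in y0int.
have [_ _ cg _] := hgf.
have PF : ProperFilter (within D' (nbhs y0)) by exact: within_nbhs_proper.
have [[l gl]|[p [q [pq Fp Fq]]]] := Rbar_cluster (fmap_proper_filter g PF).
  exact: continuous_extension gl.
have unique (x0 : 'rV[R]_d.+1) z : cluster (g @ within D' (nbhs y0)) (fin_pt x0) ->
    cluster (g @ within D' (nbhs y0)) z -> z = fin_pt x0.
  move=> F1; apply: (finite_cluster_unique hn oD oD' hgf y0D' hy0 Q_ge0 Q_meas Q_out Q_L1) => //.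
  exact: hf _ (cluster_boundary oD hgf y0D' F1).
exfalso; apply: pq.
case: p q Fp Fq => [x|] [y|] // Fp Fq.
- exact/esym/(unique x _ Fp Fq).
- exact/esym/(unique x _ Fp Fq).
- exact: (unique y _ Fq Fp).
Qed.
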